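(* Let $t=2t'+1$ be an odd positive integer. Let $u',v'$ be nonnegative integers, let $j_u,k_u$ ($1\le u\le u'$) and $j'_v,k'_v$ ($1\le v\le v'$) be nonnegative integers, and let $\alpha$ be a given $t$-core doubled distinct partition. Then there exists some $r\in\mathbb{N}$ such that $$D_t^r\Biggl(G_\lambda\Biggl(\prod_{u=1}^{u'}\sum_{\substack{\square\in\lambda\\ h_\square\equiv\pm j_u\ (\mathrm{mod}\ t)}}h_\square^{2k_u}\Biggr)\Biggl(\prod_{v=1}^{v'}\sum_{\substack{\square\in\lambda\\ c_\square\equiv j'_v\ (\mathrm{mod}\ t)}}c_\square^{k'_v}\Biggr)\Biggr)=0$$ for every doubled distinct partition $\lambda$ with $\lambda_{t\text{-core}}=\alpha$. Moreover, for any given doubled distinct partition $\mu$, $$\sum_{\substack{\lambda\in\mathcal{DD},\ \lambda\ge_t\mu\\ |\lambda/\mu|=2nt}}F_{\lambda/\mu}\,G_\lambda\Biggl(\prod_{u=1}^{u'}\sum_{\substack{\square\in\lambda\\ h_\square\equiv\pm j_u\ (\mathrm{mod}\ t)}}h_\square^{2k_u}\Biggr)\Biggl(\prod_{v=1}^{v'}\sum_{\substack{\square\in\lambda\\ c_\square\equiv j'_v\ (\mathrm{mod}\ t)}}c_\square^{k'_v}\Biggr)$$ is a polynomial in $n$ of degree at most $\sum_{u=1}^{u'}(k_u+1)+\sum_{v=1}^{v'}\frac{k'_v+2}{2}$.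
   Context: Ordinary partitions are identified with Young diagrams (boxes $(i,j)$, row $i$, column $j$, $1\le j\le\lambda_i$); $h_\square$ is the usual hook length and $c_\square=j-i$ the content of a box $\square=(i,j)$ of $\lambda$; $H(\lambda)$ is the product of all hook lengths; $|\lambda|$ is the size, $|\lambda/\mu|=|\lambda|-|\mu|$; the convention $0^0=1$ is used. A condition $h\equiv\pm j$ means $h\equiv j$ or $h\equiv -j$, each box being counted once. Strict partitions: finite strictly decreasing sequences of positive integers $\bar\lambda=(\bar\lambda_1,\dots,\bar\lambda_\ell)$ (possibly empty), $\ell(\bar\lambda)=\ell$, $\bar\lambda_i=0$ for $i>\ell$. The shifted Young diagram of $\bar\lambda$ consists of the boxes $(i,j)$ with $1\le i\le\ell$, $i+1\le j\le i+\bar\lambda_i$. The hook length of a box $(i,j)$ of it is the number of boxes $(i,j'')$ with $j''>j$, plus the number of boxes $(i'',j)$ with $i''>i$, plus $1$, plus $\bar\lambda_j$; $H(\bar\lambda)$ is the product of all these hook lengths. The doubled distinct partition $\bar\lambda\bar\lambda$ is the ordinary partition obtained from the shifted diagram by adding the boxes $(k,i)$, $i\le k\le i+\bar\lambda_i-1$, for each $1\le i\le\ell$. $\mathcal{DD}$ is the set of doubled distinct partitions. Littlewood decomposition. Encode a partition $\lambda$ by the bi-infinite binary word of its boundary (English convention), read from bottom-left to top-right with each vertical edge coded $0$ and each horizontal edge coded $1$ (so it begins with infinitely many $0$'s and ends with infinitely many $1$'s), indexed as $(a_i)_{i\in\mathbb{Z}}$ so that $\#\{i\le-1:a_i=1\}=\#\{i\ge0:a_i=0\}$.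 For $0\le i\le t-1$, $\lambda^i$ is the partition encoded by the word $(a_{tk+i})_{k\in\mathbb{Z}}$ (up to a shift of index), and $\lambda_{t\text{-core}}$ is the $t$-core (partition with no hook length equal to $t$) obtained by rearranging, within each residue class mod $t$, the word so that all $0$'s precede all $1$'s (keeping, in each class, $\#\{k\ge0:0\}-\#\{k<0:1\}$ unchanged). For $t=2t'+1$ odd, this identifies $\lambda\in\mathcal{DD}$ with $(\lambda_{t\text{-core}};\lambda^0,\dots,\lambda^{t-1})$ where $\lambda_{t\text{-core}}\in\mathcal{DD}$ is a $t$-core, $\lambda^0=\bar\lambda^0\bar\lambda^0\in\mathcal{DD}$ and $\lambda^i$ is the conjugate of $\lambda^{t-i}$ for $1\le i\le t-1$; hence $\lambda$ is in bijective correspondence with $(\lambda_{t\text{-core}};\bar\lambda^0,\lambda^1,\dots,\lambda^{t'})$ with $\bar\lambda^0$ an arbitrary strict partition and $\lambda^1,\dots,\lambda^{t'}$ arbitrary partitions. For doubled distinct $\lambda,\mu$ write $\lambda\ge_t\mu$ if $\lambda_{t\text{-core}}=\mu_{t\text{-core}}$, $\bar\lambda^0\supseteq\bar\mu^0$ and $\lambda^i\supseteq\mu^i$ for $1\le i\le t'$ (containment of diagrams). Define $F_{\mu/\mu}=1$ and, for $\lambda\ge_t\mu$ with $\lambda\ne\mu$, $F_{\lambda/\mu}=\sum F_{\lambda^-/\mu}$, the sum over $\lambda^-\in\mathcal{DD}$ with $\lambda\ge_t\lambda^-\ge_t\mu$ and $|\lambda/\lambda^-|=2t$. Put $$G_\lambda=\frac{2^{N-\ell(\bar\lambda^0)}}{t^{N}H(\bar\lambda^0)\prod_{i=1}^{t'}H(\lambda^i)},\qquad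 N=|\bar\lambda^0|+\sum_{i=1}^{t'}|\lambda^i|.$$ For a function $g$ of doubled distinct partitions, $D_tg(\lambda)=\sum_{\lambda^+}g(\lambda^+)-g(\lambda)$, the sum over $\lambda^+\in\mathcal{DD}$ with $\lambda^+\ge_t\lambda$ and $|\lambda^+/\lambda|=2t$; $D_t^0g=g$, $D_t^kg=D_t(D_t^{k-1}g)$. *)

(* Defs.v *)
From HB Require Import structures.
From mathcomp Require Import all_boot all_order all_algebra.
From mathcomp Require Import zify.

Set Implicit Arguments.
Unset Strict Implicit.
Unset Printing Implicit Defensive.

Import Order.TTheory GRing.Theory Num.Theory.

(* A partition (ordinary or strict) is the sequence of its positive parts, so
   that each partition has a unique representation. Rows and columns of
   diagrams are numbered from 1, as in [part la i] and in boxes [(i, j)]. *)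

Definition is_part (la : seq nat) : bool := sorted geq la && (0 \notin la).

Definition is_strict (s : seq nat) : bool := sorted gtn s && (0 \notin s).

Definition part (la : seq nat) (i : nat) : nat := nth 0 la i.-1.

(* Containment of diagrams; for strict partitions this is also containment of
   shifted diagrams. *)
Definition contains (la mu : seq nat) : bool :=
  all (fun i => part mu i <= part la i) (iota 1 (size mu)).

(* Partitions of n with all parts at most k. *)
Fixpoint partitions_le (k n : nat) : seq (seq nat) :=
  if k is k'.+1 then
    [seq nseq c k ++ la | c <- iota 0 (n %/ k).+1,
                          la <- partitions_le k' (n - c * k)]
  else if n == 0 then [:: [::]] else [::].

Definition partitions (n : nat) : seq (seq nat) := partitions_le n n.

Definition boxes (la : seq nat) : seq (nat * nat) :=
  [seq (i, j) | i <- iota 1 (size la), j <- iota 1 (part la i)].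

Definition arm (bs : seq (nat * nat)) (b : nat * nat) : nat :=
  count (fun b' => (b'.1 == b.1) && (b.2 < b'.2)) bs.

Definition leg (bs : seq (nat * nat)) (b : nat * nat) : nat :=
  count (fun b' => (b.1 < b'.1) && (b'.2 == b.2)) bs.

Definition hook (la : seq nat) (b : nat * nat) : nat :=
  arm (boxes la) b + leg (boxes la) b + 1.

Definition content (b : nat * nat) : int := (b.2%:Z - b.1%:Z)%R.

Definition hook_prod (la : seq nat) : nat := \prod_(b <- boxes la) hook la b.

Definition is_tcore (t : nat) (la : seq nat) : bool :=
  all (fun b => hook la b != t) (boxes la).

Definition shifted_boxes (s : seq nat) : seq (nat * nat) :=
  [seq (i, j) | i <- iota 1 (size s), j <- iota i.+1 (part s i)].

Definition shifted_hook (s : seq nat) (b : nat * nat) : nat :=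
  arm (shifted_boxes s) b + leg (shifted_boxes s) b + 1 + part s b.2.

Definition shifted_hook_prod (s : seq nat) : nat :=
  \prod_(b <- shifted_boxes s) shifted_hook s b.

Definition doubled_boxes (s : seq nat) : seq (nat * nat) :=
  shifted_boxes s ++ [seq (k, i) | i <- iota 1 (size s), k <- iota i (part s i)].

(* The partition whose diagram is [doubled_boxes s], see [mem_boxes_doubled];
   the last nonempty row of the diagram is the bottom of its first column. *)
Definition doubled (s : seq nat) : seq nat :=
  [seq count (fun b => b.1 == r) (doubled_boxes s) | r <- iota 1 (part s 1)].

(* The inverse of [doubled], see [doubledK]. *)
Definition strict_of (la : seq nat) : seq nat :=
  [seq s <- [seq part la i - i | i <- iota 1 (size la)] | 0 < s].

(* Membership in DD, see [is_ddP]. *)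
Definition is_dd (la : seq nat) : bool :=
  is_strict (strict_of la) && (doubled (strict_of la) == la).

(* The boundary of a diagram whose rows, from bottom to top, are given by the
   second argument, x being the current abscissa: vertical edges are [false],
   horizontal edges are [true]. The half-lines at both ends are omitted. *)
Fixpoint boundary (x : nat) (rows : seq nat) : seq bool :=
  if rows is r :: rows' then nseq (r - x) true ++ false :: boundary r rows'
  else [::].

(* The bi-infinite word of la. The first edge of [boundary] has index
   - size la, which balances the 1's of negative index with the 0's of
   nonnegative index, see [word_balanced]. *)
Definition word (la : seq nat) (k : int) : bool :=
  if (- (size la)%:Z <= k)%R
  then nth true (boundary 0 (rev la)) (absz (k + (size la)%:Z)%R)
  else false.

(* Inverse of [boundary], see [boundaryK]: the rows, from bottom to top, some
   possibly empty, of the diagram with the given boundary; 0's at the front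
   only add empty rows, and 1's at the end have no effect. *)
Fixpoint rows_of (x : nat) (w : seq bool) : seq nat :=
  if w is e :: w' then if e then rows_of x.+1 w' else x :: rows_of x w'
  else [::].

Definition part_of_word (w : seq bool) : seq nat :=
  [seq r <- rev (rows_of 0 w) | 0 < r].

(* The integers k with - m <= k < m. When m = |la|, each subword
   (a_(tk+i))_k of the word of la is constantly 0 before this window and
   constantly 1 after it, see [subword_outside]. *)
Definition window (m : nat) : seq int :=
  [seq (k%:Z - m%:Z)%R | k <- iota 0 m.*2].

Definition subword (t i : nat) (la : seq nat) (k : int) : bool :=
  word la (t%:Z * k + i%:Z)%R.

Definition tquotient (t i : nat) (la : seq nat) : seq nat :=
  part_of_word [seq subword t i la k | k <- window (sumn la)].

(* #{k >= 0 : 0} - #{k < 0 : 1} *)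
Definition charge (t i : nat) (la : seq nat) : int :=
  ((count (fun k => (0 <= k)%R && ~~ subword t i la k) (window (sumn la)))%:Z
   - (count (fun k => (k < 0)%R && subword t i la k) (window (sumn la)))%:Z)%R.

(* After the rearrangement, the letter of index tk+i is 1 iff
   k >= charge t i la; letters are listed by increasing index tk+i. *)
Definition tcore (t : nat) (la : seq nat) : seq nat :=
  part_of_word [seq (charge t i la <= k)%R
               | k <- window (sumn la), i <- iota 0 t].

(* From here on, t is odd, t./2 is t' and [strict_of (tquotient t 0 la)] is the
   strict partition of the Littlewood decomposition of la in DD. *)

Definition strict_quotient (t : nat) (la : seq nat) : seq nat :=
  strict_of (tquotient t 0 la).

Definition ge_t (t : nat) (la mu : seq nat) : bool :=
  [&& tcore t la == tcore t mu,
      contains (strict_quotient t la) (strict_quotient t mu) &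
      all (fun i => contains (tquotient t i la) (tquotient t i mu))
          (iota 1 t./2)].

(* The argument fuel bounds the recursion depth; see [F_tE] for the intended
   recursion. *)
Fixpoint F_t_rec (fuel t : nat) (la mu : seq nat) : nat :=
  if la == mu then 1
  else if fuel is fuel'.+1 then
    \sum_(nu <- partitions (sumn la - 2 * t) |
            [&& is_dd nu, sumn la == sumn nu + 2 * t,
                ge_t t la nu & ge_t t nu mu]) F_t_rec fuel' t nu mu
  else 0.

Definition F_t (t : nat) (la mu : seq nat) : nat := F_t_rec (sumn la) t la mu.

Definition quotient_size (t : nat) (la : seq nat) : nat :=
  sumn (strict_quotient t la) +
  \sum_(1 <= i < t./2.+1) sumn (tquotient t i la).

Local Open Scope ring_scope.

Definition G_t (t : nat) (la : seq nat) : rat :=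
  2%:R ^+ (quotient_size t la - size (strict_quotient t la))
  / (t%:R ^+ quotient_size t la
     * (shifted_hook_prod (strict_quotient t la))%:R
     * \prod_(1 <= i < t./2.+1) (hook_prod (tquotient t i la))%:R).

Definition D_t (t : nat) (g : seq nat -> rat) (la : seq nat) : rat :=
  \sum_(nu <- partitions (sumn la + 2 * t) | is_dd nu && ge_t t nu la) g nu
  - g la.

Definition hook_sum (t j k : nat) (la : seq nat) : rat :=
  \sum_(b <- boxes la | ((hook la b)%:Z == j%:Z %[mod t%:Z])%Z
                        || ((hook la b)%:Z == - j%:Z %[mod t%:Z])%Z)
     (hook la b)%:R ^+ (2 * k).

Definition content_sum (t j k : nat) (la : seq nat) : rat :=
  \sum_(b <- boxes la | (content b == j%:Z %[mod t%:Z])%Z)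
     (content b)%:~R ^+ k.

Local Close Scope ring_scope.

Lemma part_default la i : size la < i -> part la i = 0.
Proof. by case: i => // i; rewrite /part ltnS => h; rewrite nth_default. Qed.

Lemma part_gt0 la i : 0 \notin la -> 0 < i <= size la -> 0 < part la i.
Proof.
move=> h0; case: i => // i /andP[_ hi]; rewrite lt0n; apply/eqP => e.
by move: h0; rewrite -[X in X \in la]e mem_nth.
Qed.

Lemma mem_pairs (T : eqType) (f : T -> seq nat) (l : seq T) i j :
  ((i, j) \in [seq (i, j) | i <- l, j <- f i]) = (i \in l) && (j \in f i).
Proof.
apply/allpairsPdep/andP => [[x [y [hx hy [-> ->]]]]//|[hi hj]].
by exists i, j.
Qed.

Lemma mem_boxes la i j :
  ((i, j) \in boxes la) = (0 < i) && (0 < j <= part la i).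
Proof.
rewrite mem_pairs !mem_iota.
case: (leqP i (size la)) => h; last rewrite part_default //; lia.
Qed.

Lemma boxes_uniq la : uniq (boxes la).
Proof.
apply: allpairs_uniq_dep => [||[a b] [c d] _ _ [-> ->]//]; first exact: iota_uniq.
by move=> *; apply: iota_uniq.
Qed.

Lemma mem_doubled_boxes s i j :
  ((i, j) \in doubled_boxes s) =
  (0 < i) && (i < j <= i + part s i) || (0 < j) && (j <= i < j + part s j).
Proof.
rewrite mem_cat mem_pairs !mem_iota; congr orb.
  by case: (leqP i (size s)) => h; last rewrite part_default //; lia.
have -> : ((i, j) \in [seq (k, i0) | i0 <- iota 1 (size s), k <- iota i0 (part s i0)])
  = (j \in iota 1 (size s)) && (i \in iota j (part s j)).
  apply/allpairsPdep/andP => [[x [y [hx hy [-> ->]]]]//|[hi hj]].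
  by exists j, i.
rewrite !mem_iota.
by case: (leqP j (size s)) => h; last rewrite part_default //; lia.
Qed.

Lemma doubled_boxes_uniq s : uniq (doubled_boxes s).
Proof.
rewrite cat_uniq; apply/and3P; split.
- apply: allpairs_uniq_dep => [||[a b] [c d] _ _ [-> ->]//]; first exact: iota_uniq.
  by move=> *; apply: iota_uniq.
- apply/hasPn => -[a b] /allpairsPdep[x [y [_ hy [-> ->]]]].
  move: hy; rewrite mem_pairs !mem_iota; lia.
- apply: allpairs_uniq_dep => [||[a b] [c d] _ _ [-> ->]//]; first exact: iota_uniq.
  by move=> *; apply: iota_uniq.
Qed.

Lemma strict_part s a b :
  is_strict s -> 0 < a -> a <= b -> 0 < part s b -> b + part s b <= a + part s a.
Proof.
move=> /andP[st n0] a0 ab; rewrite -(subnKC ab); elim: (b - a) => [|n IH] h.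
  by rewrite addn0.
have hn : part s (a + n.+1) < part s (a + n).
  have hs : a + n.+1 <= size s.
    by rewrite leqNgt; apply/negP => /part_default e; rewrite e in h.
  have/(sortedP 0)/(_ (a + n).-1) := st.
  rewrite /part; move=> /(_ ltac:(lia)); rewrite /gtn /= => /(leq_trans _) -> //.
  by rewrite addnS /= (prednK (_ : 0 < a + n)) //; lia.
have := IH ltac:(lia); lia.
Qed.

Lemma size_row_initial (l : seq nat) :
  uniq l -> 0 \notin l -> (forall x y, x \in l -> 0 < y <= x -> y \in l) ->
  forall x, (x \in l) = (0 < x <= size l).
Proof.
move=> ul l0 dl.
have h : exists m, forall x, (x \in l) = (0 < x <= m).
  exists (\max_(y <- l) y) => x; apply/idP/idP => [hx|/andP[x0 hx]].
    rewrite lt0n; apply/andP; split; last by rewrite (big_rem _ hx) leq_maxl.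
    by apply/eqP => e; rewrite e in hx; rewrite hx in l0.
  have : \max_(y <- l) y = 0 \/ \max_(y <- l) y \in l.
    elim: (l) => [|y s IH]; first by rewrite big_nil; left.
    rewrite big_cons inE; case: IH => [->|IH].
      by rewrite maxn0 eqxx; right.
    right; case: (leqP y (\max_(j <- s) j)) => h; first by rewrite IH orbT.
    by rewrite eqxx.
  case=> [e|hm]; first by rewrite e in hx; lia.
  by apply: dl hm _; rewrite x0.
case: h => m hm.
have : perm_eq l (iota 1 m).
  by apply: uniq_perm => // [|x]; rewrite ?iota_uniq // mem_iota hm; lia.
by move/perm_size; rewrite size_iota => ->.
Qed.

Lemma part_doubled s i : is_strict s ->
  forall j, ((i, j) \in doubled_boxes s) = (0 < i) && (0 < j <= part (doubled s) i).
Proof.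
move=> st; case: i => [|i] j.
  rewrite mem_doubled_boxes; lia.
rewrite /=; case: (ltnP i (part s 1)) => hi; last first.
  rewrite part_default; last by rewrite size_map size_iota.
  rewrite mem_doubled_boxes.
  have H : forall a, 0 < a -> 0 < part s a -> a + part s a <= 1 + part s 1.
    by move=> a a0 pa; apply: strict_part.
  have := H i.+1 isT; have := H j; lia.
rewrite {1}/part (nth_map 0) ?size_iota // nth_iota // add1n.
set l := [seq b.2 | b <- doubled_boxes s & b.1 == i.+1].
have meml y : (y \in l) = ((i.+1, y) \in doubled_boxes s).
  apply/mapP/idP => [[[a b]]|h]; last by exists (i.+1, y); rewrite // mem_filter eqxx.
  by rewrite mem_filter /= => /andP[/eqP -> h] ->.
have -> : count (fun b => b.1 == i.+1) (doubled_boxes s) = size l.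
  by rewrite size_map size_filter.
rewrite -meml; apply: size_row_initial.
- rewrite map_inj_in_uniq ?filter_uniq ?doubled_boxes_uniq //.
  move=> [a b] [c d]; rewrite !mem_filter /= => /andP[/eqP-> _] /andP[/eqP-> _].
  by move=> ->.
- by rewrite meml mem_doubled_boxes; lia.
- move=> x y; rewrite !meml !mem_doubled_boxes => hx hy.
  have H a b := @strict_part s a b st.
  have := H y x; have := H y i.+1.
  case: (ltnP y i.+2) => yi; lia.
Qed.

Lemma mem_boxes_doubled s : is_strict s -> boxes (doubled s) =i doubled_boxes s.
Proof. by move=> st [i j]; rewrite part_doubled // mem_boxes. Qed.

Lemma is_part_doubled s : is_strict s -> is_part (doubled s).
Proof.
move=> st; apply/andP; split.
  apply/(sortedP 0) => i hi.
  have e a : nth 0 (doubled s) a = part (doubled s) a.+1 by [].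
  rewrite /geq /= !e.
  case E : (part (doubled s) i.+2) => [//|n]; rewrite -E.
  have : (i.+2, part (doubled s) i.+2) \in doubled_boxes s.
    by rewrite part_doubled // E /= leqnn.
  set c := part _ _ => h.
  suff : (i.+1, c) \in doubled_boxes s by rewrite part_doubled // => /and3P[].
  move: h; rewrite !mem_doubled_boxes.
  have := @strict_part s i.+1 i.+2 st.
  by case: (eqVneq c i.+2) => [->|]; lia.
apply/negP => /(nthP 0)[i hi e].
have : (i.+1, 1) \in doubled_boxes s.
  rewrite size_map size_iota in hi.
  rewrite mem_doubled_boxes; lia.
by rewrite part_doubled // /part /= e.
Qed.

Lemma doubledK s : is_strict s -> strict_of (doubled s) = s.
Proof.
move=> st; have /andP[_ s0] := st.
have sz : size (doubled s) = part s 1 by rewrite size_map size_iota.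
have H i : 0 < i -> part (doubled s) i - i = part s i.
  move=> i0; have h := @part_doubled s i st.
  case: (posnP (part s i)) => p0.
    by have := h i; rewrite mem_doubled_boxes p0; lia.
  have := h (i + part s i); have := h (i + part s i).+1.
  have := @strict_part s i (i + part s i).+1 st.
  by rewrite !mem_doubled_boxes; lia.
rewrite /strict_of sz.
have -> : [seq part (doubled s) i - i | i <- iota 1 (part s 1)] =
          [seq part s i | i <- iota 1 (part s 1)].
  by apply/eq_in_map => i; rewrite mem_iota => hi; apply: H; lia.
have hle : size s <= part s 1.
  case: (posnP (size s)) => [->//|hs].
  have p0 : 0 < part s (size s) by apply: part_gt0 => //; rewrite hs leqnn.
  have := @strict_part s 1 (size s) st isT hs p0; lia.
rewrite -(subnKC hle) iotaD map_cat filter_cat.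
rewrite [X in _ ++ X](_ : _ = [::]) ?cats0; last first.
  apply/eqP; rewrite -(negbK (_ == _)) -has_filter; apply/hasPn => x /mapP[i].
  by rewrite mem_iota => hi ->; rewrite part_default //; lia.
have -> : [seq part s i | i <- iota 1 (size s)] = s.
  apply: (@eq_from_nth _ 0); rewrite size_map size_iota // => i hi.
  by rewrite (nth_map 0) ?size_iota // nth_iota.
apply/all_filterP/allP => x hx; rewrite lt0n.
by apply: contraNneq s0 => <-.
Qed.

Lemma is_ddP la : reflect (exists2 s, is_strict s & la = doubled s) (is_dd la).
Proof.
apply: (iffP andP) => [[st /eqP e]|[s st ->]]; first by exists (strict_of la).
by rewrite doubledK.
Qed.

Lemma partitions_leS k n : partitions_le k.+1 n =
  [seq nseq c k.+1 ++ la | c <- iota 0 (n %/ k.+1).+1,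
                           la <- partitions_le k (n - c * k.+1)].
Proof. by []. Qed.

Lemma mem_partitions_le k n la :
  (la \in partitions_le k n) =
  [&& is_part la, all (fun x => x <= k) la & sumn la == n].
Proof.
elim: k n la => [|k IH] n la.
  rewrite /=; case: la => [|x la]; first by case: n.
  rewrite /= leqn0 /is_part in_cons; case: (posnP x) => [->|_].
    by rewrite eqxx andbF; case: (n == 0).
  by rewrite andbF; case: (n == 0).
rewrite partitions_leS; apply/allpairsPdep/and3P => [[c [mu []]]|[]].
  rewrite mem_iota /= add0n ltnS => hc.
  rewrite IH => /and3P[/andP[st m0] /allP le /eqP sm] ->.
  have hck : c * k.+1 <= n by rewrite -leq_divRL.
  split.
  - rewrite /is_part mem_cat mem_nseq /= andbF (negbTE m0) andbT.
    elim: (c) => [//|d /= IHd]; rewrite path_sortedE; last first.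
      by move=> x y z /= yx zy; apply: leq_trans zy yx.
    rewrite IHd andbT all_cat all_nseq /geq /= leqnn orbT /=.
    by apply/allP => x /le /= /leqW.
  - by rewrite all_cat all_nseq leqnn orbT /=; apply/allP => x /le /leqW.
  - by rewrite sumn_cat sumn_nseq sm mulnC subnKC // mulnC.
elim: la n => [|x la IHla] n.
  move=> _ _ /eqP <-; exists 0, [::]; rewrite div0n IH /=; split=> //.
move=> pla /= /andP[hx hla] /eqP hs.
have pl : is_part la.
  move: pla => /andP[/path_sorted st]; rewrite inE negb_or => /andP[_ l0].
  by apply/andP.
have [e|nx] := eqVneq x k.+1; last first.
  exists 0, (x :: la); split=> //; rewrite mul0n subn0 IH.
  rewrite pla /= hs eqxx andbT.
  apply/andP; split; first by lia.
  move: pla => /andP[]; rewrite /= path_sortedE; last first.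
    by move=> y z w /= zy wz; apply: leq_trans wz zy.
  case/andP => /allP H _ _; apply/allP => y /H; rewrite /geq /=; lia.
have [c [mu [hc hm ->]]] := IHla (n - k.+1) pl hla ltac:(lia).
exists c.+1, mu; split; last by rewrite e.
  move: hc; rewrite !mem_iota !add0n ltnS leq_divRL // => /andP[_ hc].
  suff : c.+1 <= n %/ k.+1.
    by move=> hle; change (c.+1 \in iota 0 (n %/ k.+1).+1); rewrite mem_iota.
  rewrite leq_divRL // mulSn; move: hs; rewrite e; lia.
by move: hm; rewrite mulSn subnDA.
Qed.

Lemma mem_partitions n la :
  (la \in partitions n) = is_part la && (sumn la == n).
Proof.
rewrite mem_partitions_le; case: eqP => [<-|]; rewrite ?andbF // !andbT.
rewrite andb_idr // => _; elim: la => //= x la IH; rewrite leq_addr /=.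
by apply: sub_all IH => y; lia.
Qed.

Lemma partitions_uniq n : uniq (partitions n).
Proof.
rewrite /partitions; move: {1}n => k; elim: k n => [|k IH] n.
  by case: n.
rewrite partitions_leS.
apply: allpairs_uniq_dep => [|c _|]; rewrite ?iota_uniq ?IH //.
move=> p q /allpairsPdep[c [la [_ h1 ->]]] /allpairsPdep[d [mu [_ h2 ->]]] /= e.
move: h1 h2; rewrite !mem_partitions_le => /and3P[_ b1 _] /and3P[_ b2 _].
have ct x nu : all (leq^~ k) nu -> count_mem k.+1 (nseq x k.+1 ++ nu) = x.
  move=> /allP b; rewrite count_cat count_nseq /= eqxx mul1n.
  by rewrite (count_memPn _) ?addn0 //; apply/negP => /b; rewrite ltnn.
have ecd : c = d by rewrite -(ct c _ b1) e ct.
by move: e; rewrite ecd => /eqP; rewrite eqseq_cat // eqxx /= => /eqP ->.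
Qed.

Lemma is_part_size la : is_part la -> size la <= sumn la.
Proof.
move=> /andP[_]; elim: la => //= x la IH; rewrite inE => /norP[x0 /IH]; lia.
Qed.

Lemma size_boundary x rows :
  sorted leq (x :: rows) -> size (boundary x rows) + x = size rows + last x rows.
Proof.
elim: rows x => [//|r rows IH] x /= /andP[xr /IH].
rewrite size_cat size_nseq /=; lia.
Qed.

Lemma count_boundary x rows : count negb (boundary x rows) = size rows.
Proof.
elim: rows x => [//|r rows IH] x /=.
by rewrite count_cat count_nseq /= IH; lia.
Qed.

Lemma rows_of_boundary x rows :
  sorted leq (x :: rows) -> rows_of x (boundary x rows) = rows.
Proof.
have H n y w : rows_of y (nseq n true ++ w) = rows_of (y + n) w.
  by elim: n y => [|n IH] y /=; rewrite ?addn0 // IH addSnnS.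
elim: rows x => [//|r rows IH] x /= /andP[xr sr].
by rewrite H subnKC //= IH.
Qed.

Lemma sorted_rev_part la : is_part la -> sorted leq (0 :: rev la).
Proof.
move=> /andP[st _]; rewrite [sorted _ _]path_min_sorted ?rev_sorted //.
by apply/allP.
Qed.

Lemma boundaryK la : is_part la -> part_of_word (boundary 0 (rev la)) = la.
Proof.
move=> pla; rewrite /part_of_word rows_of_boundary ?sorted_rev_part // revK.
move: pla => /andP[_ l0]; apply/all_filterP/allP => x hx; rewrite lt0n.
by apply: contraNneq l0 => <-.
Qed.

Lemma size_boundary_le la :
  is_part la -> size (boundary 0 (rev la)) <= size la + sumn la.
Proof.
move=> pla; have := size_boundary (sorted_rev_part pla).
rewrite addn0 size_rev => ->; rewrite leq_add2l.
by case: (la) => [//|x l]; rewrite rev_cons last_rcons /= leq_addr.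
Qed.

Lemma word_outside la k : is_part la ->
  ((k < - (sumn la)%:Z)%R -> word la k = false) /\
  (((sumn la)%:Z <= k)%R -> word la k = true).
Proof.
move=> pla; have := is_part_size pla; have := size_boundary_le pla.
rewrite /word => h1 h2; split=> hk; case: ifP => //; first lia.
  by move=> _; rewrite nth_default //; lia.
lia.
Qed.

Lemma subword_outside t i la k : is_part la -> i < t ->
  ((k < - (sumn la)%:Z)%R -> subword t i la k = false) /\
  (((sumn la)%:Z <= k)%R -> subword t i la k = true).
Proof.
move=> pla it; have [h1 h2] := word_outside (t%:Z * k + i%:Z)%R pla.
split=> hk; [apply: h1|apply: h2]; nia.
Qed.

Lemma word_balanced la : is_part la ->
  count (fun k => (k < 0)%R && word la k) (window (sumn la)) =
  count (fun k => (0 <= k)%R && ~~ word la k) (window (sumn la)).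
Proof.
move=> pla; set w := window _; set m := sumn la.
have hs := is_part_size pla; have hb := size_boundary_le pla.
have e0 : count (fun k => (k < 0)%R) w = m.
  rewrite count_map -addnn iotaD count_cat.
  set p := preim _ _; have -> : count p (iota 0 (sumn la)) = m.
    apply: etrans (size_iota 0 m); apply/eqP; rewrite -all_count; apply/allP => k.
    rewrite mem_iota /p /=; lia.
  suff -> : count p (iota (0 + sumn la) (sumn la)) = 0 by rewrite addn0.
  apply/eqP; rewrite -leqn0 leqNgt -has_count; apply/hasPn => k.
  rewrite mem_iota /p /=; lia.
have e1 : count (fun k => ~~ word la k) w = m.
  have -> : count (fun k => ~~ word la k) w = count negb (map (word la) w).
    by rewrite count_map.
  have -> : map (word la) w = nseq (m - size la) false ++ boundary 0 (rev la)
     ++ nseq (m + size la - size (boundary 0 (rev la))) true.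
    apply: (@eq_from_nth _ true); rewrite !size_map size_iota ?size_cat ?size_nseq.
      lia.
    move=> i hi; rewrite (nth_map 0%R) ?size_map ?size_iota //.
    rewrite (nth_map 0) ?size_iota // nth_iota // add0n !nth_cat !size_nseq.
    rewrite nth_nseq /word; case: ifP => h1; case: ifP => h2; rewrite ?h2 //; try lia.
    rewrite nth_nseq if_same (_ : absz _ = i - (m - size la)); last by lia.
    by case: ifP => // h3; rewrite nth_default //; lia.
  rewrite !count_cat !count_nseq count_boundary size_rev /=; lia.
have split2 (p q : pred int) : count q w = count (predI p q) w + count (predI (predC p) q) w.
  by elim: (w) => //= x l ->; case: (p x); case: (q x) => //=; lia.
have := split2 (word la) (fun k => (k < 0)%R).
have := split2 (fun k => (k < 0)%R) (fun k => ~~ word la k).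
rewrite e0 e1 => a b.
have e2 : count (fun k => (k < 0)%R && word la k) w =
  count (predI (word la) (fun k => (k < 0)%R)) w.
  by apply: eq_count => k /=; rewrite andbC.
have e3 : count (fun k => (0 <= k)%R && ~~ word la k) w =
  count (predI (predC (fun k => (k < 0)%R)) (fun k => ~~ word la k)) w.
  by apply: eq_count => k /=; rewrite -leNgt.
have e4 : count (predI (fun k => (k < 0)%R) (fun k => ~~ word la k)) w =
  count (predI (predC (word la)) (fun k => (k < 0)%R)) w.
  by apply: eq_count => k /=; rewrite andbC.
rewrite e2 e3; apply: (@addIn (count (predI (predC (word la)) (fun k => (k < 0)%R)) w)).
by rewrite -b -e4 addnC -a.
Qed.

Lemma F_tE t la mu : 0 < t ->
  F_t t la mu =
  if la == mu then 1 else
    \sum_(nu <- partitions (sumn la - 2 * t) |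
            [&& is_dd nu, sumn la == sumn nu + 2 * t,
                ge_t t la nu & ge_t t nu mu]) F_t t nu mu.
Proof.
move=> t0.
have H n m nu : sumn nu <= n -> sumn nu <= m -> F_t_rec n t nu mu = F_t_rec m t nu mu.
  elim: n m nu => [|n IH] [|m] nu //= hn hm; case: ifP => // _.
  - rewrite big1 // => x /and4P[_ /eqP]; lia.
  - rewrite big1 // => x /and4P[_ /eqP]; lia.
  - by apply: eq_bigr => x /and4P[_ /eqP hx _ _]; apply: IH; lia.
rewrite /F_t (H _ (sumn la).+1) //=; case: ifP => // _.
by apply: eq_bigr => x /and4P[_ /eqP hx _ _]; apply: H; lia.
Qed.

(* Main.v *)
(* Let X be the set of parts of the strict partition of la in DD, and let
   psum r a be the sum of the x^a over the x in X congruent to r mod t, minus the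
   sum of the (- x)^a over those congruent to - r. All hook and content sums are
   polynomials in these power sums; if psum r a is given the weight a + 1, then
   content_sum t j k has weight at most k + 2 and hook_sum t j k at most 2 (k + 1).

   Adding a box to a component of the Littlewood decomposition moves a bead from
   x to x + t and one from - x - t to - x. By the hook formulas for H, the ratio
   G_(la^+) / G_la is, up to a constant, a Lagrange weight
   prod_j (b_i - a_j) / prod_(j <> i) (b_i - b_j): for an ordinary component the
   b_i are the positions of the beads and a_j = b_j - t; for the strict component
   the a_j are the y (y - 1) for y a part, and the b_i the y (y + 1) for y a part
   or 0. The Lagrange weights sum to 1 and, by Newton's identities, their moments
   are polynomials in the power sums of weight at most their degree (in y for the
   strict component). The constants are 1 / t for the strict component and 2 / t for
   each of the t' others, with total 1, and moving a bead lowers the weight by 2: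
   D_t (G f) = G f', where the weight of f' is that of f minus 2. Functions of
   negative weight vanish, so some D_t^r kills G f, and the sums of F_(la/mu) g(la)
   are polynomial in n, their forward difference being the same sums for D_t g. *)
From HB Require Import structures.
From mathcomp Require Import all_boot all_order all_algebra.
From mathcomp Require Import zify ring lra.
Require Import Defs.
Set Implicit Arguments.
Unset Strict Implicit.
Unset Printing Implicit Defensive.
Import Order.TTheory GRing.Theory Num.Theory.
Local Open Scope ring_scope.

(** * Moments of Lagrange weights *)

(** The bead sets are infinite, so [psum] counts beads against the vacuum. The power differences in
    Newton's identities then telescope outside finitely many beads and become polynomials summed
    over a runner, of degree one less than the order of the moment; this is why exponent a gets
    weight a + 1. As (x + t)^a - x^a has degree a - 1 in a position x of weight 1, a move lowers
    weights by 2. In the strict component the variable is y (y + 1), of weight 2, because (y + 1 -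
    z)(y + z) and (y - z)(y + z + 1) are both differences of its values. The charges are the
    [psum i 0]: the core enters through elements of the algebra, and one bound serves all cores. The
    constants come from G. A new box brings 1 / t, and 2^(N - l) brings a factor 2 unless a part of
    the strict component is created; there the Lagrange weight contains exactly this factor, which
    leaves 1 / t. The obstacle is that f (la^+) depends on the moved bead as well as on la. The
    algebra is therefore enlarged by the position of that bead, and averaging, which turns powers of
    the position into moments, leads back to functions of la. *)

Section Newton.

Variables (F : numFieldType) (n : nat) (b : 'I_n.+1 -> F) (a : 'I_n -> F).
Hypothesis b_inj : injective b.

(** The residue of prod (z - a_j) / prod (z - b_j) at z = b_i; the moments are the coefficients of
    this fraction expanded at infinity. *)
Definition lagr (i : 'I_n.+1) : F :=
  (\prod_j (b i - a j)) / \prod_(j | j != i) (b i - b j).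

Definition lagr_moment (m : nat) : F := \sum_i lagr i * b i ^+ m.

Definition power_diff (k : nat) : F := \sum_i b i ^+ k - \sum_j a j ^+ k.

(** Both sides have degree at most [n] and agree at the [n.+1] distinct nodes [b i]. *)
Lemma lagr_interpolation :
  \sum_i lagr i *: \prod_(j | j != i) ('X - (b j)%:P) = \prod_j ('X - (a j)%:P).
Proof.
apply/eqP; rewrite -subr_eq0; apply/eqP.
set d := _ - _.
apply: (@roots_geq_poly_eq0 _ d (codom b)).
- apply/allP => _ /codomP[i ->]; rewrite rootE /d hornerD hornerN horner_sum.
  rewrite horner_prod subr_eq0; apply/eqP.
  rewrite (bigD1 i) //= [X in _ + X]big1 ?addr0 => [|i1 ni]; last first.
    by rewrite hornerZ horner_prod (bigD1 i) 1?eq_sym //= hornerXsubC subrr mul0r mulr0.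
  rewrite hornerZ horner_prod.
  have -> : \prod_(j | j != i) ('X - (b j)%:P).[b i] = \prod_(j | j != i) (b i - b j).
    by apply: eq_bigr => j _; rewrite hornerXsubC.
  rewrite /lagr divfK; first by apply: eq_bigr => j _; rewrite hornerXsubC.
  by apply/prodf_neq0 => j ji; rewrite subr_eq0 inj_eq // eq_sym.
- by rewrite /codom map_inj_uniq ?enum_uniq.
rewrite size_codom card_ord /d.
apply: leq_trans (size_polyD _ _) _; rewrite size_polyN size_prod_XsubC geq_max.
rewrite (_ : size (index_enum _) = n) ?leqnn ?andbT; last first.
  by rewrite -[RHS]card_ord cardT enumT.
apply: (leq_trans (size_sum _ _ _)); apply/bigmax_leqP => i _.
apply: (leq_trans (size_scale_leq _ _)).
rewrite -big_filter size_prod_XsubC size_filter ltnS.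
by rewrite -sum1_count sum1_card cardC1 card_ord.
Qed.

(** The reciprocal form of [lagr_interpolation]: at a point c it is c^n times the latter at 1 / c.
    Characteristic 0 provides enough nonzero points c, the integers [m.+1]. *)
Lemma lagr_interpolation_rev :
  \sum_i lagr i *: \prod_(j | j != i) (1 - b j *: 'X) = \prod_j (1 - a j *: 'X).
Proof.
set L := LHS; set R := RHS; apply/eqP; rewrite -subr_eq0; apply/eqP.
pose N := size (L - R).
apply: (@roots_geq_poly_eq0 _ _ [seq m.+1%:R | m <- iota 0 N]).
- apply/allP => _ /mapP[m _ ->]; rewrite rootE hornerD hornerN subr_eq0.
  apply/eqP; set c := m.+1%:R : F.
  have c0 : c != 0 by rewrite pnatr_eq0.
  have E x : 1 - x * c = c * (c^-1 - x) by rewrite mulrBr divff // mulrC.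
  have := congr1 (fun p => c ^+ n * p.[c^-1]) lagr_interpolation.
  rewrite horner_sum horner_prod /L /R horner_sum horner_prod.
  rewrite -[in X in c ^+ X](card_ord n) -prodr_const -big_split /= mulr_sumr.
  rewrite [RHS](_ : _ = \prod_i (1 - a i *: 'X).[c]); last first.
    by apply: eq_bigr => i _; rewrite !hornerE E.
  move <-; apply: eq_bigr => i _.
  rewrite !hornerZ !horner_prod mulrCA; congr (_ * _).
  have -> : \prod_(i0 < n) c = \prod_(j | j != i) c.
    by rewrite !prodr_const cardC1 !card_ord.
  by rewrite -big_split; apply: eq_bigr => j _; rewrite !hornerE E.
- by rewrite map_inj_uniq ?iota_uniq // => x y /eqP; rewrite eqr_nat => /eqP[].
by rewrite size_map size_iota.
Qed.

Lemma geometric_rev (M : nat) (c : F) :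
  (\sum_(k < M) c ^+ k *: 'X^k) * (1 - c *: 'X) = 1 - c ^+ M *: 'X^M.
Proof.
elim: M => [|M IH]; first by rewrite big_ord0 mul0r !expr0 scale1r subrr.
rewrite big_ord_recr mulrDl IH /= mulrBr mulr1 -scalerAl -scalerAr scalerA -!exprSr.
by rewrite addrA subrK.
Qed.

(** Truncated form of the logarithmic derivative - B' / B = sum_j c_j / (1 - c_j X): the j-th
    geometric series cancels the j-th factor up to a multiple of X^M. *)
Lemma deriv_prod_rev m (c : 'I_m -> F) (M : nat) :
  'X^M %| (\prod_j (1 - c j *: 'X)) * (\sum_j \sum_(k < M) c j ^+ k.+1 *: 'X^k)
          + (\prod_j (1 - c j *: 'X))^`().
Proof.
have -> : (\prod_j (1 - c j *: 'X))^`() =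
    - \sum_j c j *: \prod_(i | i != j) (1 - c i *: 'X).
  elim: m c => [|m IH] c; first by rewrite !big_ord0 derivC oppr0.
  rewrite big_ord_recl derivM IH [in RHS]big_ord_recl opprD.
  rewrite derivB derivC derivZ derivX sub0r mulNr; congr (- _ + _).
    rewrite alg_polyC mul_polyC; congr (_ *: _).
    by rewrite [RHS]big_mkcond big_ord_recl eqxx /= mul1r.
  rewrite mulrN mulr_sumr; congr (- _); apply: eq_bigr => i _.
  rewrite -scalerAr; congr (_ *: _).
  rewrite [RHS]big_mkcond big_ord_recl /=; congr (_ * _).
  rewrite -big_mkcond /=; apply: eq_bigl => i'.
  by rewrite (inj_eq (@lift_inj _ _)).
rewrite mulr_sumr -sumrB; apply: (big_ind (fun p => 'X^M %| p)).
- exact: dvdp0.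
- by move=> p q; apply: dvdp_add.
move=> i _; rewrite (bigD1 i) //=; set Q := \prod_(_ | _) _.
have -> : \sum_(k < M) c i ^+ k.+1 *: 'X^k = c i *: \sum_(k < M) c i ^+ k *: 'X^k.
  by rewrite scaler_sumr; apply: eq_bigr => k _; rewrite scalerA exprS.
rewrite mulrAC [X in X * Q]mulrC -!scalerAl geometric_rev -scalerBr mulrBl mul1r.
rewrite addrAC subrr sub0r scalerN dvdpNr -scalerAl scalerA -mul_polyC.
by rewrite dvdp_mull // dvdp_mulr.
Qed.

Lemma lagr_moment0 : lagr_moment 0 = 1.
Proof.
have := congr1 (fun p => p.[0]) lagr_interpolation_rev.
rewrite horner_sum horner_prod [RHS]big1 => [|i _]; last first.
  by rewrite hornerD hornerN hornerZ hornerX mulr0 subr0 hornerC.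
move=> <-; apply: eq_bigr => i _; rewrite hornerZ horner_prod.
congr (_ * _); rewrite expr0 big1 // => j _.
by rewrite hornerD hornerN hornerZ hornerX mulr0 subr0 hornerC.
Qed.

(* With H the generating series of the moments, the interpolation formula
   reads H = prod (1 - a_j X) / prod (1 - b_j X); this is the coefficient of
   X^m in its logarithmic derivative. *)
Lemma lagr_moment_newton (m : nat) :
  m.+1%:R * lagr_moment m.+1 =
  \sum_(k < m.+1) lagr_moment (m - k) * power_diff k.+1.
Proof.
pose B := \prod_j (1 - b j *: 'X); pose A := \prod_j (1 - a j *: 'X).
pose H := \sum_(k < m.+2) lagr_moment k *: 'X^k : {poly F}.
pose QB := \sum_j \sum_(k < m.+2) b j ^+ k.+1 *: 'X^k : {poly F}.
pose QA := \sum_j \sum_(k < m.+2) a j ^+ k.+1 *: 'X^k : {poly F}.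
have HB : 'X^(m.+2) %| H * B - A.
  rewrite /A -lagr_interpolation_rev.
  have -> : H = \sum_i lagr i *: \sum_(k < m.+2) b i ^+ k *: 'X^k.
    under [RHS]eq_bigr do rewrite scaler_sumr.
    rewrite exchange_big; apply: eq_bigr => k _ /=.
    by rewrite scaler_suml; apply: eq_bigr => i _; rewrite scalerA.
  rewrite mulr_suml -sumrB; apply: (big_ind (fun p => 'X^(m.+2) %| p)).
  - exact: dvdp0.
  - by move=> p q; apply: dvdp_add.
  move=> i _; rewrite /B (bigD1 i) //= mulrA -scalerAl geometric_rev.
  rewrite -scalerAl -scalerBr mulrBl mul1r addrAC subrr sub0r scalerN dvdpNr.
  by rewrite -scalerAl scalerA -mul_polyC dvdp_mull // dvdp_mulr.
have lowX (p : {poly F}) : 'X^(m.+2) %| p -> 'X^(m.+1) %| p.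
  by apply: dvdp_trans; rewrite [X in _ %| X]exprSr dvdp_mulr.
(* The factor [B] avoids inverting power series; its constant term is 1, so it is coprime to ['X]
   and can be cancelled afterwards. Differentiating [H * B - A] costs one power of ['X]. *)
have E : 'X^(m.+1) %| B * (H^`() - H * (QB - QA)).
  have -> : B * (H^`() - H * (QB - QA)) = (H * B - A)^`()
      + (A * QA + A^`()) - H * (B * QB + B^`()) + (H * B - A) * QA.
    by rewrite derivB derivM; ring.
  apply: dvdp_add; last by rewrite dvdp_mulr // lowX.
  apply: dvdp_sub; last by rewrite dvdp_mull // lowX // deriv_prod_rev.
  apply: dvdp_add; last by rewrite lowX // deriv_prod_rev.
  case/dvdpP: HB => q ->; rewrite derivM derivXn /= dvdp_add //.
    by rewrite lowX // dvdp_mull.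
  by rewrite -mulr_natl !dvdp_mull.
have cop : coprimep 'X^(m.+1) B.
  rewrite coprimep_expl // /B; apply: (big_ind (coprimep 'X)).
  - exact: coprimep1.
  - by move=> p q; rewrite coprimepMr => -> ->.
  move=> j _; rewrite coprimep_sym coprimepX.
  by rewrite rootE hornerD hornerN hornerZ hornerX mulr0 subr0 hornerC oner_neq0.
move: E; rewrite Gauss_dvdpr // => /dvdpP[Z] /(congr1 (fun p : {poly F} => p`_m)).
rewrite coefMXn ltnSn coefB coef_deriv => /eqP; rewrite subr_eq0 => /eqP.
have coefS (c : nat -> F) i : (i < m.+2)%N -> (\sum_(k < m.+2) c k *: 'X^k)`_i = c i.
  move=> hi; rewrite coef_sum (bigD1 (Ordinal hi)) //= coefZ coefXn eqxx mulr1.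
  rewrite big1 ?addr0 // => k nk; rewrite coefZ coefXn.
  by rewrite (_ : i == k = false) ?mulr0 //; apply: contraNF nk => /eqP e; apply/eqP/val_inj.
rewrite coefS // => h; rewrite mulr_natl h coefMr; apply: eq_bigr => k _.
rewrite coefS; last by rewrite ltnW // !ltnS leq_subr.
congr (_ * _); rewrite coefB !coef_sum; congr (_ - _).
  by apply: eq_bigr => i _; rewrite (coefS (fun k => b i ^+ k.+1)) // ltnW // ltnS.
by apply: eq_bigr => i _; rewrite (coefS (fun k => a i ^+ k.+1)) // ltnW // ltnS.
Qed.

End Newton.

(** * Hook lengths *)

Lemma count_uniq_eq (T : eqType) (p : pred T) (s l : seq T) :
  uniq s -> uniq l -> (forall x, (x \in l) = p x && (x \in s)) ->
  count p s = size l.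
Proof.
move=> us ul e; rewrite -size_filter; apply/perm_size/uniq_perm => //.
  exact: filter_uniq.
by move=> x; rewrite mem_filter e.
Qed.

Lemma part_mono la i j :
  is_part la -> (0 < i)%N -> (i <= j)%N -> (part la j <= part la i)%N.
Proof.
move=> /andP[st _]; case: i j => // i [|j] // _ ij; rewrite /part /=.
case: (ltnP j (size la)) => hj; last by rewrite [nth 0 la j]nth_default.
have := @sorted_leq_nth _ geq _ _ 0%N la st i j.
rewrite !inE; apply=> //; last exact: leq_ltn_trans hj.
- by move=> x y z; rewrite /geq /= => yx zy; apply: leq_trans zy yx.
- exact: leqnn.
Qed.

(** The parts of the conjugate partition. *)
Definition col_len (la : seq nat) (c : nat) : nat :=
  count (fun i => c <= part la i)%N (iota 1 (size la)).

Lemma col_lenP la c i : is_part la -> (0 < c)%N -> (0 < i)%N ->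
  (c <= part la i)%N = (i <= col_len la c)%N.
Proof.
move=> pla c0 i0; rewrite /col_len -size_filter.
set l := filter _ _.
have hl x : (x \in l) = (0 < x)%N && (c <= part la x)%N.
  rewrite mem_filter mem_iota andbC; case: (leqP x (size la)) => h; first lia.
  by rewrite (part_default h); lia.
have := @size_row_initial l _ _ _ i; rewrite hl i0 /= => -> //.
- by rewrite filter_uniq // iota_uniq.
- by rewrite hl.
- move=> x y; rewrite !hl => /andP[x0 hx] /andP[y0 yx]; rewrite y0 /=.
  by apply: leq_trans hx _; apply: part_mono.
Qed.

Lemma hookE la i c : is_part la -> (0 < i)%N -> (0 < c <= part la i)%N ->
  hook la (i, c) = (part la i - c + (col_len la c - i) + 1)%N.
Proof.
move=> pla i0 /andP[c0 hc]; rewrite /hook /arm /leg; congr (_ + _ + _)%N.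
  rewrite (@count_uniq_eq _ _ _ [seq (i, c') | c' <- iota c.+1 (part la i - c)]).
  - by rewrite size_map size_iota.
  - exact: boxes_uniq.
  - by rewrite map_inj_uniq ?iota_uniq // => x y [].
  - move=> [x y]; rewrite mem_boxes /=; apply/mapP/idP => [[z]|h].
      by rewrite mem_iota => hz [-> ->]; lia.
    by exists y; move: h => /andP[/andP[/eqP-> ?] ?] //; rewrite mem_iota; lia.
rewrite (@count_uniq_eq _ _ _ [seq (i', c) | i' <- iota i.+1 (col_len la c - i)]).
- by rewrite size_map size_iota.
- exact: boxes_uniq.
- by rewrite map_inj_uniq ?iota_uniq // => x y [].
- move=> [x y]; rewrite mem_boxes /=; apply/mapP/idP => [[z]|].
    rewrite mem_iota => hz [-> ->]; rewrite eqxx c0 (@col_lenP la c z) //; lia.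
  move=> /andP[/andP[hi /eqP->] /and3P[x0 _]]; rewrite col_lenP // => hx.
  by exists x => //; rewrite mem_iota; lia.
Qed.

(** The two lists on the left have together as many entries as the interval on the right, which
    contains them, so it suffices that no value is repeated. A hook length in column c differs from
    the entry of row j because c <= [part la j] exactly when j <= [col_len la c]. *)
Lemma hook_row la n i : is_part la -> (size la <= n)%N -> (0 < i <= n)%N ->
  perm_eq ([seq hook la (i, c) | c <- iota 1 (part la i)] ++
           [seq part la i + j - i - part la j | j <- iota i.+1 (n - i)])%N
          (iota 1 (part la i + n - i)).
Proof.
move=> pla hn /andP[i0 hi].
have hook' c : (0 < c <= part la i)%N ->
    hook la (i, c) = (part la i - c + (col_len la c - i) + 1)%N /\
    (i <= col_len la c)%N.
  by move=> hc; rewrite hookE // -col_lenP //; lia.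
have mono c d : (0 < c)%N -> (c <= d)%N -> (col_len la d <= col_len la c)%N.
  by move=> c0 cd; apply: sub_count => x; apply: leq_trans.
have coln c : (col_len la c <= n)%N.
  by apply: leq_trans (count_size _ _) _; rewrite size_iota.
set A := map _ _; set B := map _ _.
have ul : uniq (A ++ B).
  rewrite cat_uniq; apply/and3P; split.
  - rewrite map_inj_in_uniq ?iota_uniq // => x y; rewrite !mem_iota => hx hy.
    have [] := hook' x ltac:(lia); have [] := hook' y ltac:(lia) => -> h1 -> h2.
    by case: (ltngtP x y) => // xy; have := mono x y; have := mono y x; lia.
  - apply/hasPn => _ /mapP[j + ->]; rewrite mem_iota => hj; apply/negP => /mapP[c].
    rewrite mem_iota => hc; have [|-> h1] := hook' c; first lia.
    have := @part_mono la i j pla i0; have := @col_lenP la c j pla; lia.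
  - rewrite map_inj_in_uniq ?iota_uniq // => x y; rewrite !mem_iota => hx hy.
    have := @part_mono la i x pla; have := @part_mono la i y pla.
    have := @part_mono la y x pla; have := @part_mono la x y pla; lia.
have sub : {subset A ++ B <= iota 1 (part la i + n - i)}.
  move=> x; rewrite mem_cat mem_iota => /orP[] /mapP[y]; rewrite mem_iota => hy ->.
    have [|-> h1] := hook' y; first lia.
    by have := coln y; lia.
  by have := @part_mono la i y pla; lia.
have [|_ e] := uniq_min_size ul sub.
  by rewrite size_iota size_cat !size_map !size_iota; lia.
exact: uniq_perm (iota_uniq _ _) e.
Qed.

(** * Shifted hook lengths *)

Definition shifted_col_len (s : seq nat) (j : nat) : nat :=
  count (fun i => j <= i + part s i)%N (iota 1 (size s)).

Lemma mem_shifted_boxes s i j :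
  ((i, j) \in shifted_boxes s) = (0 < i)%N && (i < j <= i + part s i)%N.
Proof.
rewrite mem_pairs !mem_iota.
by case: (leqP i (size s)) => h; last rewrite part_default //; lia.
Qed.

Lemma shifted_boxes_uniq s : uniq (shifted_boxes s).
Proof.
apply: allpairs_uniq_dep => [||[a b] [c d] _ _ [-> ->]//]; first exact: iota_uniq.
by move=> *; apply: iota_uniq.
Qed.

Lemma strict_pos s i : is_strict s -> (0 < i <= size s)%N -> (0 < part s i)%N.
Proof. by move=> /andP[_ h] hi; apply: part_gt0. Qed.

Lemma shifted_col_lenP s i j : is_strict s -> (size s < j)%N -> (0 < i <= size s)%N ->
  (j <= i + part s i)%N = (i <= shifted_col_len s j)%N.
Proof.
move=> st hj /andP[i0 hi]; rewrite /shifted_col_len -size_filter.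
set l := filter _ _.
have hl x : (x \in l) = (0 < x <= size s)%N && (j <= x + part s x)%N.
  by rewrite mem_filter mem_iota; lia.
have := @size_row_initial l _ _ _ i; rewrite hl i0 hi /= => -> //.
- by rewrite filter_uniq // iota_uniq.
- by rewrite hl.
- move=> x y; rewrite !hl => /andP[x0 hx] /andP[y0 yx].
  have := @strict_part s y x st; have := strict_pos st x0; lia.
Qed.

(** A column j <= [size s] meets exactly the rows above row j, and the hook then turns into row j,
    whose length is the extra term of [shifted_hook]: arm, leg and this term add up to a sum of two
    parts. *)
Lemma shifted_hookE s i j : is_strict s -> (0 < i)%N -> (i < j <= i + part s i)%N ->
  shifted_hook s (i, j) =
  if (j <= size s)%N then (part s i + part s j)%N
  else (i + part s i - j + (shifted_col_len s j - i) + 1)%N.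
Proof.
move=> st i0 /andP[ij hj].
have his : (i <= size s)%N.
  by rewrite leqNgt; apply/negP => /part_default e; rewrite e in hj; lia.
rewrite /shifted_hook /arm /leg.
rewrite (@count_uniq_eq _ _ _ [seq (i, c) | c <- iota j.+1 (i + part s i - j)]); first last.
- move=> [x y]; rewrite mem_shifted_boxes /=; apply/mapP/idP => [[z]|h].
    by rewrite mem_iota => hz [-> ->]; lia.
  by exists y; move: h => /andP[/andP[/eqP-> ?] ?] //; rewrite mem_iota; lia.
- by rewrite map_inj_uniq ?iota_uniq // => x y [].
- exact: shifted_boxes_uniq.
rewrite size_map size_iota.
case: ifP => hjs.
  rewrite (@count_uniq_eq _ _ _ [seq (c, j) | c <- iota i.+1 (j - i.+1)]); first last.
  - have pj : (0 < part s j)%N by apply: strict_pos => //; lia.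
    move=> [x y]; rewrite mem_shifted_boxes /=; apply/mapP/idP => [[z]|h].
      rewrite mem_iota => hz [-> ->].
      by have := @strict_part s z j st; lia.
    by exists x; [rewrite mem_iota; lia|congr (_, _); lia].
  - by rewrite map_inj_uniq ?iota_uniq // => x y [].
  - exact: shifted_boxes_uniq.
  by rewrite size_map size_iota /=; lia.
rewrite [part s j]part_default; last lia.
rewrite addn0; congr (_ + _ + _)%N.
rewrite (@count_uniq_eq _ _ _ [seq (c, j) | c <- iota i.+1 (shifted_col_len s j - i)]); first last.
- have hc : (shifted_col_len s j <= size s)%N.
    by apply: leq_trans (count_size _ _) _; rewrite size_iota.
  move=> [x y]; rewrite mem_shifted_boxes /=; apply/mapP/idP => [[z]|h].
    rewrite mem_iota => hz [-> ->].
    by have := @shifted_col_lenP s z j st; lia.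
  exists x; last by congr (_, _); lia.
  have xs : (x <= size s)%N.
    by rewrite leqNgt; apply/negP => /part_default e; move: h; rewrite e; lia.
  move: h => /andP[/andP[h1 /eqP e] h2]; rewrite e in h2.
  by rewrite mem_iota; have := @shifted_col_lenP s x j st; lia.
- by rewrite map_inj_uniq ?iota_uniq // => x y [].
- exact: shifted_boxes_uniq.
by rewrite size_map size_iota.
Qed.

(** The counting argument of [hook_row]: the columns up to [size s] produce the sums of parts, and
    the other columns fill the gaps that the differences of parts leave in the interval. *)
Lemma shifted_hook_row s i : is_strict s -> (0 < i <= size s)%N ->
  perm_eq ([seq shifted_hook s (i, j) | j <- iota i.+1 (part s i)] ++
           [seq part s i - part s j | j <- iota i.+1 (size s - i)])%N
          (iota 1 (part s i) ++ [seq part s i + part s j | j <- iota i.+1 (size s - i)])%N.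
Proof.
move=> st /andP[i0 hi].
have sp x y := @strict_part s x y st.
have pos x : (0 < x <= size s)%N -> (0 < part s x)%N by apply: strict_pos.
have hook' j : (i < j <= i + part s i)%N -> (size s < j)%N ->
    shifted_hook s (i, j) = (i + part s i - j + (shifted_col_len s j - i) + 1)%N /\
    (i <= shifted_col_len s j <= size s)%N.
  move=> hj sj; rewrite shifted_hookE // leqNgt sj; split=> //.
  rewrite -shifted_col_lenP ?i0 //; apply/andP; split; first lia.
  by apply: leq_trans (count_size _ _) _; rewrite size_iota.
have hook1 j : (i < j <= i + part s i)%N -> (j <= size s)%N ->
    shifted_hook s (i, j) = (part s i + part s j)%N.
  by move=> h1 h2; rewrite shifted_hookE // h2.
have mono c d : (size s < c)%N -> (c <= d)%N -> (shifted_col_len s d <= shifted_col_len s c)%N.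
  by move=> c0 cd; apply: sub_count => x; apply: leq_trans.
set A := map _ _; set B := map _ _; set R := _ ++ map _ _.
have ul : uniq (A ++ B).
  rewrite cat_uniq; apply/and3P; split.
  - rewrite map_inj_in_uniq ?iota_uniq // => x y; rewrite !mem_iota => hx hy.
    have := hook' x ltac:(lia); have := hook' y ltac:(lia).
    have := hook1 x ltac:(lia); have := hook1 y ltac:(lia).
    have := sp x y; have := sp y x; have := pos x; have := pos y.
    case: (leqP x (size s)) => h1; case: (leqP y (size s)) => h2.
    + by move=> p1 p2 p3 p4 -> // -> // _ _; lia.
    + by move=> p1 p2 p3 p4 _ -> // [] // -> h3 _; lia.
    + by move=> p1 p2 p3 p4 -> // _ _ [] // -> h3; lia.
    + move=> _ _ _ _ _ _ [] // -> h3 [] // -> h4.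
      by case: (ltngtP x y) => // xy; have := mono x y; have := mono y x; lia.
  - apply/hasPn => _ /mapP[j + ->]; rewrite mem_iota => hj; apply/negP => /mapP[c].
    rewrite mem_iota => hc; have pj := pos j ltac:(lia).
    case: (leqP c (size s)) => h1.
      by rewrite hook1 //; lia.
    have [||-> h2] := hook' c; [lia|by []|].
    have := @shifted_col_lenP s j c st; have := sp i j; lia.
  - rewrite map_inj_in_uniq ?iota_uniq // => x y; rewrite !mem_iota => hx hy.
    have := sp x y; have := sp y x; have := pos x; have := pos y; have := sp i x; have := sp i y; lia.
have sub : {subset A ++ B <= R}.
  move=> x; rewrite mem_cat => /orP[] /mapP[y]; rewrite mem_iota => hy ->.
    case: (leqP y (size s)) => h1.
      have -> := hook1 y ltac:(lia) h1.
      by rewrite mem_cat; apply/orP; right; apply/mapP; exists y; rewrite // mem_iota; lia.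
    have [||-> h2] := hook' y; [lia|by []|].
    by rewrite mem_cat mem_iota; apply/orP; left; lia.
  rewrite mem_cat mem_iota; apply/orP; left.
  by have := sp i y; have := pos y; lia.
have ur : uniq R.
  rewrite cat_uniq iota_uniq /=; apply/andP; split.
    apply/hasPn => _ /mapP[j + ->]; rewrite !mem_iota => hj.
    by have := pos j; lia.
  rewrite map_inj_in_uniq ?iota_uniq // => x y; rewrite !mem_iota => hx hy.
  by have := sp x y; have := sp y x; have := pos x; have := pos y; lia.
have [|_ e] := uniq_min_size ul sub.
  by rewrite !size_cat !size_map !size_iota; lia.
exact: uniq_perm ur e.
Qed.

(** * Ratios of hook products as Lagrange weights *)

Lemma pair_prod_split (n : nat) (j : 'I_n) (f : 'I_n -> 'I_n -> rat) :
  \prod_(i < n) \prod_(i' < n | (i < i')%N) f i i' =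
  (\prod_(i < n | i != j) \prod_(i' < n | (i' != j) && (i < i')%N) f i i') *
  \prod_(i < n | i != j) (if (i < j)%N then f i j else f j i).
Proof.
rewrite (bigD1 j) //= mulrC.
have -> : \prod_(i' < n | (j < i')%N) f j i' =
          \prod_(i < n | i != j) (if (j < i)%N then f j i else 1).
  rewrite big_mkcond [RHS]big_mkcond; apply: eq_bigr => i _.
  by case: eqVneq => [->|] /=; rewrite ?ltnn.
rewrite -!big_split; apply: eq_bigr => i ij /=.
rewrite (bigID (pred1 j)) /= mulrAC mulrC; congr (_ * _).
  by apply: eq_bigl => i'; rewrite andbC.
have {}ij : (i == j :> nat) = false by apply: contraNF ij.
case: (ltngtP i j) ij => // ij _.
  rewrite (big_pred1 j) ?mulr1 // => i' /=.
  by case: eqVneq => [->|]; rewrite ?andbF ?ij.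
rewrite big_pred0 ?mul1r // => i' /=.
by case: eqVneq => [->|]; rewrite ?andbF // andbT ltnNge ltnW.
Qed.

(* Ratio of two quantities of the shape
   prod_i (l_i)! / prod_(i < i') K (l_i, l_i'), where l_j increases by 1. *)
Lemma frobenius_ratio (n : nat) (K : rat -> rat -> rat) (l l' : 'I_n -> nat)
    (j : 'I_n) (h h' : rat) :
  (forall x y, K x y = - K y x) ->
  (forall i, l' i = l i + (i == j))%N ->
  (forall i i' : 'I_n, (i < i')%N -> K (l i)%:R (l i')%:R != 0) ->
  (forall i i' : 'I_n, (i < i')%N -> K (l' i)%:R (l' i')%:R != 0) ->
  h * \prod_(i < n) \prod_(i' < n | (i < i')%N) K (l i)%:R (l i')%:R = \prod_i (l i)`!%:R ->
  h' * \prod_(i < n) \prod_(i' < n | (i < i')%N) K (l' i)%:R (l' i')%:R = \prod_i (l' i)`!%:R ->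
  h / h' = (l j).+1%:R^-1 *
           \prod_(i | i != j) (K (l j).+1%:R (l i)%:R / K (l j)%:R (l i)%:R).
Proof.
move=> anti e K0 K0'.
have ne i : i != j -> l' i = l i by rewrite e => /negbTE ->; rewrite addn0.
have ej : l' j = (l j).+1 by rewrite e eqxx addn1.
rewrite !(pair_prod_split j) => H H'.
rewrite [RHS](bigD1 j) //= in H; rewrite [RHS](bigD1 j) //= ej factS in H'.
move: H H'.
set P := \prod_(i | i != j) \prod_(i' | _) _.
set P' := \prod_(i | i != j) \prod_(i' | _) _.
have <- : P = P'.
  by apply: eq_bigr => i ij; apply: eq_bigr => i' /andP[ij' _]; rewrite !ne.
set Q := (X in h * (P * X)); set R := (X in (l j)`!%:R * X).
set Q' := (X in h' * (P * X)); set R' := \prod_(i < n | i != j) (l' i)`!%:R.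
have <- : R = R' by apply: eq_bigr => i ij; rewrite ne.
have P0 : P != 0.
  by apply/prodf_neq0 => i _; apply/prodf_neq0 => i' /andP[_]; apply: K0.
have side (i : 'I_n) : i != j -> (i < j)%N || (j < i)%N by rewrite -neq_ltn.
have Q0 : Q != 0.
  apply/prodf_neq0 => i /side; case: ifP => [h1 _|_ /= h2]; exact: K0.
have Q'0 : Q' != 0.
  by apply/prodf_neq0 => i /side; rewrite -ej; case: ifP => [h1 _|_ /= h2]; apply: K0'.
have R0 : R != 0 by apply/prodf_neq0 => i _; rewrite pnatr_eq0 -lt0n fact_gt0.
have f0 : (l j)`!%:R != 0 :> rat by rewrite pnatr_eq0 -lt0n fact_gt0.
have s0 : (l j).+1%:R != 0 :> rat by rewrite pnatr_eq0.
have -> : \prod_(i | i != j) (K (l j).+1%:R (l i)%:R / K (l j)%:R (l i)%:R) = Q' / Q.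
  rewrite -prodf_div; apply: eq_bigr => i ij; rewrite ne // ?ej.
  by case: ifP => // _; rewrite anti [K (l j)%:R _]anti invrN mulrNN.
move=> /(canRL (mulfK (mulf_neq0 P0 Q0))) ->.
move=> /(canRL (mulfK (mulf_neq0 P0 Q'0))) ->.
rewrite natrM; move: (l j).+1%:R (l j)`!%:R s0 f0 => x y x0 y0.
by field; rewrite P0 Q0 Q'0 R0 x0 y0.
Qed.

Lemma prod_iota_fact m : (\prod_(i <- iota 1 m) i = m`!)%N.
Proof. by rewrite fact_prod /index_iota subn1. Qed.

Lemma big_iota_ord (R : Type) (idx : R) (op : Monoid.law idx) n m (f : nat -> R) :
  \big[op/idx]_(i <- iota m n) f i = \big[op/idx]_(i < n) f (m + i)%N.
Proof.
rewrite -(big_mkord xpredT (fun i => f (m + i)%N)) /index_iota subn0.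
by rewrite -[m in iota m]addn0 iotaDl big_map.
Qed.

Lemma big_iota_ord_gt (n : nat) (i : 'I_n) (f : nat -> rat) :
  \prod_(j <- iota i.+2 (n - i.+1)) f j = \prod_(j < n | (i < j)%N) f j.+1.
Proof.
rewrite (eq_bigr (fun j : 'I_n => (fun k => f k.+1) (nat_of_ord j))) //.
rewrite -(@big_geq_mkord _ _ _ i.+1 n xpredT (fun k => f k.+1)) /index_iota.
by rewrite -[iota i.+2 _]/(iota (1 + i.+1) _) iotaDl big_map.
Qed.

(** The beta-numbers of [la] seen as a partition with [n] rows, possibly empty. *)
Definition beta (n : nat) (la : seq nat) (i : nat) : nat := (nth 0%N la i + (n - i.+1))%N.

Lemma hook_prod_beta la n : is_part la -> (size la <= n)%N ->
  (hook_prod la)%:R *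
  \prod_(i < n) \prod_(i' < n | (i < i')%N) ((beta n la i)%:R - (beta n la i')%:R)
  = \prod_(i < n) (beta n la i)`!%:R :> rat.
Proof.
move=> pla hn.
have -> : (hook_prod la = \prod_(i < n) \prod_(c <- iota 1 (nth 0%N la i)) hook la (i.+1, c))%N.
  rewrite /hook_prod /boxes big_allpairs_dep big_iota_ord.
  rewrite (big_ord_widen _ (fun i => \prod_(c <- iota 1 (part la i.+1)) hook la (i.+1, c))%N hn).
  rewrite big_mkcond; apply: eq_bigr => i _; case: ltnP => // hi.
  by rewrite nth_default // big_nil.
rewrite natr_prod -big_split; apply: eq_bigr => i _ /=.
have hi : (0 < i.+1 <= n)%N by rewrite ltn_ord.
have := perm_big _ (hook_row pla hn hi) : (\prod_(x <- _) x = \prod_(x <- _) x)%N.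
set d := (part la i.+1 + n - i.+1)%N; rewrite prod_iota_fact big_cat !big_map /=.
have -> : d = beta n la i by rewrite /d /beta /part /=; have := ltn_ord i; lia.
move=> <-; rewrite natrM; congr (_ * _).
rewrite natr_prod big_iota_ord_gt; apply: eq_bigr => i' ii'.
have := @part_mono la i.+1 i'.+1 pla isT (ltnW ii').
have := ltn_ord i'; rewrite /beta /part /= => h1 h2.
by rewrite -natrB; [congr (_%:R); lia|lia].
Qed.

(** Obtained row by row from [shifted_hook_row]. The index [size s], where the part is 0,
    contributes only factors 1; it is included because a move may create a part there. *)
Lemma shifted_hook_prod_beta s : is_strict s ->
  (shifted_hook_prod s)%:R *
  \prod_(i < (size s).+1) \prod_(i' < (size s).+1 | (i < i')%N)
     (((nth 0%N s i)%:R - (nth 0%N s i')%:R) / ((nth 0%N s i)%:R + (nth 0%N s i')%:R))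
  = \prod_(i < (size s).+1) (nth 0%N s i)`!%:R :> rat.
Proof.
move=> st.
have -> : (shifted_hook_prod s =
   \prod_(i < size s) \prod_(c <- iota i.+2 (nth 0%N s i)) shifted_hook s (i.+1, c))%N.
  by rewrite /shifted_hook_prod /shifted_boxes big_allpairs_dep big_iota_ord.
rewrite natr_prod [in LHS]big_ord_recr [RHS]big_ord_recr /=.
rewrite [X in _ * (_ * X)]big1 => [|i]; last first.
  by rewrite ltnNge -ltnS ltn_ord.
rewrite [nth 0%N s (size s)]nth_default // fact0 !mulr1 -big_split.
apply: eq_bigr => i _ /=.
have hi : (0 < i.+1 <= size s)%N by rewrite ltn_ord.
have pi := strict_pos st hi.
rewrite [\prod_(_ < _ | _) _]big_mkcond big_ord_recr /= ltn_ord [nth 0%N s (size s)]nth_default //.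
have pi0 : (nth 0%N s i)%:R != 0 :> rat by rewrite pnatr_eq0 -lt0n.
rewrite [X in _ * (_ * X)](_ : _ = 1) ?mulr1; last first.
  by rewrite -[RHS](divff pi0); congr (_ / _); [exact: subr0 | exact: addr0].
rewrite -big_mkcond prodf_div /= mulrA.
set X := \prod_(_ | _) _; set Y := \prod_(_ | _) _.
have Y0 : Y != 0.
  apply/prodf_neq0 => i' _; rewrite -natrD pnatr_eq0 -lt0n.
  by rewrite addn_gt0 [(0 < nth 0%N s i)%N]pi.
apply: (canLR (mulfK Y0)).
have := perm_big _ (shifted_hook_row st hi) : (\prod_(x <- _) x = \prod_(x <- _) x)%N.
rewrite !big_cat prod_iota_fact !big_map /=.
move=> /(congr1 (fun x => x%:R : rat)); rewrite !natrM !natr_prod /= !big_iota_ord_gt.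
have -> : \prod_(j < size s | (i < j)%N) (part s i.+1 + part s j.+1)%:R = Y.
  by apply: eq_bigr => i' _; rewrite natrD.
move=> <-; congr (_ * _); apply: eq_bigr => i' ii'; rewrite natrB //.
have := @strict_part s i.+1 i'.+1 st isT (ltnW ii').
have := @strict_pos s i'.+1 st; rewrite ltn_ord /part /=; lia.
Qed.

Lemma is_part_incr la (j : nat) : is_part la ->
  (j == 0%N) || (nth 0%N la j < nth 0%N la j.-1)%N -> is_part (incr_nth la j).
Proof.
move=> pla hj; have js : (j <= size la)%N.
  case: j hj => // j /=; case: (ltnP j (size la)) => // h.
  by rewrite [X in (_ < X)%N]nth_default.
have mono i : (nth 0%N la i.+1 <= nth 0%N la i)%N by exact: (@part_mono la i.+1 i.+2 pla isT (leqnSn _)).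
apply/andP; split.
  apply/(sortedP 0%N) => i _; rewrite /geq /= !nth_incr_nth.
  have := mono i; case: eqP => [e|_]; last by lia.
  by move: hj; rewrite e /=; lia.
apply/negP => /(nthP 0%N)[i]; rewrite nth_incr_nth size_incr_nth.
move: pla => /andP[_ n0]; case: (eqVneq j i) => [->//|ij].
case: ifP => h h1; rewrite add0n => h2; first by rewrite -h2 mem_nth in n0.
have hi : (i < size la)%N by move/eqP: ij; lia.
by case/negP: n0; rewrite -[X in X \in _]h2; apply: mem_nth.
Qed.

Lemma is_strict_incr s (j : nat) : is_strict s ->
  (j == 0%N) || ((nth 0%N s j).+1 < nth 0%N s j.-1)%N -> is_strict (incr_nth s j).
Proof.
move=> st hj; have js : (j <= size s)%N.
  case: j hj => // j /=; case: (ltnP j (size s)) => // h.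
  by rewrite [X in (_ < X)%N]nth_default.
have /andP[/(sortedP 0%N) mono n0] := st.
apply/andP; split.
  apply/(sortedP 0%N) => i; rewrite size_incr_nth /gtn /= !nth_incr_nth => hi.
  case: (eqVneq j i.+1) => [e|ij]; first by move: hj; rewrite e /=; lia.
  have := mono i; rewrite /gtn /=; case: ifP hi; lia.
apply/negP => /(nthP 0%N)[i]; rewrite nth_incr_nth size_incr_nth.
case: (eqVneq j i) => [->//|ij].
case: ifP => h h1; rewrite add0n => h2; first by rewrite -h2 mem_nth in n0.
have hi : (i < size s)%N by move/eqP: ij; lia.
by case/negP: n0; rewrite -[X in X \in _]h2; apply: mem_nth.
Qed.

(** The weights depend on differences only, so the offset [c] is free; it is chosen later so that
    the value is the place of the bead in the word of the whole partition. *)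
Definition bead_pos (t c : rat) (la : seq nat) (i : nat) : rat :=
  t * ((nth 0%N la i)%:R - i%:R) + c.

Definition bead_weight (t c : rat) (la : seq nat) (n : nat) : 'I_n.+1 -> rat :=
  lagr (fun i : 'I_n.+1 => bead_pos t c la i) (fun i : 'I_n => bead_pos t c la i - t).

Lemma beta_lt n la i i' : is_part la -> (i < i' < n)%N -> (beta n la i' < beta n la i)%N.
Proof.
move=> pla hi; have := part_mono pla (isT : (0 < i.+1)%N) (j := i'.+1).
by rewrite /part /beta /=; lia.
Qed.

Lemma bead_pos_beta t c la n i : (i <= n)%N ->
  bead_pos t c la i = t * ((beta n.+1 la i)%:R - n%:R) + c.
Proof.
by move=> hi; rewrite /bead_pos /beta subSS natrD natrB //; congr (_ * _ + _); ring.
Qed.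

Lemma bead_pos_inj t c la n : t != 0 -> is_part la ->
  injective (fun i : 'I_n.+1 => bead_pos t c la i).
Proof.
move=> t0 pla i i' /=; rewrite !(bead_pos_beta _ _ _ (leq_ord _)).
move=> /addIr /(mulfI t0) /addIr /eqP; rewrite eqr_nat => /eqP e; apply/val_inj.
have := @beta_lt n.+1 la i i' pla; have := @beta_lt n.+1 la i' i pla.
have := ltn_ord i; have := ltn_ord i'; rewrite /=; lia.
Qed.

(** The row of index [n] is empty and has beta-number 0, so its factor l_j + 1 cancels the ratio of
    the factorials. There remain n factors l_j + 1 - l_i over n differences l_j - l_i, and the scale
    t^n cancels. *)
Lemma hook_ratio t c la n (j : 'I_n.+1) : t != 0 -> is_part la ->
  (size la <= n)%N -> is_part (incr_nth la j) ->
  (hook_prod la)%:R / (hook_prod (incr_nth la j))%:R = bead_weight t c la j.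
Proof.
move=> t0 pla hn pla'.
have hn' : (size (incr_nth la j) <= n.+1)%N.
  by rewrite size_incr_nth; case: ifP => _; [exact: leqW|exact: ltn_ord].
pose l (i : 'I_n.+1) := beta n.+1 la i.
pose l' (i : 'I_n.+1) := beta n.+1 (incr_nth la j) i.
have nz m mu (i i' : 'I_m) : is_part mu -> (i < i')%N ->
    (beta m mu i)%:R - (beta m mu i')%:R != 0 :> rat.
  move=> pm ii'; rewrite subr_eq0 eqr_nat neq_ltn orbC beta_lt //.
  by rewrite ii' ltn_ord.
rewrite (@frobenius_ratio _ (fun x y => x - y) l l' j _ _ _ _ _ _
          (hook_prod_beta pla (leqW hn)) (hook_prod_beta pla' hn')); first last.
- by move=> i i'; apply: nz.
- by move=> i i'; apply: nz.
- by move=> i; rewrite /l /l' /beta nth_incr_nth -addnA addnC eq_sym.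
- by move=> x y; rewrite opprB.
pose D := \prod_(i | i != j) ((l j)%:R - (l i)%:R : rat).
have D0 : D != 0.
  apply/prodf_neq0 => i; rewrite neq_ltn => /orP[] ij; last exact: nz.
  by rewrite -oppr_eq0 opprB nz.
pose N := \prod_(i < n) ((l j)%:R + 1 - (beta n.+1 la i)%:R : rat).
have lj0 : (l j).+1%:R != 0 :> rat by rewrite pnatr_eq0.
have -> : \prod_(i | i != j) (((l j).+1%:R - (l i)%:R) / ((l j)%:R - (l i)%:R))
          = (l j).+1%:R * N / D :> rat.
  rewrite prodf_div; congr (_ / _).
  have e1 : \prod_i ((l j).+1%:R - (l i)%:R) = N * (l j).+1%:R :> rat.
    rewrite big_ord_recr /=; congr (_ * _).
      by apply: eq_bigr => i _; rewrite -natr1.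
    by rewrite (_ : l ord_max = 0%N) ?subr0 // /l /beta /= nth_default //; lia.
  by rewrite mulrC -e1 [RHS](bigD1 j) //= -[in X in X * _]natr1 [_ + 1]addrC addrK mul1r.
rewrite mulrA mulrA mulVf // mul1r /bead_weight /lagr.
have -> : \prod_(i < n) (bead_pos t c la j - (bead_pos t c la i - t)) = t ^+ n * N.
  rewrite -[in X in t ^+ X](card_ord n) -prodr_const -big_split /=.
  apply: eq_bigr => i _; rewrite (bead_pos_beta _ _ _ (leq_ord j)) (bead_pos_beta _ _ _ (ltnW (ltn_ord i))).
  by rewrite /l; ring.
have -> : \prod_(i < n.+1 | i != j) (bead_pos t c la j - bead_pos t c la i) = t ^+ n * D.
  have -> : t ^+ n = \prod_(i < n.+1 | i != j) t by rewrite prodr_const cardC1 card_ord.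
  rewrite -big_split /=.
  apply: eq_bigr => i _; rewrite !(bead_pos_beta _ _ _ (leq_ord _)).
  by rewrite /l; ring.
by field; rewrite D0 expf_neq0.
Qed.

(** If row [j] cannot grow, row [j.-1] has the same length: the place t beyond bead [j] is occupied
    by bead [j.-1], and the numerator contains the factor 0. Sums over admissible boxes may thus be
    extended to all rows. *)
Lemma bead_weight0 t c la n (j : 'I_n.+1) : is_part la ->
  ~~ is_part (incr_nth la j) -> bead_weight t c la j = 0.
Proof.
move=> pla /(contra (is_part_incr pla)); rewrite negb_or -leqNgt => /andP[j0 hj].
have jn : (j.-1 < n)%N by have := ltn_ord j; lia.
rewrite /bead_weight /lagr (bigD1 (Ordinal jn)) //=.
rewrite (_ : bead_pos t c la j - _ = 0) ?mul0r //.
have -> : nat_of_ord j = j.-1.+1 by rewrite prednK // lt0n.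
rewrite /bead_pos /= [nth 0%N la j.-1.+1](_ : _ = nth 0%N la j.-1); last first.
  apply/eqP; rewrite eqn_leq (@part_mono la j.-1.+1 j.-1.+2 pla) //=.
  by rewrite prednK // lt0n.
by rewrite -natr1; ring.
Qed.

(** From oblong a - oblong b = (a - b)(a + b + 1), the kernel K (y, z) = (y - z) / (y + z) satisfies
    K (y + 1, z) / K (y, z) = (oblong y - oblong (z - 1)) / (oblong y - oblong z). *)
Definition oblong (y : rat) : rat := y * (y + 1).

Definition strict_weight (s : seq nat) : 'I_(size s).+1 -> rat :=
  lagr (fun i : 'I_(size s).+1 => oblong (nth 0%N s i)%:R)
       (fun i : 'I_(size s) => oblong ((nth 0%N s i)%:R - 1)).

Lemma strict_nth_lt s i i' : is_strict s -> (i < i' <= size s)%N -> (nth 0%N s i' < nth 0%N s i)%N.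
Proof.
move=> st hi; have := @strict_part s i.+1 i'.+1 st; have := @strict_pos s i'.+1 st.
have := @strict_pos s i.+1 st.
rewrite /part /=; case: (ltnP i' (size s)) => h; last first.
  by rewrite [nth _ _ i']nth_default //; lia.
lia.
Qed.

Lemma oblong_inj s : is_strict s ->
  injective (fun i : 'I_(size s).+1 => oblong (nth 0%N s i)%:R).
Proof.
move=> st i i' /= e; apply/val_inj => /=.
have e' : (nth 0%N s i)%:R = (nth 0%N s i')%:R :> rat.
  move: e; rewrite /oblong; have := ler0n rat (nth 0%N s i); have := ler0n rat (nth 0%N s i').
  move: (_%:R) (_%:R) => x y; nra.
move/eqP: e'; rewrite eqr_nat => /eqP e'.
have := @strict_nth_lt s i i' st; have := @strict_nth_lt s i' i st.
have := ltn_ord i; have := ltn_ord i'; lia.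
Qed.

(** [frobenius_ratio] yields 1 / (y_j + 1) times a product over all indices but [j], whereas the
    numerator of the weight omits the index [size s]. For [j < size s], exchanging the two replaces
    the factor y_j (y_j + 1) by 2 y_j, whence the 2; for a new part, y_j = 0 and the products
    coincide. *)
Lemma shifted_hook_ratio s (j : 'I_(size s).+1) : is_strict s ->
  is_strict (incr_nth s j) ->
  (if (j < size s)%N then 2 else 1) *
  (shifted_hook_prod s)%:R / (shifted_hook_prod (incr_nth s j))%:R = strict_weight j.
Proof.
move=> st st'.
set n := size s; pose y (i : 'I_n.+1) := nth 0%N s i.
pose y' (i : 'I_n.+1) := nth 0%N (incr_nth s j) i.
pose K (x z : rat) := (x - z) / (x + z).
have nz mu (i i' : nat) : is_strict mu -> (i < i' <= size mu)%N ->
    K (nth 0%N mu i)%:R (nth 0%N mu i')%:R != 0.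
  move=> sm hi; have := strict_nth_lt sm hi => h.
  rewrite mulf_neq0 ?invr_eq0 // -?natrD ?pnatr_eq0 ?subr_eq0 ?eqr_nat; lia.
have size' : (n <= size (incr_nth s j))%N by rewrite size_incr_nth; case: ifP => //; lia.
have E : (shifted_hook_prod (incr_nth s j))%:R *
   \prod_(i < n.+1) \prod_(i' < n.+1 | (i < i')%N) K (y' i)%:R (y' i')%:R
   = \prod_(i < n.+1) (y' i)`!%:R :> rat.
  have := shifted_hook_prod_beta st'.
  have [e|e] : size (incr_nth s j) = n \/ size (incr_nth s j) = n.+1.
  - by rewrite size_incr_nth; case: ifP => h; [left|right; have := ltn_ord j; lia].
  - by rewrite e.
  rewrite e [RHS]big_ord_recr /= [X in _ = _ * X](_ : _ = 1); last first.
    by rewrite nth_default ?fact0 // e.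
  rewrite mulr1 => <-; congr (_ * _).
  rewrite [RHS]big_ord_recr /= [X in _ = _ * X]big1 => [|i]; last first.
    by rewrite ltnNge -ltnS ltn_ord.
  rewrite mulr1; apply: eq_bigr => i _.
  rewrite [RHS]big_mkcond big_ord_recr /= ltn_ord -big_mkcond /=.
  rewrite [nth 0%N _ n.+1]nth_default ?e // /K.
  have yi : y' i != 0%N.
    move: st' => /andP[_]; apply: contraNneq => <-; apply: mem_nth; rewrite e.
    exact: ltn_ord.
  rewrite [X in _ = _ * X](_ : _ = 1) ?mulr1 //.
  have yi' : (y' i)%:R != 0 :> rat by rewrite pnatr_eq0.
  by rewrite -[RHS](divff yi'); congr (_ / _); [exact: subr0 | exact: addr0].
rewrite -mulrA (@frobenius_ratio _ K y y' j _ _ _ _ _ _ (shifted_hook_prod_beta st) E); first last.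
- move=> i i' ii'; apply: nz => //; rewrite ii' /=; apply: leq_trans size'.
  exact: leq_ord.
- by move=> i i' ii'; apply: nz => //; rewrite ii' leq_ord.
- by move=> i; rewrite /y /y' nth_incr_nth addnC eq_sym.
- by move=> x z; rewrite /K [z + x]addrC -mulNr opprB.
pose N (i : nat) : rat := oblong (y j)%:R - oblong ((nth 0%N s i)%:R - 1).
pose D := \prod_(i | i != j) (oblong (y j)%:R - oblong (y i)%:R).
have D0 : D != 0.
  apply/prodf_neq0 => i ij; rewrite subr_eq0; apply: contraNneq ij => e.
  by rewrite eq_sym; apply/eqP/(oblong_inj st).
have yj0 : (y j).+1%:R != 0 :> rat by rewrite pnatr_eq0.
have -> : \prod_(i | i != j) (K (y j).+1%:R (y i)%:R / K (y j)%:R (y i)%:R)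
          = (\prod_(i : 'I_n.+1 | i != j) N i) / D.
  rewrite -prodf_div; apply: eq_bigr => i ij.
  have ne : (y j)%:R != (y i)%:R :> rat.
    apply: contraNneq ij => e; rewrite eq_sym; apply/eqP/(oblong_inj st).
    by rewrite /= -/(y i) -/(y j) e.
  have h1 : (y j)%:R - (y i)%:R != 0 :> rat by rewrite subr_eq0.
  have h2 : (y j)%:R + (y i)%:R != 0 :> rat.
    by move: ne; rewrite -natrD eqr_nat pnatr_eq0; lia.
  have h3 : (y j)%:R + 1 + (y i)%:R != 0 :> rat.
    by rewrite natr1 -natrD pnatr_eq0 addSn.
  rewrite /K /N -/(y i) -natr1.
  move: (y j)%:R (y i)%:R h1 h2 h3 => a b h1 h2 h3.
  have -> : oblong a - oblong b = (a - b) * (a + 1 + b) by rewrite /oblong; ring.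
  by rewrite /oblong; field; rewrite h1 h2 h3.
have e : (\prod_(i : 'I_n.+1 | i != j) N i) * N j = (\prod_(i < n) N i) * N n.
  transitivity (\prod_(i < n.+1) N i); last by rewrite big_ord_recr.
  by rewrite [RHS](bigD1 j) //= mulrC.
have Nj : N j = 2 * (y j)%:R by rewrite /N /oblong -/(y j); ring.
have Nn : N n = (y j).+1%:R * (y j)%:R.
  rewrite /N nth_default // /oblong -natr1 mulr0n; ring.
rewrite /strict_weight /lagr -/(y j) -/D.
have -> : \prod_(j0 < size s) (oblong (y j)%:R - oblong ((nth 0%N s j0)%:R - 1)) =
  \prod_(i < n) N i by [].
case: ifP => hj.
  have yj : (y j)%:R != 0 :> rat.
    by rewrite pnatr_eq0 -lt0n; apply: (strict_pos st (i := j.+1)).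
  have -> : \prod_(i < n) N i = (\prod_(i : 'I_n.+1 | i != j) N i) * 2 / (y j).+1%:R.
    apply: (mulIf (_ : N n != 0)); first by rewrite Nn mulf_neq0.
    by rewrite -e Nj Nn; move: (y j).+1%:R yj0 => z z0; field.
  by move: (y j).+1%:R yj0 => z z0; field; rewrite D0 z0.
have ej : j = n :> nat.
  by apply/eqP; rewrite eqn_leq leq_ord leqNgt hj.
have yj : y j = 0%N by rewrite /y ej nth_default.
rewrite yj invr1 !mul1r; congr (_ / _).
rewrite big_mkcond big_ord_recr /= -(inj_eq val_inj) /= ej eqxx mulr1.
by apply: eq_bigr => i _; rewrite -(inj_eq val_inj) /= ej neq_ltn ltn_ord.
Qed.

Lemma strict_weight0 s (j : 'I_(size s).+1) : is_strict s ->
  ~~ is_strict (incr_nth s j) -> strict_weight j = 0.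
Proof.
move=> st /(contra (is_strict_incr st)); rewrite negb_or -leqNgt => /andP[j0 hj].
have jn : (j.-1 < size s)%N by have := ltn_ord j; lia.
rewrite /strict_weight /lagr (bigD1 (Ordinal jn)) //=.
have h := @strict_nth_lt s j.-1 j st.
have -> : nth 0%N s j.-1 = (nth 0%N s j).+1 by have := leq_ord j; lia.
by rewrite -natr1 addrK subrr !mul0r.
Qed.

(** * Words and quotients *)

Lemma boundary_falseP x rows p : sorted leq (x :: rows) ->
  reflect (exists2 m, (m < size rows)%N & (p + x = m + nth 0%N rows m)%N)
          (~~ nth true (boundary x rows) p).
Proof.
elim: rows x p => [|r rows IH] x p /=.
  by rewrite nth_nil => _; constructor => -[].
move=> /andP[xr sr].
have ge_r m : (m < size (r :: rows))%N -> (r <= nth 0%N (r :: rows) m)%N.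
  case: m => // m hm; have := order_path_min leq_trans sr => /allP; apply.
  exact: mem_nth.
rewrite nth_cat size_nseq nth_nseq.
case: ltngtP => [pr|pr|e]; last by rewrite e subnn /=; constructor; exists 0%N => //=; lia.
  by constructor => -[m /ge_r hm e]; lia.
have -> : (p - (r - x))%N = (p - (r - x)).-1.+1 by lia.
apply: (iffP (IH r _ sr)) => -[m hm e].
  by exists m.+1 => //=; lia.
case: m hm e => [|m] hm /= e; first by lia.
by exists m => //; lia.
Qed.

(** Every row ends with a vertical edge; the empty rows beyond [size la] give the infinitely many
    0's on the left. *)
Lemma beadP la k : is_part la ->
  reflect (exists2 j, (0 < j)%N & k = (part la j)%:Z - j%:Z) (~~ word la k).
Proof.
move=> pla; rewrite /word; case: ifP => hk; last first.
  constructor; exists (`|k|)%N; first by lia.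
  by rewrite part_default; lia.
apply: (iffP (boundary_falseP _ (sorted_rev_part pla))); rewrite size_rev.
  move=> [m hm]; rewrite nth_rev // => e; exists (size la - m)%N; first by lia.
  by rewrite /part (_ : (size la - m).-1 = size la - m.+1)%N; lia.
move=> [j j0 e]; have js : (j <= size la)%N.
  by rewrite leqNgt; apply/negP => h; move: e; rewrite part_default //; lia.
exists (size la - j)%N; first by lia.
rewrite nth_rev; last by lia.
by rewrite (_ : size la - (size la - j).+1 = j.-1)%N -?/(part la j); lia.
Qed.

Lemma rows_of_sorted x w : sorted leq (x :: rows_of x w).
Proof.
elim: w x => //= e w IH x; case: e => /=; last by rewrite leqnn; apply: IH.
have := IH x.+1; case: (rows_of _ _) => //= r rows /andP[h ->].
by rewrite ltnW.
Qed.

Lemma nth_boundary_rows_of x w p :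
  nth true (boundary x (rows_of x w)) p = nth true w p.
Proof.
elim: w x p => [//|e w IH] x p /=.
case: e => /=; last by rewrite subnn; case: p => /=.
have -> : nth true (boundary x (rows_of x.+1 w)) p =
          if p is p'.+1 then nth true (boundary x.+1 (rows_of x.+1 w)) p' else true.
  have := rows_of_sorted x.+1 w; case: (rows_of _ _) => [|r rows] /=.
    by rewrite nth_nil; case: p => // p; rewrite nth_nil.
  move=> /andP[xr _]; have -> : (r - x = (r - x.+1).+1)%N by lia.
  by case: p.
by case: p => //= p; rewrite IH.
Qed.

Lemma size_rows_of x w : size (rows_of x w) = count negb w.
Proof. by elim: w x => //= -[] w IH x /=; rewrite IH. Qed.

Lemma is_part_of_word w : is_part (part_of_word w).
Proof.
apply/andP; split; last by rewrite mem_filter.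
rewrite /part_of_word sorted_filter //.
  by move=> x y z yx zy; apply: leq_trans zy yx.
rewrite rev_sorted; have := rows_of_sorted 0 w.
by rewrite [sorted _ _]path_min_sorted //; apply/allP.
Qed.

(** The first letter of [w] has index minus the number of 0's in [w]. The empty rows discarded by
    [part_of_word] are leading 0's, which the word has there anyway. *)
Lemma word_part_of_word w k :
  word (part_of_word w) k =
  (0 <= k + (count negb w)%:Z) && nth true w (absz (k + (count negb w)%:Z)%R).
Proof.
rewrite -(nth_boundary_rows_of 0) -(size_rows_of 0).
have e : rows_of 0 w = nseq (count (pred1 0%N) (rows_of 0 w)) 0%N ++ rev (part_of_word w).
  rewrite /part_of_word filter_rev revK.
  have := rows_of_sorted 0 w; rewrite [sorted _ _]path_min_sorted; last exact/allP.
  elim: (rows_of _ _) => //= -[|r] rows IH srt /=; first by rewrite -IH // (path_sorted srt).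
  have h : all (ltn 0) (r.+1 :: rows).
    rewrite /=; apply/allP => y hy.
    by have /allP/(_ _ hy) := order_path_min leq_trans srt; apply: leq_trans.
  have -> : count (pred1 0%N) rows = 0%N.
    apply/eqP; rewrite -leqn0 leqNgt -has_count; apply/hasPn => y hy.
    by have /andP[_ /allP/(_ y hy)] := h; rewrite /= -lt0n.
  by rewrite add0n; congr (_ :: _); apply/esym/all_filterP; have /andP[] := h.
have sz := congr1 size e; move: e sz; set e := count _ _ => E.
rewrite size_cat size_nseq size_rev => ->; rewrite E.
have -> : forall l, boundary 0 (nseq e 0%N ++ l) = nseq e false ++ boundary 0 l.
  by move=> l; elim: (e) => //= m ->.
rewrite nth_cat size_nseq nth_nseq /word.
case: ifP => h1.
  have -> : 0 <= k + (e + size (part_of_word w))%:Z by lia.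
  rewrite /=; case: ifP => h2; first by lia.
  by congr (nth _ _ _); lia.
by case: ifP => h2; rewrite ?h2 ?andbF //; lia.
Qed.

(** Listed in decreasing order, the 0's of the two words must correspond one by one. Beyond the rows
    of both partitions the 0's occupy the same places, which forces the shift to be 0. *)
Lemma word_shift_inj la mu d : is_part la -> is_part mu ->
  (forall k, word la k = word mu (k + d)) -> d = 0 /\ la = mu.
Proof.
move=> pla pmu h.
pose x nu j := (part nu j.+1)%:Z - j.+1%:Z.
have xlt nu j j' : is_part nu -> (j < j')%N -> x nu j' < x nu j.
  by move=> pn jj; have := @part_mono nu j.+1 j'.+1 pn isT; rewrite /x; lia.
have xle nu j j' : is_part nu -> (j <= j')%N -> x nu j' <= x nu j.
  by move=> pn; rewrite leq_eqVlt => /orP[/eqP->//|/(xlt _ _ _ pn)/ltW].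
have ex1 j : exists j', x mu j' = x la j + d.
  have : ~~ word mu (x la j + d).
    by rewrite -h; apply/(beadP _ pla); exists j.+1.
  by move/(beadP _ pmu) => [[|j'] // _ ->]; exists j'.
have ex2 j : exists j', x la j' + d = x mu j.
  have : ~~ word la (x mu j - d).
    by rewrite h subrK; apply/(beadP _ pmu); exists j.+1.
  move/(beadP _ pla) => [[|j'] // _ e]; exists j'.
  by rewrite /x -e subrK.
have e j : x la j + d = x mu j.
  elim/ltn_ind: j => j IH; apply/le_anti/andP; split.
    have [m hm] := ex1 j; rewrite -hm; apply: (xle mu j m pmu).
    rewrite leqNgt; apply/negP => mj.
    by have := xlt la m j pla mj; have := IH m mj; lia.
  have [m hm] := ex2 j; rewrite -hm lerD2r; apply: (xle la j m pla).
  rewrite leqNgt; apply/negP => mj.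
  by have := xlt mu m j pmu mj; have := IH m mj; lia.
have d0 : d = 0.
  have := e (size la + size mu)%N; rewrite /x !part_default; lia.
split=> //; have ep j : nth 0%N la j = nth 0%N mu j.
  by have := e j; rewrite d0 /x /part /=; lia.
have le nu nu' : is_part nu' -> (forall j, nth 0%N nu' j = nth 0%N nu j) ->
    (size nu' <= size nu)%N.
  move=> /andP[_ n0] ee; rewrite leqNgt; apply/negP => hs.
  by case/negP: n0; rewrite -(nth_default 0%N (leqnn (size nu))) -ee mem_nth.
apply: (@eq_from_nth _ 0%N) => // ; apply/eqP; rewrite eqn_leq.
by apply/andP; split; apply: le.
Qed.

Lemma word_inj la mu : is_part la -> is_part mu -> word la =1 word mu -> la = mu.
Proof.
move=> pla pmu h; have [] // := word_shift_inj (d := 0) pla pmu.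
by move=> k; rewrite addr0.
Qed.

Lemma size_window m : size (window m) = m.*2.
Proof. by rewrite size_map size_iota. Qed.

Lemma nth_window x0 m p : (p < m.*2)%N -> nth x0 (window m) p = p%:Z - m%:Z.
Proof. by move=> hp; rewrite (nth_map 0%N) ?size_iota // nth_iota. Qed.

Lemma count_window_lt m c : - m%:Z <= c <= m%:Z ->
  (count (fun k => (k < c)%R) (window m))%:Z = c + m%:Z.
Proof.
move=> hc; rewrite count_map.
have -> : count (preim (fun k => k%:Z - m%:Z) (fun k : int => k < c)) (iota 0 m.*2)
   = size (iota 0 (absz (c + m%:Z)%R)).
  apply: count_uniq_eq; rewrite ?iota_uniq // => x.
  by rewrite !mem_iota /=; lia.
by rewrite size_iota; lia.
Qed.

Lemma chargeE t i la :
  charge t i la = (count (fun k => ~~ subword t i la k) (window (sumn la)))%:Z - (sumn la)%:Z.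
Proof.
have := @count_window_lt (sumn la) 0 ltac:(lia); rewrite add0r /charge.
set w := window _; move=> e.
have := count_predC (fun k : int => k < 0) (filter (fun k => ~~ subword t i la k) w).
have := count_predC (subword t i la) (filter (fun k : int => k < 0) w).
rewrite !count_filter !size_filter /=.
have -> : count (predI (subword t i la) (fun k => (k < 0)%R)) w =
  count (fun k => (k < 0)%R && subword t i la k) w by apply: eq_count => k /=; rewrite andbC.
have -> : count (predI (predC (fun k : int => k < 0)) (fun k => ~~ subword t i la k)) w =
  count (fun k => (0 <= k)%R && ~~ subword t i la k) w.
  by apply: eq_count => k /=; rewrite -leNgt.
have -> : count (predI (predC (subword t i la)) (fun k : int => (k < 0)%R)) w =
  count (predI (fun k : int => (k < 0)%R) (fun k => ~~ subword t i la k)) w.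
  by apply: eq_count => k /=; rewrite andbC.
move: e.
set A := count (fun k => (k < 0)%R && subword t i la k) w.
set B := count (fun k => (0 <= k)%R && ~~ subword t i la k) w.
set C := count (fun k => ~~ subword t i la k) w.
set D := count (<%R^~ 0) w; set E := count (predI _ _) w.
move: A B C D E; lia.
Qed.

Lemma charge_bounds t i la : - (sumn la)%:Z <= charge t i la <= (sumn la)%:Z.
Proof.
rewrite chargeE.
have := count_size (fun k => ~~ subword t i la k) (window (sumn la)).
rewrite size_window; lia.
Qed.

Lemma is_part_tquotient t i la : is_part (tquotient t i la).
Proof. exact: is_part_of_word. Qed.

Lemma word_tquotient t i la k : is_part la -> (i < t)%N ->
  word (tquotient t i la) k = subword t i la (k + charge t i la).
Proof.
move=> pla it; rewrite word_part_of_word count_map chargeE.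
have [lo hi] := subword_outside (k + charge t i la) pla it.
rewrite chargeE in lo hi.
set c := count (fun k => ~~ subword t i la k) _ in lo hi *.
rewrite addrA; set m := sumn la in lo hi *.
case: (leP 0 (k + c%:Z)) => h /=; last by rewrite -addrA lo //; lia.
case: (ltnP (absz (k + c%:Z)%R) m.*2) => h2.
  rewrite (nth_map 0) ?size_window // nth_window //.
  by congr (subword _ _ _ _); lia.
rewrite nth_default ?size_map ?size_iota //.
by rewrite -addrA hi //; lia.
Qed.

(** By [word_shift_inj], a runner determines both its charge and its quotient: they are computed
    below by exhibiting a partition with the same word up to a shift. *)
Lemma tquotient_unique t i la mu c : is_part la -> is_part mu -> (i < t)%N ->
  (forall k, subword t i la k = word mu (k - c)) ->
  charge t i la = c /\ tquotient t i la = mu.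
Proof.
move=> pla pmu it h.
have [] := @word_shift_inj (tquotient t i la) mu (charge t i la - c).
- exact: is_part_tquotient.
- by [].
- by move=> k; rewrite (word_tquotient _ pla it) h -addrA.
by move=> /eqP; rewrite subr_eq0 => /eqP.
Qed.

(** * Doubled distinct partitions *)

Lemma mem_strict s x : is_strict s ->
  (x \in s) = (0 < x)%N && (x \in [seq part s i | i <- iota 1 (size s)]).
Proof.
move=> /andP[_ n0]; have -> : [seq part s i | i <- iota 1 (size s)] = s.
  apply: (@eq_from_nth _ 0%N); rewrite size_map size_iota // => i hi.
  by rewrite (nth_map 0%N) ?size_iota // nth_iota.
by case: (posnP x) => // ->; apply/negbTE.
Qed.

Lemma part_mem s i : (0 < part s i)%N -> part s i \in s.
Proof.
case: (ltnP (size s) i) => [/part_default->//|hi].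
case: i hi => [|i] hi h; last exact: mem_nth.
by move: h; rewrite /part /=; case: (s) => //= x l _; rewrite mem_head.
Qed.

Lemma mem_strictP s x : is_strict s ->
  reflect (exists2 i, (0 < i)%N & (0 < x)%N /\ x = part s i) (x \in s).
Proof.
move=> st; rewrite (mem_strict _ st); apply: (iffP andP) => [[x0 /mapP[i]]|].
  by rewrite mem_iota => hi e; exists i => //; lia.
move=> [i i0 [x0 e]]; split=> //; apply/mapP; exists i => //.
rewrite mem_iota; case: (ltnP (size s) i) => [/part_default h|h]; lia.
Qed.

(** A row [i] with [part s i] positive exceeds its own index by [part s i], which gives the 0's at
    positive places. The symmetry of the diagram up to its extra column makes the letters at x and -
    x complementary and leaves a 1 at place 0. *)
Lemma word_doubled s k : is_strict s ->
  ~~ word (doubled s) k =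
  if 0 < k then absz k \in s else if k < 0 then absz k \notin s else false.
Proof.
move=> st; have D i := @part_doubled s i st.
have inD i j : (0 < j <= part (doubled s) i)%N && (0 < i)%N =
  (0 < i)%N && (i < j <= i + part s i)%N || (0 < j)%N && (j <= i < j + part s j)%N.
  by rewrite -mem_doubled_boxes D andbC.
have up i : (0 < i)%N -> (part (doubled s) i - i)%N = part s i.
  move=> i0; case: (posnP (part s i)) => p0.
    by have := inD i (part (doubled s) i); rewrite p0; lia.
  have := inD i (i + part s i)%N; have := inD i (i + part s i).+1.
  by have := @strict_part s i (i + part s i).+1 st; lia.
apply/(beadP _ (is_part_doubled st))/idP.
  move=> [j j0 ek]; case: ifP => k0.
    apply/(mem_strictP _ st); exists j => //; split; first by lia.
    by rewrite -up //; lia.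
  have := inD j (part (doubled s) j); have := inD j (part (doubled s) j).+1.
  case: ifP => kn; last by (have -> : part (doubled s) j = j by lia); lia.
  set a := absz k; case: (posnP a) => [|a0]; first by rewrite /a; lia.
  move=> h1 h2; apply/negP => /(mem_strictP _ st)[i i0 [_ e]].
  have ej : j = (part (doubled s) j + a)%N by rewrite /a; lia.
  set c := part (doubled s) j in h1 h2 ej.
  case: (ltnP c i) => ci.
    by have := @strict_part s c.+1 i st; lia.
  by have := @strict_part s i c st; lia.
case: ifP => k0.
  move=> /(mem_strictP _ st)[i i0 [_ e]]; exists i => //.
  by have := up i i0; lia.
case: ifP => // kn; set a := absz k => an.
have a0 : (0 < a)%N by rewrite /a; lia.
(* The least such [c] is the number of parts of [s] exceeding [a], and row [c + a] of the doubled
   diagram has length [c]. *)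
have ex : exists c, (part s c.+1 < a)%N.
  by exists (size s); rewrite part_default.
pose c := ex_minn ex; have [hc hmin] : (part s c.+1 < a)%N /\
    forall c', (part s c'.+1 < a)%N -> (c <= c')%N by rewrite /c; case: ex_minnP.
exists (c + a)%N; first by lia.
suff e : part (doubled s) (c + a) = c by rewrite e /a; lia.
have h1 := inD (c + a)%N c; have h2 := inD (c + a)%N c.+1.
have hc1 : (0 < c)%N -> (a < part s c)%N.
  move=> c0; rewrite ltn_neqAle; apply/andP; split.
    by apply: contraNneq an => ->; apply: part_mem; have := hmin c.-1; rewrite prednK //; lia.
  by rewrite leqNgt; apply/negP => h; have := hmin c.-1; rewrite prednK //; lia.
by lia.
Qed.

Lemma dd_strict la : is_dd la -> is_strict (strict_of la).
Proof. by move=> /andP[]. Qed.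

Lemma dd_doubled la : is_dd la -> doubled (strict_of la) = la.
Proof. by move=> /andP[_ /eqP]. Qed.

Lemma dd_part la : is_dd la -> is_part la.
Proof. by move=> dd; rewrite -(dd_doubled dd); apply/is_part_doubled/dd_strict. Qed.

Lemma is_dd_doubled s : is_strict s -> is_dd (doubled s).
Proof. by move=> st; apply/is_ddP; exists s. Qed.

Lemma word_dd la k : is_dd la ->
  ~~ word la k =
  if 0 < k then absz k \in strict_of la
  else if k < 0 then absz k \notin strict_of la else false.
Proof. by move=> dd; rewrite -[in LHS](dd_doubled dd) word_doubled // dd_strict. Qed.

Definition strict_set (n : nat) (p : pred nat) : seq nat :=
  [seq x <- rev (iota 1 n) | p x].

Lemma mem_strict_set n p x : (x \in strict_set n p) = (0 < x <= n)%N && p x.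
Proof. by rewrite mem_filter mem_rev mem_iota andbC add1n ltnS. Qed.

Lemma is_strict_strict_set n p : is_strict (strict_set n p).
Proof.
apply/andP; split; last by rewrite mem_strict_set.
rewrite sorted_filter //; first by move=> x y z yx zy; apply: ltn_trans zy yx.
by rewrite rev_sorted; apply: iota_ltn_sorted.
Qed.

Lemma strict_uniq s : is_strict s -> uniq s.
Proof.
move=> /andP[st _]; apply: sorted_uniq st; last by move=> x; rewrite /= ltnn.
by move=> x y z yx zy; apply: ltn_trans zy yx.
Qed.

Lemma strict_gt0 s x : is_strict s -> x \in s -> (0 < x)%N.
Proof. by move=> /andP[_ n0] xs; rewrite lt0n; apply: contraNneq n0 => <-. Qed.

(** Runner 0 is stable under k -> - k and inherits the symmetry of the whole word, so it is, without
    shift, the word of a doubled distinct partition. *)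
Lemma dd_quotient0 t la : is_dd la -> (0 < t)%N ->
  [/\ charge t 0 la = 0, is_strict (strict_quotient t la),
      tquotient t 0 la = doubled (strict_quotient t la) &
      forall y, (y \in strict_quotient t la) = (0 < y)%N && (t * y \in strict_of la)%N].
Proof.
move=> dd t0; pose Y := strict_set (sumn la) (fun y => (t * y \in strict_of la)%N).
have stY : is_strict Y by apply: is_strict_strict_set.
have memY y : (y \in Y) = (0 < y)%N && (t * y \in strict_of la)%N.
  rewrite mem_strict_set; case: (leqP y (sumn la)) => h; rewrite ?andbT // andbF /=.
  case: (posnP y) => // y0; apply/esym/negbTE/negP => /= hy.
  have [_ /(_ _)] := word_outside (t * y)%:Z (dd_part dd).
  have /negbTE -> : ~~ word la (t * y)%:Z.
    by rewrite word_dd // absz_nat hy ltz_nat muln_gt0 t0 y0.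
  by move=> hh; have := hh ltac:(nia).
have [] := @tquotient_unique t 0 la (doubled Y) 0 (dd_part dd) (is_part_doubled stY) t0.
  move=> k; rewrite subr0 /subword addr0; apply: negb_inj.
  rewrite word_dd // word_doubled // pmulr_rgt0 ?ltz_nat // pmulr_rlt0 ?ltz_nat //.
  rewrite abszM absz_nat memY.
  by case: ltgtP => //= k0; rewrite (_ : 0 < absz k)%N //; lia.
move=> -> e; rewrite /strict_quotient e doubledK //.
Qed.

(** * Power sums over the runners *)

Lemma bead_inj la : is_part la ->
  injective (fun j : nat => (nth 0%N la j)%:Z - j.+1%:Z).
Proof.
move=> pla x y /= e; have := @part_mono la x.+1 y.+1 pla isT.
by have := @part_mono la y.+1 x.+1 pla isT; rewrite /part /=; lia.
Qed.

(* Splits the beads of the runner i of a doubled distinct partition, cut at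
   depth n, into the vacuum and the contribution of the parts x of the strict
   partition: a bead at x and a hole at -x. *)
Lemma runner_perm t i la n : is_dd la -> (i < t)%N ->
  (size (tquotient t i la) <= n)%N -> charge t i la <= n%:Z ->
  perm_eq
   ([seq t%:Z * ((nth 0%N (tquotient t i la) j)%:Z - j.+1%:Z + charge t i la) + i%:Z
       | j <- iota 0 n]
    ++ [seq - x%:Z | x <- strict_of la & (t %| x + i)%N])
   ([seq x%:Z | x <- strict_of la & (x %% t == i)%N]
    ++ [seq i%:Z - t%:Z * m.+1%:Z | m <- iota 0 (absz (n%:Z - charge t i la)%R)]).
Proof.
move=> dd it hn cn; have pla := dd_part dd; have st := dd_strict dd.
set mu := tquotient t i la in hn *; set c := charge t i la in cn *.
have pmu : is_part mu by apply: is_part_tquotient.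
have t0 : (0 < t)%N by apply: leq_ltn_trans it.
have wq (q : int) : word mu (q - c) = word la (t%:Z * q + i%:Z).
  by rewrite word_tquotient // subrK.
have uX := strict_uniq st.
have X0 x : x \in strict_of la -> (0 < x)%N by apply: strict_gt0.
have bead_mem (q : int) : c - n%:Z <= q -> ~~ word la (t%:Z * q + i%:Z) ->
    t%:Z * q + i%:Z \in
      [seq t%:Z * ((nth 0%N mu j)%:Z - j.+1%:Z + c) + i%:Z | j <- iota 0 n].
  move=> hq; rewrite -wq => /(beadP _ pmu)[[|j] // _ e].
  have jn : (j < n)%N.
    rewrite ltnNge; apply/negP => nj; move: e; rewrite part_default; first by lia.
    by apply: leq_ltn_trans hn _; rewrite ltnS.
  apply/mapP; exists j; first by rewrite mem_iota.
  by rewrite -[q](subrK c) e.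
apply: uniq_perm.
- rewrite cat_uniq; apply/and3P; split.
  + rewrite map_inj_uniq ?iota_uniq // => x y.
    by move=> /addIr /(mulfI _) h; apply: (bead_inj pmu); apply: (addIr c); apply: h; lia.
  + apply/hasPn => _ /mapP[x + ->]; rewrite mem_filter => /andP[_ hx].
    apply/negP => /mapP[j _ e].
    have : ~~ word la (- x%:Z).
      by rewrite e -wq addrK; apply/(beadP _ pmu); exists j.+1.
    by rewrite word_dd // abszN absz_nat hx; have := X0 x hx; do 2?case: ifP; lia.
  + by rewrite map_inj_uniq ?(filter_uniq _ uX) // => x y /= ?; lia.
- rewrite cat_uniq; apply/and3P; split.
  + by rewrite map_inj_uniq ?(filter_uniq _ uX) // => x y /= ?; lia.
  + apply/hasPn => _ /mapP[m _ ->]; apply/negP => /mapP[x].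
    by rewrite mem_filter => /andP[_ /X0]; nia.
  + by rewrite map_inj_uniq ?iota_uniq // => x y; nia.
move=> u; rewrite !mem_cat; apply/orP/orP => -[].
- move=> /mapP[j]; rewrite mem_iota => hj ->.
  set q := _ + c; have : ~~ word la (t%:Z * q + i%:Z).
    by rewrite -wq /q addrK; apply/(beadP _ pmu); exists j.+1.
  rewrite word_dd //; case: ifP => [u0 h|_].
    left; apply/mapP; exists (absz (t%:Z * q + i%:Z)); last by lia.
    rewrite mem_filter h andbT (_ : absz _ = absz q * t + i)%N; last by nia.
    by rewrite modnMDl modn_small.
  case: ifP => // un _; right; have q0 : q < 0 by clearbody q; nia.
  have e : ((absz (- q) - 1).+1)%:Z = - q by clearbody q; lia.
  apply/mapP; exists (absz (- q) - 1)%N; last by rewrite e mulrN opprK addrC.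
  by rewrite mem_iota /=; move: e q0; rewrite /q; lia.
- move=> /mapP[x]; rewrite mem_filter => /andP[/dvdnP[m e] hx] ->; right.
  have m0 : (0 < m)%N by have := X0 x hx; nia.
  have xE : - x%:Z = t%:Z * - m%:Z + i%:Z by nia.
  have nb : word la (- x%:Z).
    apply/negbNE; rewrite word_dd // abszN absz_nat hx; have := X0 x hx.
    by do 2?case: ifP; lia.
  apply/mapP; exists m.-1; last by rewrite prednK //; nia.
  rewrite mem_iota; suff : c - n%:Z <= - m%:Z by lia.
  rewrite leNgt; apply/negP => h; move: nb; rewrite xE -wq.
  apply/negP/(beadP _ pmu); exists (absz (m%:Z + c)).
    by lia.
  rewrite part_default; first by lia.
  by apply: leq_ltn_trans hn _; lia.
- move=> /mapP[x]; rewrite mem_filter => /andP[/eqP e hx] ->; left.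
  have xE : x%:Z = t%:Z * (x %/ t)%:Z + i%:Z.
    by rewrite {1}(divn_eq x t) e; lia.
  have hq : c - n%:Z <= (x %/ t)%:Z by apply: (@le_trans _ _ 0); rewrite ?subr_le0.
  rewrite xE; apply: bead_mem hq _.
  by rewrite -xE word_dd // absz_nat hx; have := X0 x hx; case: ifP; lia.
- move=> /mapP[m]; rewrite mem_iota => hm ->.
  have uE : i%:Z - t%:Z * m.+1%:Z = t%:Z * - m.+1%:Z + i%:Z by lia.
  case: (boolP (word la (i%:Z - t%:Z * m.+1%:Z))) => h.
    right; apply/mapP; exists (t * m.+1 - i)%N; last by nia.
    rewrite mem_filter subnK ?dvdn_mulr //; last by nia.
    move/negPn: h; rewrite word_dd //.
    have un : i%:Z - t%:Z * m.+1%:Z < 0 by nia.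
    have -> : (0 < i%:Z - t%:Z * m.+1%:Z) = false by rewrite ltNge ltW.
    by rewrite un negbK (_ : absz _ = (t * m.+1 - i)%N) //; nia.
  have hq : c - n%:Z <= - m.+1%:Z by lia.
  by left; rewrite uE; apply: bead_mem hq _; rewrite -uE.
Qed.

(** The sum of [g] over the beads of runner [r], minus its sum over the vacuum, where the negative
    places are filled: a part x is a bead at x and a hole at - x. *)
Definition psumf (t r : nat) (g : int -> rat) (la : seq nat) : rat :=
  \sum_(x <- strict_of la | (x %% t == r)%N) g x%:Z
  - \sum_(x <- strict_of la | (t %| x + r)%N) g (- x%:Z).

Lemma psumf_runner t i g la n : is_dd la -> (i < t)%N ->
  (size (tquotient t i la) <= n)%N -> charge t i la <= n%:Z ->
  psumf t i g la =
  \sum_(j < n) g (t%:Z * ((nth 0%N (tquotient t i la) j)%:Z - j.+1%:Z + charge t i la) + i%:Z)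
  - \sum_(m < absz (n%:Z - charge t i la)%R) g (i%:Z - t%:Z * m.+1%:Z).
Proof.
move=> dd it hn cn; apply/eqP; rewrite /psumf subr_eq addrAC eq_sym subr_eq.
have := perm_big _ (runner_perm dd it hn cn) : \sum_(x <- _) g x = \sum_(x <- _) g x.
by rewrite !big_cat !big_map !big_filter !big_iota_ord /= => ->.
Qed.

Lemma count_residue (t x : nat) : (0 < t)%N ->
  (\sum_(i < t) (x %% t == i)%N = 1)%N /\ (\sum_(i < t) (t %| x + i)%N = 1)%N.
Proof.
move=> t0; split.
  rewrite (bigD1 (Ordinal (ltn_pmod x t0))) //= eqxx big1 // => i.
  by rewrite -(inj_eq val_inj) /= eq_sym => /negbTE ->.
pose k := ((t - x %% t) %% t)%N.
have kt : (k < t)%N by apply: ltn_pmod.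
have dk : (t %| x + k)%N.
  rewrite /dvdn modnDmr -modnDml addnC subnK ?modnn //.
  by rewrite ltnW // ltn_pmod.
rewrite (bigD1 (Ordinal kt)) //= dk big1 // => i; rewrite -(inj_eq val_inj) /= => ik.
apply/eqP; rewrite eqb0; apply: contra ik => di.
have : x + i = x + k %[mod t] by rewrite (eqP di) (eqP dk).
by move/eqP; rewrite eqn_modDl !modn_small // => /eqP ->.
Qed.

Lemma sum_psumf t g la : (0 < t)%N ->
  \sum_(i < t) psumf t i g la = \sum_(x <- strict_of la) (g x%:Z - g (- x%:Z)).
Proof.
move=> t0; rewrite sumrB [in RHS]sumrB.
have E (p : nat -> nat -> bool) (h : nat -> rat) :
    (forall x, \sum_(i < t) p i x = 1)%N ->
    \sum_(i < t) \sum_(x <- strict_of la | p i x) h x = \sum_(x <- strict_of la) h x.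
  move=> hp; under eq_bigr do rewrite big_mkcond.
  rewrite exchange_big; apply: eq_bigr => x _ /=.
  rewrite -[RHS]mul1r -[1]/(1%:R) -(hp x) natr_sum mulr_suml.
  by apply: eq_bigr => i _; case: ifP => _; rewrite ?mul1r ?mul0r.
congr (_ - _).
  by apply: (E (fun i x => x %% t == i)%N) => x; have [] := count_residue x t0.
by apply: (E (fun i x => t %| x + i)%N (fun x => g (- x%:Z))) => x; have [] := count_residue x t0.
Qed.

Lemma psumfN t i g la : (0 < i < t)%N ->
  psumf t (t - i) g la = - psumf t i (g \o -%R) la.
Proof.
move=> /andP[i0 it]; rewrite /psumf opprB; congr (_ - _).
  apply: eq_big => x; last by rewrite /= opprK.
  apply/eqP/idP => h; first by rewrite /dvdn -modnDml h subnK ?modnn // ltnW.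
  have : x + i = (t - i) + i %[mod t] by rewrite (eqP h) subnK ?modnn // ltnW.
  by move/eqP; rewrite eqn_modDr => /eqP ->; rewrite modn_small //; lia.
apply: eq_big => // x; apply/idP/eqP => h; last first.
  by rewrite /dvdn -modnDml h subnKC ?modnn // ltnW.
have : x + (t - i) = i + (t - i) %[mod t] by rewrite (eqP h) subnKC ?modnn // ltnW.
by move/eqP; rewrite eqn_modDr => /eqP ->; rewrite modn_small.
Qed.

(** With g = 1, [psumf] counts the beads of the runner against the vacuum. The charges are thus the
    power sums of exponent 0. *)
Lemma charge_psumf t i la : is_dd la -> (i < t)%N ->
  (charge t i la)%:~R = psumf t i (fun=> 1) la.
Proof.
move=> dd it; set mu := tquotient t i la; set c := charge t i la.
rewrite (@psumf_runner t i _ la (size mu + absz c)%N) ?leq_addr // -/c; last by lia.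
rewrite !sumr_const !card_ord; set N := (size mu + absz c)%N.
have -> : c = N%:Z - (absz (N%:Z - c)%R)%:Z by lia.
rewrite rmorphB /=; congr (_ - _); rewrite -!pmulrn; congr (_ *+ _); lia.
Qed.

Lemma charge_opp t i la : is_dd la -> (0 < i < t)%N ->
  charge t (t - i) la = - charge t i la.
Proof.
move=> dd hi; apply: (@intr_inj rat).
by rewrite rmorphN /= !charge_psumf //; [rewrite psumfN|lia|lia].
Qed.

(** Each part adds one bead and one hole. This makes the rearranged word balanced, so that
    [word_tcore] involves no shift of the index. *)
Lemma sum_charge t la : is_dd la -> (0 < t)%N -> \sum_(i < t) charge t i la = 0.
Proof.
move=> dd t0; apply: (@intr_inj rat); rewrite rmorph_sum /=.
under eq_bigr do rewrite charge_psumf //.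
by rewrite sum_psumf // big1 // => x _; rewrite subrr.
Qed.

Lemma nth_allpairs_iota (T U : Type) (f : T -> nat -> U) s n x0 y0 a b :
  (a < size s)%N -> (b < n)%N ->
  nth x0 [seq f k i | k <- s, i <- iota 0 n] (a * n + b) = f (nth y0 s a) b.
Proof.
move=> ha hb; elim: s a ha => //= k s IH [|a] ha; rewrite nth_cat size_map size_iota.
  by rewrite mul0n add0n hb (nth_map 0%N) ?size_iota // nth_iota.
by rewrite mulSn -addnA ltnNge leq_addr /= addKn; apply: IH.
Qed.

Lemma word_tcore t la i (q : int) : is_dd la -> (i < t)%N ->
  word (tcore t la) (t%:Z * q + i%:Z) = (charge t i la <= q).
Proof.
move=> dd it; have t0 : (0 < t)%N by apply: leq_ltn_trans it.
rewrite word_part_of_word; set L := (X in count negb X); set m := sumn la.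
have szL : size L = (m.*2 * t)%N by rewrite size_allpairs size_window size_iota.
have -> : count negb L = (t * m)%N.
  suff : ((count negb L)%:Z = t%:Z * m%:Z)%R by lia.
  rewrite -sum1_count /L big_mkcond big_allpairs_dep /= exchange_big /=.
  rewrite big_iota_ord /= -natz natr_sum.
  transitivity (\sum_(j < t) (charge t j la + m%:Z)); last first.
    rewrite big_split /= sum_charge // add0r sumr_const card_ord.
    by rewrite -mulr_natl natz.
  apply: eq_bigr => j _; rewrite natz -count_window_lt ?charge_bounds //.
  rewrite -sum1_count [in RHS]big_mkcond; congr (_%:Z); apply: eq_bigr => k _.
  by rewrite add0n -ltNge.
have idx : t%:Z * q + i%:Z + (t * m)%:Z = t%:Z * (q + m%:Z) + i%:Z by lia.
rewrite idx; have := charge_bounds t i la; rewrite -/m => hc.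
case: (ltP q (- m%:Z)) => qm.
  have -> : (0 <= t%:Z * (q + m%:Z) + i%:Z) = false by nia.
  by rewrite /=; apply/esym/negbTE; rewrite -ltNge; lia.
have -> : (0 <= t%:Z * (q + m%:Z) + i%:Z) = true by nia.
have e : absz (t%:Z * (q + m%:Z) + i%:Z)%R = (absz (q + m%:Z)%R * t + i)%N by nia.
rewrite /= e; case: (ltnP (absz (q + m%:Z)%R) m.*2) => h.
  rewrite (nth_allpairs_iota _ _ 0) ?size_window // nth_window //.
  by congr (_ <= _); lia.
rewrite nth_default; last by rewrite szL; nia.
by apply/esym; lia.
Qed.

Lemma tcore_eqP t la nu : is_dd la -> is_dd nu -> (0 < t)%N ->
  (tcore t la = tcore t nu) <-> (forall i, (i < t)%N -> charge t i la = charge t i nu).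
Proof.
move=> dl dn t0; split=> [e i it|e].
  have h q : (charge t i la <= q) = (charge t i nu <= q).
    by rewrite -!word_tcore // e.
  by apply/le_anti; rewrite -h lexx h lexx.
apply: word_inj => [||k]; try exact: is_part_of_word.
have tz : t%:Z != 0 by lia.
have it : (absz (k %% t%:Z)%Z < t)%N.
  by have := ltz_mod k tz; have := modz_ge0 k tz; lia.
have -> : k = t%:Z * (k %/ t%:Z)%Z + (absz (k %% t%:Z)%Z)%:Z.
  rewrite {1}(divz_eq k t%:Z) mulrC; congr (_ + _).
  by have := modz_ge0 k tz; lia.
by rewrite !word_tcore // e.
Qed.

(** * Bijectivity of the Littlewood decomposition *)

Lemma word_ddN la k : is_dd la -> k != 0 -> word la (- k) = ~~ word la k.
Proof.
move=> dd k0; rewrite word_dd //; apply: negb_inj; rewrite word_dd // abszN.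
by case: (ltgtP k 0) k0 => // hk _; do ?case: ifP => //=; rewrite ?negbK //; lia.
Qed.

(** As [t] is odd, k -> - k exchanges the runners above [t./2] with those from 1 to [t./2], so by
    symmetry a word is controlled by the runners 0 to [t./2]. *)
Lemma runner_ind t (P : int -> Prop) : odd t ->
  (forall q : int, P (t%:Z * q)) ->
  (forall i (q : int), (0 < i <= t./2)%N -> P (t%:Z * q + i%:Z)) ->
  (forall i (q : int), (0 < i <= t./2)%N -> P (- (t%:Z * q + i%:Z))) ->
  forall k, P k.
Proof.
move=> ot P0 P1 P2 k; have t0 : (0 < t)%N by apply: odd_gt0.
have tz : t%:Z != 0 by lia.
have it : (absz (k %% t%:Z)%Z < t)%N.
  by have := ltz_mod k tz; have := modz_ge0 k tz; lia.
have kE : k = t%:Z * (k %/ t%:Z)%Z + (absz (k %% t%:Z)%Z)%:Z.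
  rewrite {1}(divz_eq k t%:Z) mulrC; congr (_ + _).
  by have := modz_ge0 k tz; lia.
move: (k %/ t%:Z)%Z (absz (k %% t%:Z)%Z) it kE => q i it kE.
case: (posnP i) => [i0|i0]; first by rewrite kE i0 addr0.
case: (leqP i t./2) => h; first by rewrite kE; apply: P1; rewrite i0.
have -> : k = - (t%:Z * (- q - 1) + (t - i)%N%:Z) by rewrite kE; lia.
by apply: P2; have := odd_double_half t; rewrite ot -addnn; lia.
Qed.

Lemma dd_quotient_inj t la nu : odd t -> is_dd la -> is_dd nu ->
  tcore t la = tcore t nu -> strict_quotient t la = strict_quotient t nu ->
  (forall i, (0 < i <= t./2)%N -> tquotient t i la = tquotient t i nu) ->
  la = nu.
Proof.
move=> ot dl dn; have t0 : (0 < t)%N by apply: odd_gt0.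
move=> /(tcore_eqP dl dn t0) ec es eq.
have lt i : (0 < i <= t./2)%N -> (i < t)%N.
  by have := odd_double_half t; rewrite ot -addnn; lia.
have E i q : (0 < i <= t./2)%N -> word la (t%:Z * q + i%:Z) = word nu (t%:Z * q + i%:Z).
  move=> hi; have := word_tquotient (q - charge t i la) (dd_part dl) (lt i hi).
  by rewrite subrK eq // word_tquotient ?lt ?dd_part // -ec ?lt // subrK => h; apply: esym h.
apply: word_inj (dd_part dl) (dd_part dn) _; apply: (runner_ind ot) => [q|i q hi|i q hi].
- have := word_tquotient q (dd_part dl) t0; have := word_tquotient q (dd_part dn) t0.
  have [cl _ -> _] := dd_quotient0 dl t0; have [cn _ -> _] := dd_quotient0 dn t0.
  by rewrite cl cn es !addr0 /subword !addr0 => -> ->.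
- exact: E.
- have [e0|n0] := eqVneq (t%:Z * q + i%:Z) 0.
    by rewrite e0 oppr0; apply: negb_inj; rewrite !word_dd.
  by rewrite !word_ddN // E.
Qed.

(** Whether there is to be a bead at t q + r. For r above [t./2] the answer is the opposite of that
    at the mirror place - (t q + r) = t (- q - 1) + (t - r). *)
Definition runner_bead t (c : nat -> int) (Y : seq nat) (Lam : nat -> seq nat)
    (r : nat) (q : int) : bool :=
  if r == 0%N then ~~ word (doubled Y) q
  else if (r <= t./2)%N then ~~ word (Lam r) (q - c r)
  else word (Lam (t - r)%N) (- q - 1 - c (t - r)%N).

(** A doubled distinct partition is given by its beads at positive places. The bound on the parts is
    only meant to be large enough: beyond it no runner has a bead. *)
Definition assemble (t : nat) (c : nat -> int) (Y : seq nat) (Lam : nat -> seq nat) :=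
  doubled (strict_set
    (t * (sumn (doubled Y) + \sum_(i < t) (sumn (Lam i) + absz (c i)%R)))
    (fun x => runner_bead t c Y Lam (x %% t) (x %/ t)%N)).

Lemma word_assemble t c Y Lam r q : odd t -> is_strict Y ->
  (forall i, (0 < i <= t./2)%N -> is_part (Lam i)) -> (r < t)%N ->
  word (assemble t c Y Lam) (t%:Z * q + r%:Z) = ~~ runner_bead t c Y Lam r q.
Proof.
move=> ot stY pL rt; set B := runner_bead t c Y Lam.
have t0 : (0 < t)%N by apply: odd_gt0.
have th : t = (t./2 + t./2).+1 by rewrite -[LHS]odd_double_half ot -addnn.
rewrite /assemble; set M := (_ + _)%N; apply: negb_inj.
rewrite negbK word_doubled ?is_strict_strict_set // !mem_strict_set -/B.
have Mr i : (i < t)%N -> (sumn (Lam i) + absz (c i)%R <= M)%N.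
  move=> it; rewrite /M (bigD1 (Ordinal it)) //=; lia.
have out r' q' : (r' < t)%N -> M%:Z <= q' -> B r' q' = false.
  move=> rt' hq; rewrite /B /runner_bead; case: ifP => r0.
    have [_ ->] := word_outside q' (is_part_doubled stY) => //.
    by apply: le_trans hq; rewrite /M; lia.
  case: ifP => h.
    have [_ ->] // := word_outside (q' - c r') (pL r' ltac:(lia)).
    by have := Mr r' rt'; lia.
  have [-> //] := word_outside (- q' - 1 - c (t - r')%N) (pL (t - r')%N ltac:(lia)).
  by have := Mr (t - r')%N ltac:(lia); lia.
have inX r' (q' : nat) : (r' < t)%N -> (0 < q' * t + r')%N ->
    (0 < q' * t + r' <= t * M)%N && B ((q' * t + r') %% t)%N ((q' * t + r') %/ t)%N
    = B r' q'%:Z.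
  move=> rt' ->; rewrite modnMDl divnMDl // divn_small // addn0 modn_small //=.
  case: leqP => //= h; rewrite out //; nia.
case: ltgtP => k0.
- have q0 : 0 <= q by nia.
  have -> : absz (t%:Z * q + r%:Z)%R = (absz q * t + r)%N by nia.
  by rewrite inX //; [congr (B _ _); lia|nia].
- case: (posnP r) => [r0|r0].
    have q0 : q < 0 by nia.
    have -> : absz (t%:Z * q + r%:Z)%R = (absz q * t + 0)%N by nia.
    rewrite inX //; last by nia.
    rewrite r0 /B /runner_bead /= negbK (_ : (absz q)%:Z = - q); last by lia.
    by rewrite (word_ddN (is_dd_doubled stY)) //; lia.
  have q0 : q < 0 by nia.
  have e : (absz (- q - 1)%R)%:Z = - q - 1 by lia.
  have -> : absz (t%:Z * q + r%:Z)%R = (absz (- q - 1)%R * t + (t - r))%N by nia.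
  rewrite inX //; [|lia|nia].
  rewrite e /B /runner_bead (_ : (t - r == 0)%N = false); last by lia.
  rewrite (_ : (r == 0)%N = false); last by lia.
  case: (leqP r t./2) => h.
    rewrite (_ : (t - r <= t./2)%N = false); last by lia.
    rewrite (subKn (ltnW rt)) (_ : - (- q - 1) - 1 - c r = q - c r); last by ring.
    by [].
  rewrite (_ : (t - r <= t./2)%N = true); last by lia.
  by rewrite negbK.
have q0 : q = 0 by apply/le_anti/andP; split; rewrite leNgt; apply/negP => h; nia.
have r0 : r = 0%N by move: k0; rewrite q0; lia.
rewrite q0 r0.
rewrite /B /runner_bead /=; apply/esym.
by rewrite word_doubled.
Qed.

Lemma assembleP t la Y Lam (nu := assemble t (fun i => charge t i la) Y Lam) :
  odd t -> is_dd la -> is_strict Y ->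
  (forall i, (0 < i <= t./2)%N -> is_part (Lam i)) ->
  [/\ is_dd nu, tcore t nu = tcore t la, strict_quotient t nu = Y &
      forall i, (0 < i <= t./2)%N -> tquotient t i nu = Lam i].
Proof.
move=> ot dl stY pL; have t0 : (0 < t)%N by apply: odd_gt0.
have th : t = (t./2 + t./2).+1 by rewrite -[LHS]odd_double_half ot -addnn.
have dn : is_dd nu by apply/is_dd_doubled/is_strict_strict_set.
have W r q := @word_assemble t (fun i => charge t i la) Y Lam r q ot stY pL.
have [c0 e0] : charge t 0 nu = 0 /\ tquotient t 0 nu = doubled Y.
  apply: tquotient_unique => //; [exact: dd_part|exact: is_part_doubled|].
  by move=> k; rewrite /subword W // /runner_bead /= negbK subr0.
have Q i : (0 < i <= t./2)%N -> charge t i nu = charge t i la /\ tquotient t i nu = Lam i.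
  move=> hi; apply: tquotient_unique; [exact: dd_part|exact: pL|lia|].
  move=> k; rewrite /subword W; last by lia.
  rewrite /runner_bead (_ : (i == 0)%N = false); last by lia.
  by case/andP: hi => _ ->; rewrite negbK.
split=> //; last by move=> i /Q[].
  apply/tcore_eqP => // i it.
  case: (posnP i) => [->|i0]; first by rewrite c0; have [] := dd_quotient0 dl t0.
  case: (leqP i t./2) => h; first by have [|-> _] := Q i; rewrite ?i0.
  rewrite -(subKn (ltnW it)) [LHS]charge_opp // ?[RHS]charge_opp //; try lia.
  by have [|-> _] := Q (t - i)%N; first by lia.
by rewrite /strict_quotient e0 doubledK.
Qed.

(** * Sums over boxes *)

Lemma map_part s : [seq part s i | i <- iota 1 (size s)] = s.
Proof.
apply: (@eq_from_nth _ 0%N); rewrite size_map size_iota // => i hi.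
by rewrite (nth_map 0%N) ?size_iota // nth_iota.
Qed.

Lemma boxes_dd la : is_dd la -> perm_eq (boxes la) (doubled_boxes (strict_of la)).
Proof.
move=> dd; apply: uniq_perm; [exact: boxes_uniq|exact: doubled_boxes_uniq|].
by rewrite -[in boxes _](dd_doubled dd); apply/mem_boxes_doubled/dd_strict.
Qed.

(** A part x gives a shifted row with contents 1, ..., x and an added column with contents 0, ..., -
    (x - 1). *)
Lemma sum_content (phi : int -> rat) la : is_dd la ->
  \sum_(b <- boxes la) phi (content b) =
  \sum_(x <- strict_of la) \sum_(k < x) (phi k.+1%:Z + phi (- k%:Z)).
Proof.
move=> dd; rewrite (perm_big _ (boxes_dd dd)) /doubled_boxes big_cat /=.
set X := strict_of la; rewrite /shifted_boxes !big_allpairs_dep -big_split /=.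
rewrite -[in RHS](map_part X) big_map; apply: eq_bigr => i _.
rewrite !big_iota_ord -big_split; apply: eq_bigr => k _ /=.
by rewrite /content /=; congr (phi _ + phi _); lia.
Qed.

Lemma size_boxes la : size (boxes la) = sumn la.
Proof.
rewrite size_allpairs_dep; congr sumn; rewrite -[RHS]map_part.
by apply: eq_map => i; rewrite size_iota.
Qed.

Lemma sumn_dd la : is_dd la -> (sumn la)%:R = \sum_(x <- strict_of la) (x%:R + x%:R) :> rat.
Proof.
move=> dd; rewrite -size_boxes -sum1_size natr_sum (sum_content (fun=> 1) dd).
apply: eq_bigr => x _; rewrite big_split /= !sumr_const card_ord //.
Qed.

Lemma sum_fold (R : zmodType) t (f : nat -> R) : odd t ->
  \sum_(r < t) f r = f 0%N + \sum_(1 <= i < t./2.+1) (f i + f (t - i)%N).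
Proof.
move=> ot; have th : t = (t./2 + t./2).+1 by rewrite -[LHS]odd_double_half ot -addnn.
rewrite -(big_mkord xpredT f) big_ltn ?odd_gt0 //; congr (_ + _).
rewrite big_split (big_cat_nat (n := t./2.+1)) /=; [|lia|lia]; congr (_ + _).
rewrite -[X in \sum_(X <= _ < t) _]add0n big_addn (_ : (t - t./2.+1)%N = t./2); last lia.
rewrite big_nat_rev [RHS]big_add1 /=; apply: eq_big_nat => i hi; congr f; lia.
Qed.

Lemma sum_nth n s : (size s <= n)%N -> (\sum_(j < n) nth 0 s j = sumn s)%N.
Proof.
move=> hn; rewrite sumnE (big_nth 0%N) big_mkord.
rewrite (big_ord_widen _ (fun j => nth 0%N s j) hn) [RHS]big_mkcond.
by apply: eq_bigr => j _; case: ltnP => // h; rewrite nth_default.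
Qed.

Lemma psumf_size t i la nu : is_dd la -> is_dd nu -> (i < t)%N ->
  charge t i la = charge t i nu ->
  psumf t i intr nu - psumf t i intr la =
  t%:R * ((sumn (tquotient t i nu))%:R - (sumn (tquotient t i la))%:R).
Proof.
move=> dl dn it ec; set c := charge t i la.
pose n := (size (tquotient t i la) + size (tquotient t i nu) + absz c)%N.
rewrite (@psumf_runner t i _ la n) // -?/c; [|rewrite /n; lia|rewrite /n; lia].
rewrite (@psumf_runner t i _ nu n) // -?ec -?/c; [|rewrite /n; lia|rewrite /n; lia].
have subrACA3 (a b v : rat) : a - v - (b - v) = a - b by ring.
rewrite subrACA3 -sumrB.
rewrite -(@sum_nth n (tquotient t i la)); last by rewrite /n; lia.
rewrite -(@sum_nth n (tquotient t i nu)); last by rewrite /n; lia.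
rewrite !natr_sum -sumrB mulr_sumr; apply: eq_bigr => j _.
by ring.
Qed.

Lemma mem_strict_quotient_perm t la : is_dd la -> (0 < t)%N ->
  perm_eq [seq x <- strict_of la | (t %| x)%N] [seq (t * y)%N | y <- strict_quotient t la].
Proof.
move=> dd t0; have [_ stY _ memY] := dd_quotient0 dd t0.
apply: uniq_perm.
- by rewrite filter_uniq // strict_uniq // dd_strict.
- by rewrite map_inj_uniq ?strict_uniq // => x y /eqP; rewrite eqn_pmul2l // => /eqP.
move=> x; rewrite mem_filter; apply/andP/mapP => [[/dvdnP[y e] hx]|[y + ->]].
  exists y; last by rewrite mulnC.
  rewrite memY mulnC -e hx andbT; have := strict_gt0 (dd_strict dd) hx.
  by rewrite e muln_gt0 => /andP[].
by rewrite memY => /andP[_ ->]; rewrite dvdn_mulr.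
Qed.

Lemma psumf0 t g la : is_dd la -> (0 < t)%N ->
  psumf t 0 g la = \sum_(y <- strict_quotient t la) (g (t%:Z * y%:Z) - g (- (t%:Z * y%:Z))).
Proof.
move=> dd t0; rewrite /psumf sumrB.
under [X in _ - X]eq_bigl do rewrite addn0.
have E h : \sum_(x <- strict_of la | (t %| x)%N) h x =
    \sum_(y <- strict_quotient t la) h (t * y)%N :> rat.
  by rewrite -big_filter (perm_big _ (mem_strict_quotient_perm dd t0)) big_map.
by congr (_ - _); [rewrite -(E (fun x => g x%:Z))|rewrite -(E (fun x => g (- x%:Z)))].
Qed.

(** For t = 1 the single runner is the whole word, so that [psumf_runner] also applies to the beads
    of [la] itself. *)
Lemma quotient1 la : is_dd la -> charge 1 0 la = 0 /\ tquotient 1 0 la = la.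
Proof.
move=> dd; apply: tquotient_unique => //; try exact: dd_part.
by move=> k; rewrite subr0 /subword mul1r addr0.
Qed.

Definition bead (la : seq nat) (j : nat) : int := (nth 0%N la j)%:Z - j.+1%:Z.

Lemma bead_sum (f : int -> rat) la n : is_dd la -> (size la <= n)%N ->
  \sum_(j < n) f (bead la j) =
  \sum_(x <- strict_of la) (f x%:Z - f (- x%:Z)) + \sum_(m < n) f (- m.+1%:Z).
Proof.
move=> dd hn; have [c0 e0] := quotient1 dd.
have := @psumf_runner 1 0 f la n dd isT; rewrite c0 e0 subr0 absz_nat => /(_ hn isT) E.
have e1 : \sum_(x <- strict_of la) (f x%:Z - f (- x%:Z)) = psumf 1 0 f la.
  rewrite /psumf sumrB; congr (_ - _); apply: eq_bigl => x; first by rewrite modn1.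
  by rewrite dvd1n.
rewrite e1 E.
have -> : \sum_(m < n) f (0%N%:Z - 1%N%:Z * m.+1%:Z) = \sum_(m < n) f (- m.+1%:Z).
  by apply: eq_bigr => m _; congr f; lia.
by rewrite subrK; apply: eq_bigr => j _; congr f; rewrite /bead; lia.
Qed.

Lemma sum_pairs (n : nat) (f : 'I_n -> 'I_n -> rat) : (forall i j, f i j = f j i) ->
  \sum_(i < n) \sum_(j < n) f i j =
  (\sum_(i < n) \sum_(j < n | (i < j)%N) f i j) *+ 2 + \sum_(i < n) f i i.
Proof.
move=> fs; rewrite mulr2n [X in _ = _ + X + _](exchange_big_dep xpredT) //= -!big_split /=.
apply: eq_bigr => i _; rewrite (bigID (fun j : 'I_n => (i < j)%N)) /= -addrA; congr (_ + _).
rewrite (bigD1 i) ?ltnn //= addrC; congr (_ + _).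
apply: eq_big => [j|j _]; last exact: fs.
by rewrite -leqNgt -(inj_eq val_inj) /= andbC ltn_neqAle.
Qed.

Lemma sum_hook_rows (psi : int -> rat) la n : is_part la -> (size la <= n)%N ->
  \sum_(x <- boxes la) psi (hook la x)%:Z =
  \sum_(j < n) \sum_(d < absz (bead la j + n%:Z)%R) psi d.+1%:Z
  - \sum_(j < n) \sum_(j' < n | (j < j')%N) psi (bead la j - bead la j').
Proof.
move=> pla hn; rewrite -sumrB /boxes big_allpairs_dep big_iota_ord.
rewrite (big_ord_widen _ (fun i => \sum_(c <- iota 1 (part la i.+1)) psi (hook la (i.+1, c))%:Z) hn).
rewrite big_mkcond; apply: eq_bigr => i _ /=.
have -> : (if (i < size la)%N then
     \sum_(c <- iota 1 (part la i.+1)) psi (hook la (i.+1, c))%:Z else 0)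
   = \sum_(c <- iota 1 (part la i.+1)) psi (hook la (i.+1, c))%:Z.
  by case: ltnP => // hi; rewrite part_default // big_nil.
have hi : (0 < i.+1 <= n)%N by rewrite ltn_ord.
have := perm_big _ (hook_row pla hn hi) :
  (\sum_(x <- _) psi x%:Z = \sum_(x <- _) psi x%:Z).
rewrite big_cat !big_map /= => /(canRL (addrK _)) ->; congr (_ - _).
  rewrite big_iota_ord (_ : (part la i.+1 + n - i.+1)%N = absz (bead la i + n%:Z)%R) //.
  by rewrite /bead /part /=; have := ltn_ord i; lia.
pose f k := psi (part la i.+1 + k - i.+1 - part la k)%N%:Z.
rewrite -[LHS]/(\sum_(j <- iota i.+2 (n - i.+1)) f j).
have -> : \sum_(j <- iota i.+2 (n - i.+1)) f j = \sum_(j < n | (i < j)%N) f j.+1.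
  rewrite [RHS](eq_bigr (fun j : 'I_n => (fun k => f k.+1) (nat_of_ord j))) //.
  rewrite -(@big_geq_mkord _ _ _ i.+1 n xpredT (fun k => f k.+1)) /index_iota.
  by rewrite -[iota i.+2 _]/(iota (1 + i.+1) _) iotaDl big_map.
apply: eq_bigr => j ij; rewrite /f /bead; congr psi.
by have := @part_mono la i.+1 j.+1 pla isT (ltnW ij); rewrite /part /=; lia.
Qed.

(** For even [psi] the sum over pairs of rows in [sum_hook_rows] is half of a full double sum over
    beads, up to the diagonal. Each bead sum is then split by [bead_sum] into the vacuum and the
    parts, and the mixed terms combine with the one-row terms into the content-like sum. *)
Lemma sum_hook (psi : int -> rat) la : (forall u, psi (- u) = psi u) -> is_dd la ->
  \sum_(b <- boxes la) psi (hook la b)%:Z =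
  \sum_(x <- strict_of la) \sum_(k < x) (psi k.+1%:Z + psi (- k%:Z))
  + \sum_(x <- strict_of la) \sum_(y <- strict_of la) (psi (x%:Z + y%:Z) - psi (x%:Z - y%:Z)).
Proof.
move=> ev dd; set X := strict_of la.
(* This bounds the number of rows and every part, so that [- x%:Z + n%:Z] is nonnegative and the
   absolute value in [Psi] is harmless. *)
pose n := (size la + \sum_(x <- X) x)%N.
have xn x : x \in X -> (x <= n)%N by move=> hx; rewrite /n (big_rem _ hx) /=; lia.
pose Psi (p : int) := \sum_(d < absz p) psi d.+1%:Z.
pose S (f : int -> rat) nu := \sum_(x <- strict_of nu) (f x%:Z - f (- x%:Z)).
pose N (f : int -> rat) := \sum_(m < n) f (- m.+1%:Z).
have main nu : is_dd nu -> (size nu <= n)%N ->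
  (\sum_(b <- boxes nu) psi (hook nu b)%:Z) *+ 2 =
  (S (fun u => Psi (u + n%:Z)) nu - S (fun u => N (fun v => psi (u - v))) nu) *+ 2
  + (N (fun u => Psi (u + n%:Z)) *+ 2 - N (fun u => N (fun v => psi (u - v))) + psi 0 *+ n)
  - S (fun u => S (fun v => psi (u - v)) nu) nu.
  move=> dn hn; rewrite (sum_hook_rows psi (dd_part dn) hn) /=.
  set b := bead nu.
  have sym i j : psi (b i - b j) = psi (b j - b i) by rewrite -ev opprB.
  have := sum_pairs (fun i j : 'I_n => sym i j).
  rewrite [X in _ = _ + X](eq_bigr (fun=> psi 0)); last by move=> i _; rewrite subrr.
  rewrite sumr_const card_ord => /eqP; rewrite -subr_eq => /eqP E.
  have BE f : \sum_(j < n) f (b j) = S f nu + N f by apply: bead_sum.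
  rewrite mulrnBl -E (BE (fun u => Psi (u + n%:Z))).
  have -> : \sum_(i < n) \sum_(j < n) psi (b i - b j) =
    S (fun u => S (fun v => psi (u - v)) nu) nu + S (fun u => N (fun v => psi (u - v))) nu *+ 2
    + N (fun u => N (fun v => psi (u - v))).
    under eq_bigr do rewrite (BE (fun v => psi (_ - v))).
    rewrite big_split /= (BE (fun u => S (fun v => psi (u - v)) nu)).
    rewrite (BE (fun u => N (fun v => psi (u - v)))).
    have -> : N (fun u => S (fun v => psi (u - v)) nu) = S (fun u => N (fun v => psi (u - v))) nu.
      rewrite /N /S exchange_big; apply: eq_bigr => x _ /=; rewrite -sumrB.
      by apply: eq_bigr => m _; congr (_ - _); rewrite -[LHS]ev; congr psi; ring.
    by ring.
  by move: (psi 0 *+ n) => z; ring.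
(* The pure vacuum terms do not depend on the partition; the empty partition shows that they add up
   to 0 without computing them. *)
have e0 := main [::] isT isT.
have {e0} mid : N (fun u => Psi (u + n%:Z)) *+ 2 - N (fun u => N (fun v => psi (u - v))) + psi 0 *+ n = 0.
  by move: e0; rewrite /S /= !big_nil subrr !mul0rn add0r subr0 => <-.
have h : (size la <= n)%N by rewrite leq_addr.
have half (a b : rat) : a *+ 2 = b *+ 2 -> a = b by lra.
apply: half; rewrite (main la dd h) mid addr0 [in RHS]mulrnDl; congr (_ *+ 2 + _).
  rewrite /S -sumrB; apply: eq_big_seq => x hx.
  have hxn := xn x hx; rewrite /N opprB addrACA -addrA.
  have -> : Psi (x%:Z + n%:Z) = \sum_(k < x) psi k.+1%:Z + \sum_(m < n) psi (x%:Z - - m.+1%:Z).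
    rewrite /Psi (_ : absz _ = x + n)%N; last by lia.
    rewrite big_split_ord; congr (_ + _); apply: eq_bigr => m _; congr psi.
    by rewrite /=; lia.
  have -> : \sum_(m < n) psi (- x%:Z - - m.+1%:Z) = \sum_(k < x) psi (- k%:Z) + Psi (- x%:Z + n%:Z).
    rewrite -[in LHS](subnKC hxn) big_split_ord /=; congr (_ + _).
      rewrite (reindex_inj rev_ord_inj); apply: eq_bigr => m _ /=; congr psi.
      by have := ltn_ord m; lia.
    rewrite /Psi (_ : absz _ = n - x)%N; last by lia.
    by apply: eq_bigr => m _; congr psi; lia.
  by rewrite big_split /=; ring.
rewrite -sumrMnl /S -sumrN; apply: eq_bigr => x _; rewrite -sumrMnl -sumrB -sumrN.
apply: eq_bigr => y _.
have -> : psi (- x%:Z - - y%:Z) = psi (x%:Z - y%:Z) by rewrite -[LHS]ev; congr psi; ring.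
have -> : psi (- x%:Z - y%:Z) = psi (x%:Z + y%:Z) by rewrite -[LHS]ev; congr psi; ring.
by rewrite opprK; ring.
Qed.

(** * The filtered algebra of power sums *)

Lemma subXX_monic (s : rat) n (e := 'X^(n.+1) - ('X - s%:P) ^+ n.+1 : {poly rat}) :
  (size e <= n.+1)%N /\ e`_n = n.+1%:R * s.
Proof.
have E : e = s *: \sum_(i < n.+1) 'X^(n.+1.-1 - i) * ('X - s%:P) ^+ i.
  rewrite /e subrXX opprB addrCA subrr addr0 mul_polyC.
  by congr (_ *: _); apply: eq_bigr => i _; rewrite subSS.
have M (i : 'I_n.+1) : 'X^(n.+1.-1 - i) * ('X - s%:P) ^+ i \is monic.
  by rewrite monicMl ?monicXn // monic_exp // monicXsubC.
have S (i : 'I_n.+1) : size ('X^(n.+1.-1 - i) * ('X - s%:P) ^+ i) = n.+1.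
  rewrite size_Mmonic ?monic_exp ?monicXsubC ?monic_neq0 ?monicXn //.
  by rewrite size_polyXn size_exp_XsubC /=; have := leq_ord i; lia.
rewrite E; split.
  apply: leq_trans (size_scale_leq _ _) _; apply: leq_trans (size_sum _ _ _) _.
  by apply/bigmax_leqP => i _; rewrite S.
rewrite coefZ coef_sum mulrC; congr (_ * _).
rewrite (eq_bigr (fun=> 1)) ?sumr_const ?card_ord // => i _.
by have /monicP := M i; rewrite lead_coefE S.
Qed.

(** Induction on the degree: X^(n+1) - (X - s)^(n+1) has degree n and leading coefficient (n + 1) s,
    so a multiple of it removes the leading term of [p]. *)
Lemma antidifference (s : rat) (p : {poly rat}) : s != 0 ->
  exists2 q : {poly rat}, (size q <= (size p).+1)%N &
    forall x, q.[x] - q.[x - s] = p.[x].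
Proof.
move=> s0; move: {2}(size p) (leqnn (size p)) => n.
elim: n p => [|n IH] p hp.
  exists 0; first by rewrite size_poly0.
  by move: hp; rewrite leqn0 size_poly_eq0 => /eqP-> x; rewrite !horner0 subrr.
pose c := p`_n / (n.+1%:R * s).
have [E1 E2] := subXX_monic s n.
set e := 'X^(n.+1) - _ in E1 E2.
have hp' : (size (p - c *: e)%R <= n)%N.
  apply/leq_sizeP => m; rewrite leq_eqVlt => /orP[/eqP <-|hm].
    rewrite coefB coefZ E2 /c divfK ?subrr //.
    by rewrite mulf_neq0 // pnatr_eq0.
  by rewrite coefB coefZ !nth_default ?mulr0 ?subr0 // (leq_trans _ hm).
have [q hq eq] := IH _ hp'.
case: (ltnP (size p) n.+1) => hs; first by apply: IH.
have sp : size p = n.+1 by apply/eqP; rewrite eqn_leq hp.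
exists (q + c *: 'X^(n.+1)).
  rewrite sp; apply: leq_trans (size_polyD _ _) _; rewrite geq_max.
  apply/andP; split; first by apply: leq_trans hq _; rewrite ltnS leqW.
  by apply: leq_trans (size_scale_leq _ _) _; rewrite size_polyXn.
move=> x; have := eq x; rewrite /e !(hornerD, hornerN, hornerZ, horner_exp, hornerX, hornerXn, hornerC).
by move=> h; rewrite -[RHS](subrK (c * (x ^+ n.+1 - (x - s) ^+ n.+1))) -h; ring.
Qed.

Section Weights.

Variable t : nat.

Definition psum (r a : nat) : seq nat -> rat := psumf t r (fun u => u%:~R ^+ a).

(* The weight is an integer: that of [f'] in D_t (G f) = G f' may become
   negative, which forces [f'] to vanish, see [Wt_neg]. *)
Inductive Wt : int -> (seq nat -> rat) -> Prop :=
| Wt_zero d : Wt d (fun=> 0)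
| Wt_cst d c : 0 <= d -> Wt d (fun=> c)
| Wt_psum d r a : (r < t)%N -> a.+1%:Z <= d -> Wt d (psum r a)
| Wt_add d f g : Wt d f -> Wt d g -> Wt d (fun la => f la + g la)
| Wt_mul d e f g : Wt d f -> Wt e g -> Wt (d + e) (fun la => f la * g la)
| Wt_ext d f g : (forall la, is_dd la -> f la = g la) -> Wt d f -> Wt d g.

Lemma Wt_mono d e f : d <= e -> Wt d f -> Wt e f.
Proof.
move=> + h; elim: h e => {d f} [d|d c d0|d r a rt ad|d f g _ IH1 _ IH2|d e f g _ IH1 wg _|d f g fg _ IH] e' de.
- exact: Wt_zero.
- by apply: Wt_cst; apply: le_trans de.
- by apply: Wt_psum => //; apply: le_trans de.
- by apply: Wt_add; [apply: IH1|apply: IH2].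
- rewrite -[e'](subrK e); apply: Wt_mul => //; apply: IH1; lia.
- by apply: Wt_ext fg _; apply: IH.
Qed.

(** Constants and power sums occur only at nonnegative weights, and a product of negative weight has
    a factor of negative weight. *)
Lemma Wt_neg d f la : Wt d f -> d < 0 -> is_dd la -> f la = 0.
Proof.
move=> h + dd; elim: h => {d f} [//|d c d0|d r a rt ad|d f g _ IH1 _ IH2|d e f g _ IH1 _ IH2|d f g fg _ IH] dn.
- by lia.
- by lia.
- by rewrite IH1 // IH2 // addr0.
- case: (ltP d 0) => hd; first by rewrite IH1 // mul0r.
  by rewrite IH2 ?mulr0 //; lia.
- by rewrite -fg // IH.
Qed.

Lemma Wt_scale d c f : Wt d f -> Wt d (fun la => c * f la).
Proof. by move=> h; rewrite -[d]add0r; apply: Wt_mul => //; apply: Wt_cst. Qed.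

Lemma Wt_sum d (I : Type) (s : seq I) (P : pred I) (f : I -> seq nat -> rat) :
  (forall i, P i -> Wt d (f i)) -> Wt d (fun la => \sum_(i <- s | P i) f i la).
Proof.
move=> h; elim: s => [|i s IH].
  by apply: Wt_ext (Wt_zero d) => la _; rewrite big_nil.
case Pi : (P i).
  by apply: Wt_ext (Wt_add (h i Pi) IH) => la _; rewrite big_cons Pi.
by apply: Wt_ext IH => la _; rewrite big_cons Pi.
Qed.

Lemma Wt_prod (I : Type) (s : seq I) (d : I -> int) (f : I -> seq nat -> rat) :
  (forall i, Wt (d i) (f i)) ->
  Wt (\sum_(i <- s) d i) (fun la => \prod_(i <- s) f i la).
Proof.
move=> h; elim: s => [|i s IH].
  rewrite big_nil; apply: (@Wt_ext _ (fun=> 1)) => [la _|]; last exact: Wt_cst.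
  by rewrite big_nil.
by rewrite big_cons; apply: Wt_ext (Wt_mul (h i) IH) => la _; rewrite big_cons.
Qed.

Lemma psumf_ext r g h la : (r < t)%N ->
  (forall q : int, g (t%:Z * q + r%:Z) = h (t%:Z * q + r%:Z)) ->
  psumf t r g la = psumf t r h la.
Proof.
move=> rt gh; rewrite /psumf; congr (_ - _); apply: eq_bigr => x.
  move=> /eqP e; have -> : x%:Z = t%:Z * (x %/ t)%N%:Z + r%:Z.
    by rewrite {1}(divn_eq x t) e PoszD PoszM mulrC.
  exact: gh.
move=> /dvdnP[m e]; have -> : - x%:Z = t%:Z * - m%:Z + r%:Z by nia.
exact: gh.
Qed.

Lemma psumf_sum r (I : Type) (s : seq I) (g : I -> int -> rat) la :
  psumf t r (fun u => \sum_(i <- s) g i u) la = \sum_(i <- s) psumf t r (g i) la.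
Proof.
by rewrite /psumf sumrB exchange_big /= [X in _ - X]exchange_big.
Qed.

Lemma psumfZ r c g la : psumf t r (fun u => c * g u) la = c * psumf t r g la.
Proof. by rewrite /psumf mulrBr !mulr_sumr. Qed.

Lemma psumfB r g h la :
  psumf t r (fun u => g u - h u) la = psumf t r g la - psumf t r h la.
Proof. by rewrite /psumf !sumrB; ring. Qed.

Lemma Wt_psumf_poly r (p : {poly rat}) d : (r < t)%N -> (size p)%:Z <= d ->
  Wt d (psumf t r (fun u => p.[u%:~R])).
Proof.
move=> rt hp.
apply: (@Wt_ext _ (fun la => \sum_(a < size p) p`_a * psum r a la)).
  move=> la _.
  transitivity (\sum_(a < size p) psumf t r (fun u => p`_a * u%:~R ^+ a) la).
    by apply: eq_bigr => a _; rewrite psumfZ.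
  rewrite -psumf_sum /psumf; congr (_ - _);
  by apply: eq_bigr => x _; rewrite horner_coef.
apply: Wt_sum => a _; apply: Wt_scale; apply: Wt_psum => //.
by have := ltn_ord a; lia.
Qed.

Definition residue_pow (j : int) (k : nat) (u : int) : rat :=
  if (u == j %[mod t%:Z])%Z then u%:~R ^+ k else 0.

Hypothesis t_gt0 : (0 < t)%N.

(** The inner sum runs over the integers from 1 - x to x and telescopes to Phi (x) - Phi (- x),
    where [Phi] is an antidifference of [residue_pow] that is polynomial of degree k + 1 on each
    residue class. *)
Lemma Wt_content (j : int) (k : nat) :
  Wt k.+2%:Z (fun la => \sum_(x <- strict_of la) \sum_(i < x)
     (residue_pow j k i.+1%:Z + residue_pow j k (- i%:Z))).
Proof.
have tz : t%:Z != 0 by lia.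
have t0 : t%:R != 0 :> rat by rewrite pnatr_eq0; lia.
have [Q sQ eQ] := antidifference 'X^k t0.
rewrite size_polyXn in sQ.
(* [u - del u] is the largest integer at most [u] congruent to [j]: [Phi] jumps only at that class,
   by a step of length [t] of [Q]. *)
pose del (u : int) := ((u - j) %% t%:Z)%Z.
pose Phi (u : int) := Q.[(u - del u)%:~R].
have dPhi u : Phi u - Phi (u - 1) = residue_pow j k u.
  rewrite /Phi /residue_pow /del eqz_mod_dvd -/(dvdz _ _).
  case: (boolP (t%:Z %| u - j)%Z) => [/dvdzP[m e]|nd].
    have e1 : ((u - j) %% t%:Z)%Z = 0 by rewrite e modzMl.
    have e2 : ((u - 1 - j) %% t%:Z)%Z = t%:Z - 1.
      rewrite (_ : u - 1 - j = (m - 1) * t%:Z + (t%:Z - 1)); last by lia.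
      by rewrite modzMDl modz_small //; lia.
    rewrite e1 e2 subr0 (_ : u - 1 - (t%:Z - 1) = u - t%:Z); last by ring.
    by rewrite rmorphB /= eQ hornerXn.
  have nz : ((u - j) %% t%:Z)%Z != 0 by apply: contra nd => /eqP/dvdz_mod0P.
  have e2 : ((u - 1 - j) %% t%:Z)%Z = ((u - j) %% t%:Z)%Z - 1.
    have := divz_eq (u - j) t%:Z; have := modz_ge0 (u - j) tz; have := ltz_mod (u - j) tz.
    move: nz; set m := ((u - j) %% t%:Z)%Z; set d := ((u - j) %/ t%:Z)%Z => nz h1 h2 h3.
    rewrite (_ : u - 1 - j = d * t%:Z + (m - 1)); last by rewrite addrA -h3; ring.
    by rewrite modzMDl modz_small //; lia.
  rewrite e2 (_ : u - 1 - (((u - j) %% t%:Z)%Z - 1) = u - ((u - j) %% t%:Z)%Z); last by ring.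
  by rewrite subrr.
apply: (@Wt_ext _ (fun la => \sum_(r < t) psumf t r Phi la)).
  move=> la _; rewrite sum_psumf //; apply: eq_bigr => x _.
  elim: x => [|x IH]; first by rewrite big_ord0 oppr0 subrr.
  rewrite big_ord_recr /= -IH -!dPhi.
  have -> : x.+1%:Z - 1 = x%:Z by lia.
  have -> : - x%:Z - 1 = - x.+1%:Z by lia.
  ring.
apply: Wt_sum => r _.
pose Qr := Q \Po ('X - (((r%:Z - j) %% t%:Z)%Z%:~R)%:P).
apply: (@Wt_ext _ (psumf t r (fun u => Qr.[u%:~R]))).
  move=> la _; apply: psumf_ext => // q.
  rewrite /Phi /Qr /del horner_comp hornerXsubC -rmorphB /=.
  have -> : ((t%:Z * q + r%:Z - j) %% t%:Z)%Z = ((r%:Z - j) %% t%:Z)%Z; last by [].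
  by rewrite -addrA [t%:Z * q]mulrC modzMDl.
apply: Wt_psumf_poly => //; rewrite size_comp_poly2 ?size_XsubC //; lia.
Qed.

Lemma Wt_content_sum j k : Wt k.+2%:Z (content_sum t j k).
Proof.
apply: Wt_ext (Wt_content j%:Z k) => la dd.
by rewrite -(sum_content (residue_pow j%:Z k) dd) /content_sum [RHS]big_mkcond.
Qed.

(** The even exponent and the sign in the congruence make [psi] even, as [sum_hook] requires. For u
    and v on fixed runners the congruence on u - v is constant and (u - v)^(2k) expands by the
    binomial formula. The factor 1/2 appears because the four sign choices for x and y give each
    value of [psi] twice. *)
Lemma Wt_hook_sum j k : Wt (2 * k.+1)%:Z (hook_sum t j k).
Proof.
pose chi (u : int) := ((u == j%:Z %[mod t%:Z]) || (u == - j%:Z %[mod t%:Z]))%Z.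
pose psi (u : int) := if chi u then u%:~R ^+ (2 * k) else 0 : rat.
have tz : t%:Z != 0 by lia.
have chi_mod q r : chi (t%:Z * q + r) = chi r by rewrite /chi mulrC modzMDl.
have psi_even u : psi (- u) = psi u.
  rewrite /psi rmorphN /= exprM sqrrN -exprM /chi.
  have N (a b : int) : (- a == b %[mod t%:Z])%Z = (a == - b %[mod t%:Z])%Z.
    by rewrite !eqz_mod_dvd opprK -opprD rpredN.
  by rewrite !N opprK orbC.
have E la : is_dd la -> hook_sum t j k la =
   \sum_(r < t) (if chi r%:Z then \sum_(x <- strict_of la) \sum_(i < x)
       (residue_pow r%:Z (2 * k) i.+1%:Z + residue_pow r%:Z (2 * k) (- i%:Z)) else 0)
   - 2^-1 * \sum_(r < t) \sum_(s < t) (if chi (r%:Z - s%:Z) then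
        \sum_(a < (2 * k).+1) (-1) ^+ a * 'C(2 * k, a)%:R * (psum r (2 * k - a) la * psum s a la)
      else 0).
  move=> dd; rewrite /hook_sum big_mkcond -/psi.
  rewrite (eq_bigr (fun b => psi (hook la b)%:Z)) // (sum_hook psi_even dd).
  congr (_ + _).
    rewrite -big_mkcond exchange_big; apply: eq_bigr => x _ /=.
    rewrite exchange_big; apply: eq_bigr => i _ /=; rewrite big_split /=.
    have P u : psi u = \sum_(r < t | chi r%:Z) residue_pow r%:Z (2 * k) u.
      have ut : (absz (u %% t%:Z)%Z < t)%N.
        by have := ltz_mod u tz; have := modz_ge0 u tz; lia.
      have ue : (absz (u %% t%:Z)%Z)%:Z = (u %% t%:Z)%Z by have := modz_ge0 u tz; lia.
      rewrite big_mkcond (bigD1 (Ordinal ut)) //= big1 ?addr0.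
        by rewrite /residue_pow ue modz_mod eqxx /psi /chi !modz_mod.
      move=> r nr; case: ifP => // _; rewrite /residue_pow; case: eqP => // e.
      case/eqP: nr; apply/val_inj => /=; apply/eqP; rewrite -eqz_nat ue e modz_small //.
      by rewrite /= ltz_nat ltn_ord.
    by rewrite !P.
  pose S (f : int -> rat) := \sum_(x <- strict_of la) (f x%:Z - f (- x%:Z)).
  have -> : \sum_(x <- strict_of la) \sum_(y <- strict_of la) (psi (x%:Z + y%:Z) - psi (x%:Z - y%:Z))
     = - (2^-1 * S (fun u => S (fun v => psi (u - v)))).
    rewrite /S mulr_sumr -sumrN; apply: eq_bigr => x _.
    rewrite -sumrB mulr_sumr -sumrN; apply: eq_bigr => y _.
    have -> : psi (- x%:Z - - y%:Z) = psi (x%:Z - y%:Z) by rewrite -[LHS]psi_even; congr psi; ring.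
    have -> : psi (- x%:Z - y%:Z) = psi (x%:Z + y%:Z) by rewrite -[LHS]psi_even; congr psi; ring.
    by rewrite opprK; field.
  have SE f : S f = \sum_(r < t) psumf t r f la by rewrite sum_psumf.
  congr (- (_ * _)); rewrite SE; apply: eq_bigr => r _.
  transitivity (psumf t r (fun u => \sum_(s < t) psumf t s (fun v => psi (u - v)) la) la).
    by apply: psumf_ext => // q; rewrite SE.
  rewrite psumf_sum; apply: eq_bigr => s _.
  transitivity (psumf t r (fun u => psumf t s (fun v =>
     if chi (r%:Z - s%:Z) then (u - v)%:~R ^+ (2 * k) else 0) la) la).
    apply: psumf_ext => // q; apply: psumf_ext => // q'.
    rewrite /psi (_ : _ - _ = t%:Z * (q - q') + (r%:Z - s%:Z)); last by ring.
    by rewrite chi_mod.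
  case: ifP => _; last first.
    by rewrite /psumf !big1 ?subr0 // => x _; rewrite !big1 ?subr0.
  transitivity (psumf t r (fun u => \sum_(a < (2 * k).+1)
     ((-1) ^+ a * 'C(2 * k, a)%:R * psum s a la) * u%:~R ^+ (2 * k - a)) la); last first.
    rewrite psumf_sum; apply: eq_bigr => a _.
    by rewrite psumfZ -/(psum _ _ _); ring.
  apply: psumf_ext => // q; set u := _ + _.
  transitivity (psumf t s (fun v => \sum_(a < (2 * k).+1)
      ((-1) ^+ a * 'C(2 * k, a)%:R * u%:~R ^+ (2 * k - a)) * v%:~R ^+ a) la); last first.
    by rewrite psumf_sum; apply: eq_bigr => a _; rewrite psumfZ -/(psum _ _ _); ring.
  apply: psumf_ext => // q'; rewrite rmorphB /= exprBn; apply: eq_bigr => a _.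
  by rewrite -mulr_natr; ring.
apply: (@Wt_ext _ _ _ (fun la dd => esym (E la dd))).
apply: Wt_add.
  apply: Wt_sum => r _; case: (chi r%:Z); last exact: Wt_zero.
  by apply: Wt_mono (Wt_content _ _); lia.
apply: (@Wt_ext _ (fun la => (- 2^-1) * \sum_(r < t) \sum_(s < t) (if chi (r%:Z - s%:Z) then
        \sum_(a < (2 * k).+1) (-1) ^+ a * 'C(2 * k, a)%:R * (psum r (2 * k - a) la * psum s a la)
      else 0))) => [la _|]; first by rewrite mulNr.
apply: Wt_scale; apply: Wt_sum => r _; apply: Wt_sum => s _.
case: (chi _); last exact: Wt_zero.
apply: Wt_sum => a _; apply: Wt_scale.
have -> : (2 * k.+1)%:Z = (2 * k - a).+1%:Z + a.+1%:Z by have := leq_ord a; lia.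
by apply: Wt_mul; apply: Wt_psum.
Qed.

End Weights.

(** * Averages over moves *)

Section Average.

Variables (t : nat) (om : int) (moves : seq nat -> seq (rat * rat * seq nat)).

Definition avg (chi : seq nat -> rat -> rat) (la : seq nat) : rat :=
  \sum_(p <- moves la) p.1.1 * chi la p.1.2.

(** All powers of x are included so that multiplying by x only shifts [e]. *)
Definition avg_class (d : int) (chi : seq nat -> rat -> rat) : Prop :=
  forall e : nat, Wt t (d + om * e%:Z) (avg (fun la x => chi la x * x ^+ e)).

(* Functions of weight at most d in the algebra generated by the psum r a and
   by the position x, x being given the weight om. They are specified through
   their action on averages because this property is visibly stable under
   products. *)
Definition mult_class (d : int) (psi : seq nat -> rat -> rat) : Prop :=
  forall d' chi, avg_class d' chi -> avg_class (d + d') (fun la x => psi la x * chi la x).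

Lemma avg_class_ext d chi chi' :
  (forall la x, is_dd la -> chi la x = chi' la x) -> avg_class d chi -> avg_class d chi'.
Proof.
move=> E h e; apply: Wt_ext (h e) => la dd.
by apply: eq_bigr => p _; rewrite E.
Qed.

Lemma avg_class_mono (d d' : int) chi : d <= d' -> avg_class d chi -> avg_class d' chi.
Proof. by move=> dd' h e; apply: Wt_mono (h e); lia. Qed.

Lemma mult_mono (d d' : int) psi : d <= d' -> mult_class d psi -> mult_class d' psi.
Proof.
by move=> dd' h e chi hc; apply: avg_class_mono (h e chi hc); lia.
Qed.

Lemma mult_ext d psi psi' :
  (forall la x, is_dd la -> psi la x = psi' la x) -> mult_class d psi -> mult_class d psi'.
Proof.
move=> E h d' chi hc; apply: avg_class_ext (h d' chi hc) => la x dd /=.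
by rewrite E.
Qed.

Lemma mult_Wt d f : Wt t d f -> mult_class d (fun la _ => f la).
Proof.
move=> hf d' chi hc e; rewrite -addrA; apply: Wt_ext (Wt_mul hf (hc e)) => la _.
by rewrite /avg mulr_sumr; apply: eq_bigr => p _; ring.
Qed.

Lemma mult_pos : mult_class om (fun _ x => x).
Proof.
move=> d' chi hc e; rewrite [om + d']addrC -addrA -{1}[om]mulr1 -mulrDr -PoszD add1n.
by apply: Wt_ext (hc e.+1) => la _; apply: eq_bigr => p _; rewrite exprS; ring.
Qed.

Lemma mult_add d psi psi' : mult_class d psi -> mult_class d psi' ->
  mult_class d (fun la x => psi la x + psi' la x).
Proof.
move=> h h' d' chi hc e; apply: Wt_ext (Wt_add (h _ _ hc e) (h' _ _ hc e)) => la _.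
by rewrite /avg -big_split; apply: eq_bigr => p _ /=; ring.
Qed.

Lemma mult_mul d d' psi psi' : mult_class d psi -> mult_class d' psi' ->
  mult_class (d + d') (fun la x => psi la x * psi' la x).
Proof.
move=> h h' d2 chi hc; rewrite -addrA.
by apply: avg_class_ext (h _ _ (h' _ _ hc)) => la x _ /=; rewrite mulrA.
Qed.

Lemma mult_scale d c psi : mult_class d psi -> mult_class d (fun la x => c * psi la x).
Proof.
by move=> h; rewrite -[d]add0r; apply: mult_mul => //; apply/mult_Wt/Wt_cst.
Qed.

Lemma mult_zero d : mult_class d (fun _ _ => 0).
Proof. exact: mult_Wt (Wt_zero t d). Qed.

Lemma mult_exp n : mult_class (om * n%:Z) (fun _ x => x ^+ n).
Proof.
elim: n => [|n IH]; first by rewrite mulr0; apply/mult_Wt/Wt_cst.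
rewrite intS mulrDr mulr1; apply: mult_ext (mult_mul mult_pos IH) => la x _.
by rewrite exprS.
Qed.

Lemma mult_poly (p : {poly rat}) n : 0 <= om -> (size p <= n.+1)%N ->
  mult_class (om * n%:Z) (fun _ x => p.[x]).
Proof.
move=> om0 hp.
have h m : (m <= n.+1)%N -> mult_class (om * n%:Z) (fun _ x => \sum_(i < m) p`_i * x ^+ i).
  elim: m => [|m IH] hm.
    by apply: mult_ext (mult_zero _) => la x _; rewrite big_ord0.
  apply: mult_ext (mult_add (IH (ltnW hm)) (mult_scale p`_m (mult_mono _ (mult_exp m)))).
    by move=> la x _; rewrite big_ord_recr.
  by apply: ler_wpM2l => //; lia.
apply: mult_ext (h _ hp) => la x _.
by rewrite horner_coef.
Qed.

Hypothesis moment_Wt : forall m : nat, Wt t (om * m%:Z) (avg (fun _ x => x ^+ m)).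
Hypothesis total_weight : forall la, is_dd la -> \sum_(p <- moves la) p.1.1 = 1.
Hypothesis moves_dd :
  forall la p, is_dd la -> p \in moves la -> p.1.1 != 0 -> is_dd p.2.

(** A triple in [moves] is a weight, the position of the bead and the resulting partition. Triples
    of weight 0 are excluded: they may come from boxes that cannot be added. *)
Definition has_delta (d : int) (f : seq nat -> rat) : Prop :=
  exists2 psi, mult_class d psi &
    forall la p, is_dd la -> p \in moves la -> p.1.1 != 0 ->
      f p.2 = f la + psi la p.1.2.

Hypothesis psum_delta :
  forall r a, (r < t)%N -> has_delta (a%:Z - 1) (psum t r a).

Lemma avg_mult d psi : mult_class d psi -> Wt t d (avg psi).
Proof.
move=> h; have h1 : avg_class 0 (fun _ _ => 1).
  move=> e; rewrite add0r; apply: Wt_ext (moment_Wt e) => la _.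
  by apply: eq_bigr => p _; rewrite mul1r.
have := h _ _ h1 0%N; rewrite mulr0 !addr0; apply: Wt_ext => la _.
by apply: eq_bigr => p _; rewrite expr0 !mulr1.
Qed.

(** With increments p of f and q of g, the increment of f g is f q + g p + p q, whose last term even
    drops by 4. *)
Lemma Wt_delta d f : Wt t d f -> has_delta (d - 2) f.
Proof.
elim=> {d f} [d|d c d0|d r a rt ad|d f g _ [p hp ep] _ [q hq eq]|d e f g wf [p hp ep] wg [q hq eq]|d f g fg _ [p hp ep]].
- by exists (fun _ _ => 0) => [|*]; [exact: mult_zero|rewrite addr0].
- by exists (fun _ _ => 0) => [|*]; [exact: mult_zero|rewrite addr0].
- have [psi h E] := psum_delta a rt; exists psi => //; apply: mult_mono h; lia.
- exists (fun la x => p la x + q la x); first exact: mult_add.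
  by move=> la z dd hz nz; rewrite (ep la z dd hz nz) (eq la z dd hz nz); ring.
- exists (fun la x => (f la * q la x + g la * p la x) + p la x * q la x).
    apply: mult_add; last by apply: mult_mono (mult_mul hp hq); lia.
    apply: mult_add.
      by apply: mult_mono (mult_mul (mult_Wt wf) hq); lia.
    by apply: mult_mono (mult_mul (mult_Wt wg) hp); lia.
  by move=> la z dd hz nz; rewrite (ep la z dd hz nz) (eq la z dd hz nz); ring.
- exists p => // la z dd hz nz; rewrite -!fg //; first exact: ep.
  exact: moves_dd dd hz nz.
Qed.

Lemma Wt_moves d f : Wt t d f -> exists2 f', Wt t (d - 2) f' &
  forall la, is_dd la -> \sum_(p <- moves la) p.1.1 * f p.2 = f la + f' la.
Proof.
move=> /Wt_delta[psi hpsi E]; exists (avg psi); first exact: avg_mult.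
move=> la dd; rewrite -[f la]mul1r -(total_weight dd) mulr_suml -big_split /=.
apply: eq_big_seq => p hp; have [->|nz] := eqVneq p.1.1 0; first by rewrite !mul0r addr0.
by rewrite (E la p) // mulrDr.
Qed.

End Average.

(** * Adding a box to a quotient *)

Section Moves.

Variable t : nat.
Hypothesis t_odd : odd t.

Let t_gt0 : (0 < t)%N. Proof. exact: odd_gt0. Qed.

Definition strict_move (la : seq nat) (j : nat) : seq nat :=
  assemble t (fun i => charge t i la) (incr_nth (strict_quotient t la) j)
    (fun i => tquotient t i la).

Definition runner_move (i : nat) (la : seq nat) (j : nat) : seq nat :=
  assemble t (fun i => charge t i la) (strict_quotient t la)
    (fun r => if r == i then incr_nth (tquotient t i la) j else tquotient t r la).

(** A depth that includes all nonempty rows and is at least the charge, as the cut in [psumf_runner]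
    requires. *)
Definition runner_len (i : nat) (la : seq nat) : nat :=
  (size (tquotient t i la) + absz (charge t i la)%R)%N.

Definition runner_shift (i : nat) (la : seq nat) : rat :=
  t%:R * ((charge t i la)%:~R - 1) + i%:R.

Definition strict_moves (la : seq nat) : seq (rat * rat * seq nat) :=
  [seq (strict_weight j, oblong (nth 0%N (strict_quotient t la) j)%:R, strict_move la j)
     | j <- enum 'I_(size (strict_quotient t la)).+1].

Definition runner_moves (i : nat) (la : seq nat) : seq (rat * rat * seq nat) :=
  [seq (bead_weight t%:R (runner_shift i la) (tquotient t i la) j,
        bead_pos t%:R (runner_shift i la) (tquotient t i la) j, runner_move i la j)
     | j <- enum 'I_(runner_len i la).+1].

Lemma strict_moveP la j (nu := strict_move la j) : is_dd la ->
  is_strict (incr_nth (strict_quotient t la) j) ->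
  [/\ is_dd nu, tcore t nu = tcore t la,
      strict_quotient t nu = incr_nth (strict_quotient t la) j &
      forall r, (0 < r <= t./2)%N -> tquotient t r nu = tquotient t r la].
Proof. by move=> dd st; apply: assembleP => // r _; apply: is_part_tquotient. Qed.

Lemma runner_moveP i la j (nu := runner_move i la j) : is_dd la ->
  is_part (incr_nth (tquotient t i la) j) ->
  [/\ is_dd nu, tcore t nu = tcore t la,
      strict_quotient t nu = strict_quotient t la &
      forall r, (0 < r <= t./2)%N ->
        tquotient t r nu = if r == i then incr_nth (tquotient t i la) j else tquotient t r la].
Proof.
move=> dd pt; apply: assembleP => //.
  by have [] := dd_quotient0 dd t_gt0.
by move=> r _; case: eqP => // _; apply: is_part_tquotient.
Qed.

Lemma psumf_same r g la nu : is_dd la -> is_dd nu -> (r < t)%N ->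
  charge t r nu = charge t r la -> tquotient t r nu = tquotient t r la ->
  psumf t r g nu = psumf t r g la.
Proof.
move=> dl dn rt ec et.
have h1 : (size (tquotient t r la) <= runner_len r la)%N by apply: leq_addr.
have h2 : charge t r la <= (runner_len r la)%:Z by rewrite /runner_len; lia.
rewrite (psumf_runner g dl rt h1 h2) (@psumf_runner t r g nu (runner_len r la) dn rt);
  by rewrite ?et ?ec.
Qed.

Definition runner_pos (i : nat) (la : seq nat) (j : nat) : int :=
  t%:Z * (bead (tquotient t i la) j + charge t i la) + i%:Z.

Lemma bead_pos_runner i la j :
  bead_pos t%:R (runner_shift i la) (tquotient t i la) j = (runner_pos i la j)%:~R.
Proof.
rewrite /bead_pos /runner_shift /runner_pos /bead.
by rewrite (_ : j.+1%:Z = j%:Z + 1); [ring|lia].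
Qed.

Lemma quotient0_same la nu : is_dd la -> is_dd nu -> tcore t nu = tcore t la ->
  strict_quotient t nu = strict_quotient t la -> tquotient t 0 nu = tquotient t 0 la.
Proof.
move=> dl dn ec es; have [_ _ -> _] := dd_quotient0 dl t_gt0.
by have [_ _ -> _] := dd_quotient0 dn t_gt0; rewrite es.
Qed.

(** Only runner [i] is computed directly; [psumfN] carries the change over to the mirror runner, and
    the other runners keep their charge and quotient. *)
Lemma psumf_runner_move i la j r g (x := runner_pos i la j) : is_dd la ->
  (0 < i <= t./2)%N -> is_part (incr_nth (tquotient t i la) j) -> (r < t)%N ->
  (j < (runner_len i la).+1)%N ->
  psumf t r g (runner_move i la j) = psumf t r g la +
    (if r == i then g (x + t%:Z) - g x
     else if r == (t - i)%N then g (- x) - g (- x - t%:Z) else 0).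
Proof.
move=> dl hi pt rt jn; have [dn ec es eq] := runner_moveP dl pt.
set nu := runner_move i la j in dn ec es eq *.
have ecc := (tcore_eqP dn dl t_gt0).1 ec.
have own h : psumf t i h nu = psumf t i h la + (h (x + t%:Z) - h x).
  (* One row more than [runner_len], since the new box may open a row. *)
  pose n := (runner_len i la).+1.
  have eqi : tquotient t i nu = incr_nth (tquotient t i la) j.
    by have := eq i hi; rewrite eqxx.
  have it : (i < t)%N by lia.
  rewrite (@psumf_runner t i h la n) //; [|rewrite /n /runner_len; lia|rewrite /n /runner_len; lia].
  rewrite (@psumf_runner t i h nu n) ?ecc ?eqi //; first last.
  - by rewrite /n /runner_len; lia.
  - by rewrite size_incr_nth; case: ifP => _; [exact: leqW (leq_addr _ _)|exact: jn].
  rewrite [in LHS](bigD1 (Ordinal jn)) //= [in RHS](bigD1 (Ordinal jn)) //=.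
  rewrite nth_incr_nth eqxx /=.
  rewrite [X in _ + X - _ = _](eq_bigr (fun k : 'I_n =>
    h (t%:Z * ((nth 0%N (tquotient t i la) k)%:Z - k.+1%:Z + charge t i la) + i%:Z))); last first.
    by move=> k nk; rewrite nth_incr_nth (_ : (j == k) = false) //;
       apply: contraNF nk => /eqP e; apply/eqP/val_inj.
  rewrite (_ : t%:Z * ((1 + nth 0%N (tquotient t i la) j)%N%:Z - j.+1%:Z + charge t i la) + i%:Z
     = x + t%:Z); last by rewrite /x /runner_pos /bead PoszD; ring.
  rewrite (_ : t%:Z * ((nth 0%N (tquotient t i la) j)%:Z - j.+1%:Z + charge t i la) + i%:Z = x) //.
  by ring.
case: (posnP r) => [->|r0].
  rewrite (_ : (0%N == i) = false); last by lia.
  rewrite (_ : (0%N == t - i)%N = false); last by lia.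
  by rewrite addr0; apply: psumf_same; rewrite ?ecc // (quotient0_same dl dn).
case: eqP => [->|ri]; first exact: own.
case: (leqP r t./2) => h.
  rewrite (_ : (r == t - i)%N = false); last by lia.
  rewrite addr0; apply: psumf_same; rewrite ?ecc // eq ?r0 //.
  by case: eqP.
have P nu' : psumf t r g nu' = - psumf t (t - r) (g \o -%R) nu'.
  by rewrite -[in LHS](subKn (ltnW rt)) psumfN //; lia.
rewrite !P; case: eqP => e.
  have -> : (t - r)%N = i by lia.
  by rewrite own /= (_ : - (x + t%:Z) = - x - t%:Z); [ring|exact: opprD].
rewrite addr0; congr (- _); apply: psumf_same; rewrite ?ecc //; try lia.
by rewrite eq; [case: eqP => // e'; lia|lia].
Qed.

Lemma strict_sum (Y : seq nat) n (h : nat -> rat) : (size Y <= n)%N -> h 0%N = 0 ->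
  \sum_(j < n) h (nth 0%N Y j) = \sum_(y <- Y) h y.
Proof.
move=> hn h0; rewrite (big_nth 0%N) big_mkord.
rewrite (big_ord_widen _ (fun j => h (nth 0%N Y j)) hn) [RHS]big_mkcond.
by apply: eq_bigr => j _; case: ltnP => // hj; rewrite nth_default.
Qed.

(** On runner 0, [psumf0] pairs t y with - t y. As [h] vanishes at 0, creating a part is the same as
    raising a part equal to 0. *)
Lemma psumf_strict_move la j r g (y := (nth 0%N (strict_quotient t la) j)%:Z)
    (h := fun y : int => g (t%:Z * y) - g (- (t%:Z * y))) : is_dd la ->
  is_strict (incr_nth (strict_quotient t la) j) -> (r < t)%N ->
  (j < (size (strict_quotient t la)).+1)%N ->
  psumf t r g (strict_move la j) = psumf t r g la +
    (if r == 0%N then h (y + 1) - h y else 0).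
Proof.
move=> dl st rt jn; have [dn ec es eq] := strict_moveP dl st.
set nu := strict_move la j in dn ec es eq *.
have ecc := (tcore_eqP dn dl t_gt0).1 ec.
case: (posnP r) => [->|r0].
  rewrite !psumf0 // es; set Y := strict_quotient t la.
  have h0 : h 0%N%:Z = 0 by rewrite /h mulr0 oppr0 subrr.
  rewrite -(@strict_sum _ (size Y).+1 (fun y => h y%:Z)) //; last first.
    by rewrite size_incr_nth; case: ifP.
  rewrite -(@strict_sum Y (size Y).+1 (fun y => h y%:Z)) //.
  rewrite [in LHS](bigD1 (Ordinal jn)) //= [in RHS](bigD1 (Ordinal jn)) //=.
  rewrite nth_incr_nth eqxx [X in _ + X = _](eq_bigr (fun k : 'I_(size Y).+1 => h (nth 0%N Y k)%:Z)).
    by rewrite addnC PoszD -[_ + true%:Z]/(y + 1) -[(nth 0%N Y j)%:Z]/y; ring.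
  by move=> k nk; rewrite nth_incr_nth (_ : (j == k) = false) //;
       apply: contraNF nk => /eqP e; apply/eqP/val_inj.
rewrite addr0.
case: (leqP r t./2) => hr.
  by apply: psumf_same; rewrite ?ecc // eq ?r0.
have P nu' : psumf t r g nu' = - psumf t (t - r) (g \o -%R) nu'.
  by rewrite -[in LHS](subKn (ltnW rt)) psumfN //; lia.
rewrite !P; congr (- _); apply: psumf_same; rewrite ?ecc //; try lia.
by rewrite eq //; lia.
Qed.

(** Completing the second family by its last term makes the difference a sum of b^k - (b - t)^k over
    the same beads. Its vacuum part telescopes from (i - t)^k down to a term that cancels the one
    added. *)
Lemma runner_power_diff i la k : is_dd la -> (i < t)%N ->
  power_diff (fun j : 'I_(runner_len i la).+1 =>
      bead_pos t%:R (runner_shift i la) (tquotient t i la) j)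
    (fun j : 'I_(runner_len i la) =>
      bead_pos t%:R (runner_shift i la) (tquotient t i la) j - t%:R) k =
  psumf t i (fun u => ('X^k - ('X - t%:R%:P) ^+ k).[u%:~R]) la + (i%:R - t%:R) ^+ k.
Proof.
move=> dd it; rewrite /power_diff; set n := runner_len i la; set c := charge t i la.
have cn : c <= n%:Z by rewrite /n /runner_len; lia.
have E (g : int -> rat) : \sum_(j < n.+1) g (runner_pos i la j) =
  psumf t i g la + \sum_(m < absz (n.+1%:Z - c)%R) g (i%:Z - t%:Z * m.+1%:Z).
  rewrite (@psumf_runner t i g la n.+1) ?subrK //; last by lia.
  by rewrite leqW // leq_addr.
have -> : \sum_(j < n.+1) bead_pos t%:R (runner_shift i la) (tquotient t i la) j ^+ k =
    \sum_(j < n.+1) (fun u : int => u%:~R ^+ k : rat) (runner_pos i la j).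
  by apply: eq_bigr => j _; rewrite bead_pos_runner.
have -> : \sum_(j < n) (bead_pos t%:R (runner_shift i la) (tquotient t i la) j - t%:R) ^+ k =
    \sum_(j < n.+1) (fun u : int => (u%:~R - t%:R) ^+ k : rat) (runner_pos i la j)
    - (t%:R * (c%:~R - n.+2%:R) + i%:R) ^+ k.
  rewrite big_ord_recr /= (_ : (runner_pos i la n)%:~R - t%:R = t%:R * (c%:~R - n.+2%:R) + i%:R).
    by rewrite addrK; apply: eq_bigr => j _; rewrite bead_pos_runner.
  rewrite /runner_pos /bead nth_default ?leq_addr //.
  by rewrite !(rmorphD, rmorphM, rmorphB) /= -/c -![n.+2%:R]natr1 -![n.+1%:R]natr1; ring.
rewrite (E (fun u => u%:~R ^+ k)) (E (fun u => (u%:~R - t%:R) ^+ k)).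
set M := absz _.
have eM : (t%:R * (c%:~R - n.+2%:R) + i%:R : rat) = i%:R - t%:R * M.+1%:R.
  have : c = n.+1%:Z - M%:Z by rewrite /M; lia.
  move=> ->; rewrite rmorphB /= -!pmulrn -[n.+2%:R]natr1 -[M.+1%:R]natr1; ring.
have tel m : \sum_(m < m) (i%:Z - t%:Z * m.+1%:Z)%:~R ^+ k
   - \sum_(m < m) ((i%:Z - t%:Z * m.+1%:Z)%:~R - t%:R) ^+ k
   = (i%:R - t%:R) ^+ k - (i%:R - t%:R * m.+1%:R) ^+ k :> rat.
  elim: m => [|m IH]; first by rewrite !big_ord0 mulr1 !subrr.
  rewrite !big_ord_recr /= opprD addrACA IH.
  have -> : (i%:Z - t%:Z * m.+1%:Z)%:~R = i%:R - t%:R * m.+1%:R :> rat.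
    by ring.
  have -> : i%:R - t%:R * m.+1%:R - t%:R = i%:R - t%:R * m.+2%:R :> rat.
    by rewrite -[m.+2%:R]natr1; ring.
  ring.
have -> : psumf t i (fun u => ('X^k - ('X - t%:R%:P) ^+ k).[u%:~R]) la =
  psumf t i (fun u => u%:~R ^+ k) la - psumf t i (fun u => (u%:~R - t%:R) ^+ k) la.
  rewrite -psumfB /psumf; congr (_ - _); apply: eq_bigr => u _;
  by rewrite !(hornerD, hornerN, horner_exp, hornerX, hornerXn, hornerC).
have := tel M; rewrite eM.
set A := \sum_(m < M) _; set B := \sum_(m < M) _; move: A B => A B h.
have -> : A = B + ((i%:R - t%:R) ^+ k - (i%:R - t%:R * M.+1%:R) ^+ k) by rewrite -h; ring.
ring.
Qed.

End Moves.

(** Newton's recurrence is homogeneous, so a weight proportional to the order passes from the power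
    differences to the moments. *)
Lemma Wt_newton t (om : int) (h q : nat -> seq nat -> rat) :
  (forall la, is_dd la -> h 0%N la = 1) ->
  (forall m la, is_dd la ->
     m.+1%:R * h m.+1 la = \sum_(k < m.+1) h (m - k)%N la * q k.+1 la) ->
  (forall k, Wt t (om * k.+1%:Z) (q k.+1)) ->
  forall m, Wt t (om * m%:Z) (h m).
Proof.
move=> h0 hS wq; elim/ltn_ind => -[|m] IH.
  by rewrite mulr0; apply: (@Wt_ext _ _ (fun=> 1)) (Wt_cst _ _ _) => // la dd; rewrite h0.
apply: (@Wt_ext _ _ (fun la => m.+1%:R^-1 * \sum_(k < m.+1) h (m - k)%N la * q k.+1 la)).
  by move=> la dd; rewrite -hS // mulKf // pnatr_eq0.
apply: Wt_scale; apply: Wt_sum => k _.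
have -> : om * m.+1%:Z = om * (m - k)%N%:Z + om * k.+1%:Z.
  by rewrite -mulrDr; congr (_ * _); have := leq_ord k; lia.
by apply: Wt_mul; [apply: IH; rewrite ltnS leq_subr|exact: wq].
Qed.

Lemma size_mul_leq (p q : {poly rat}) m n :
  (size p <= m)%N -> (size q <= n)%N -> (size (p * q)%R <= (m + n).-1)%N.
Proof.
move=> hp hq; apply: leq_trans (size_polyMleq _ _) _.
by rewrite -!subn1 leq_sub2r // leq_add.
Qed.

(** The numbers y + 1 and - y have sum 1 and product - oblong y, so their power sums satisfy p_(a+2)
    = p_(a+1) + oblong y p_a. *)
Lemma pow_sum_oblong a : exists2 P : {poly rat}, (size P <= (a./2).+1)%N &
  forall y, (y + 1) ^+ a + (- y) ^+ a = P.[oblong y].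
Proof.
suff [//] : (exists2 P : {poly rat}, (size P <= (a./2).+1)%N &
    forall y, (y + 1) ^+ a + (- y) ^+ a = P.[oblong y]) /\
  (exists2 P : {poly rat}, (size P <= (a.+1./2).+1)%N &
    forall y, (y + 1) ^+ a.+1 + (- y) ^+ a.+1 = P.[oblong y]).
elim: a => [|a [[P sP eP] [Q sQ eQ]]]; split.
- exists 2%:P; first by rewrite size_polyC.
  by move=> y; rewrite !expr0 hornerC.
- exists 1; first by rewrite size_poly1.
  by move=> y; rewrite !expr1 hornerC; ring.
- by exists Q.
exists (Q + P * 'X).
  apply: leq_trans (size_polyD _ _) _; rewrite geq_max; apply/andP; split.
    by apply: leq_trans sQ _; rewrite /=; lia.
  apply: leq_trans (size_polyMleq _ _) _; rewrite size_polyX addn2 /=.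
  by rewrite ltnS; exact: sP.
move=> y; rewrite hornerD hornerM hornerX -eQ -eP /oblong !exprS; ring.
Qed.

(** * Weights of moments and increments for the two kinds of moves *)

Section Lowering.

Variable t : nat.
Hypothesis t_odd : odd t.

Let t_gt0 : (0 < t)%N. Proof. exact: odd_gt0. Qed.
Let tR0 : t%:R != 0 :> rat. Proof. by rewrite pnatr_eq0 -lt0n t_gt0. Qed.

Lemma runner_moment_Wt i m : (i < t)%N ->
  Wt t (1 * m%:Z) (avg (runner_moves t i) (fun _ x => x ^+ m)).
Proof.
move=> it; pose b la (j : 'I_(runner_len t i la).+1) :=
  bead_pos t%:R (runner_shift t i la) (tquotient t i la) j.
pose a la (j : 'I_(runner_len t i la)) :=
  bead_pos t%:R (runner_shift t i la) (tquotient t i la) j - t%:R.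
have E m' la : avg (runner_moves t i) (fun _ x => x ^+ m') la = lagr_moment (b la) (a la) m'.
  by rewrite /avg big_map big_enum.
apply: (@Wt_ext _ _ (fun la => lagr_moment (b la) (a la) m)) => [la _|]; first by rewrite E.
have inj la : is_dd la -> injective (b la).
  by move=> dd; apply: bead_pos_inj => //; apply: is_part_tquotient.
apply: (@Wt_newton t 1 (fun m la => lagr_moment (b la) (a la) m)
         (fun m la => power_diff (b la) (a la) m)).
- by move=> la /inj ib; apply: lagr_moment0.
- by move=> m' la /inj ib; apply: lagr_moment_newton.
move=> k; apply: (@Wt_ext _ _ (fun la =>
  psumf t i (fun u => ('X^(k.+1) - ('X - t%:R%:P) ^+ k.+1).[u%:~R]) la + (i%:R - t%:R) ^+ k.+1)).
  by move=> la dd; rewrite runner_power_diff.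
apply: Wt_add; last by apply: Wt_cst; lia.
apply: Wt_psumf_poly => //; have [] := subXX_monic t%:R k.
by rewrite mul1r lez_nat.
Qed.

(** The difference (y (y + 1))^(k+1) - (y (y - 1))^(k+1) is odd in y, so it is half of its
    antisymmetrization, which is what [psumf0] sums at u = t y. The extra node, of part 0,
    contributes nothing as the exponent is positive. *)
Lemma strict_power_diff la k : is_dd la ->
  power_diff (fun j : 'I_(size (strict_quotient t la)).+1 =>
      oblong (nth 0%N (strict_quotient t la) j)%:R)
    (fun j : 'I_(size (strict_quotient t la)) =>
      oblong ((nth 0%N (strict_quotient t la) j)%:R - 1)) k.+1 =
  2^-1 * psumf t 0 (fun u => (((t%:R^-1 *: 'X) * (t%:R^-1 *: 'X + 1)) ^+ k.+1
     - ((t%:R^-1 *: 'X) * (t%:R^-1 *: 'X - 1)) ^+ k.+1 : {poly rat}).[u%:~R]) la.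
Proof.
move=> dd; rewrite psumf0 //; set Y := strict_quotient t la; rewrite /power_diff.
rewrite big_ord_recr /= nth_default // mulr0n /oblong mul0r expr0n /= addr0 -sumrB.
rewrite [RHS]mulr_sumr [RHS](big_nth 0%N) big_mkord; apply: eq_bigr => j _.
rewrite !(hornerD, hornerN, horner_exp, hornerM, hornerZ, hornerX, hornerC) rmorphN rmorphM /=.
rewrite -!pmulrn ?natrM !mulrN !mulKf //; move: (nth 0%N Y j)%:R => y.
have -> : (y - 1) * (y - 1 + 1) = y * (y - 1) by ring.
have -> : - y * (- y + 1) = y * (y - 1) by ring.
have -> : - y * (- y - 1) = y * (y + 1) by ring.
by field.
Qed.

Lemma strict_moment_Wt m :
  Wt t (2 * m%:Z) (avg (strict_moves t) (fun _ x => x ^+ m)).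
Proof.
pose b la (j : 'I_(size (strict_quotient t la)).+1) :=
  oblong (nth 0%N (strict_quotient t la) j)%:R.
pose a la (j : 'I_(size (strict_quotient t la))) :=
  oblong ((nth 0%N (strict_quotient t la) j)%:R - 1).
have E m' la : avg (strict_moves t) (fun _ x => x ^+ m') la = lagr_moment (b la) (a la) m'.
  by rewrite /avg big_map big_enum.
apply: (@Wt_ext _ _ (fun la => lagr_moment (b la) (a la) m)) => [la _|]; first by rewrite E.
have inj la : is_dd la -> injective (b la).
  by move=> dd; apply: oblong_inj; have [] := dd_quotient0 dd t_gt0.
apply: (@Wt_newton t 2 (fun m la => lagr_moment (b la) (a la) m)
         (fun m la => power_diff (b la) (a la) m)).
- by move=> la /inj ib; apply: lagr_moment0.
- by move=> m' la /inj ib; apply: lagr_moment_newton.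
move=> k.
apply: (@Wt_ext _ _ _ _ (fun la dd => esym (strict_power_diff k dd))).
apply: Wt_scale; apply: Wt_psumf_poly => //.
set A := _ * (_ + 1); set B := _ * (_ - 1).
(* The quadratic terms cancel, so A^(k+1) - B^(k+1) has degree at most 2 k + 1 instead of 2 k +
   2. *)
have AB : A - B = (2 * t%:R^-1) *: 'X.
  by rewrite /A /B -scalerA; move: (t%:R^-1 *: 'X) => p; rewrite scaler_nat; ring.
have sX : (size (t%:R^-1 *: 'X : {poly rat}) <= 2)%N.
  by apply: leq_trans (size_scale_leq _ _) _; rewrite size_polyX.
have sA : (size A <= 3)%N.
  apply: (@size_mul_leq _ _ 2 2) => //.
  by apply: leq_trans (size_polyD _ _) _; rewrite size_poly1 geq_max sX.
have sB : (size B <= 3)%N.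
  apply: (@size_mul_leq _ _ 2 2) => //.
  by apply: leq_trans (size_polyD _ _) _; rewrite size_polyN size_poly1 geq_max sX.
have sE (p : {poly rat}) n : (size p <= 3)%N -> (size (p ^+ n) <= (2 * n).+1)%N.
  move=> sp; apply: leq_trans (size_poly_exp_leq _ _) _; rewrite ltnS leq_mul2r.
  by apply/orP; right; lia.
rewrite subrXX AB lez_nat (_ : (2 * k.+1 = (2 + (2 * k).+1).-1)%N); last lia.
have h1 : (size ((2 * t%:R^-1) *: 'X : {poly rat}) <= 2)%N.
  by apply: leq_trans (size_scale_leq _ _) _; rewrite size_polyX.
apply: size_mul_leq => //.
apply: leq_trans (size_sum _ _ _) _; apply/bigmax_leqP => i _.
rewrite (_ : (2 * k).+1 = ((2 * (k.+1.-1 - i)).+1 + (2 * i).+1).-1)%N; last first.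
  by have := leq_ord i; lia.
by apply: size_mul_leq; apply: sE.
Qed.

Lemma runner_total_weight i la : is_dd la ->
  \sum_(p <- runner_moves t i la) p.1.1 = 1.
Proof.
move=> dd; rewrite big_map big_enum /=.
have inj := @bead_pos_inj t%:R (runner_shift t i la) (tquotient t i la)
  (runner_len t i la) tR0 (is_part_tquotient _ _ _).
rewrite -[RHS](lagr_moment0 (fun j => bead_pos t%:R (runner_shift t i la) (tquotient t i la) j - t%:R) inj).
by apply: eq_bigr => j _; rewrite expr0 mulr1.
Qed.

Lemma strict_total_weight la : is_dd la ->
  \sum_(p <- strict_moves t la) p.1.1 = 1.
Proof.
move=> dd; rewrite big_map big_enum /=.
have [_ /oblong_inj inj _ _] := dd_quotient0 dd t_gt0.
rewrite -[RHS](lagr_moment0 (fun j => oblong ((nth 0%N (strict_quotient t la) j)%:R - 1)) inj).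
by apply: eq_bigr => j _; rewrite expr0 mulr1.
Qed.

Lemma runner_movesP i la p : is_dd la -> p \in runner_moves t i la -> p.1.1 != 0 ->
  exists2 j : 'I_(runner_len t i la).+1, is_part (incr_nth (tquotient t i la) j) &
    p.1.2 = (runner_pos t i la j)%:~R /\ p.2 = runner_move t i la j.
Proof.
move=> dd /mapP[j _ ->] /=; rewrite (bead_pos_runner t_odd) => w0; exists j => //.
by apply: contraNT w0 => /bead_weight0 ->; rewrite ?is_part_tquotient.
Qed.

Lemma strict_movesP la p : is_dd la -> p \in strict_moves t la -> p.1.1 != 0 ->
  exists2 j : 'I_(size (strict_quotient t la)).+1, is_strict (incr_nth (strict_quotient t la) j) &
    p.1.2 = oblong (nth 0%N (strict_quotient t la) j)%:R /\ p.2 = strict_move t la j.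
Proof.
move=> dd /mapP[j _ ->] /= w0; exists j => //.
apply: contraNT w0 => /strict_weight0 -> //.
by have [] := dd_quotient0 dd t_gt0.
Qed.

Lemma mult_pow_delta moves a :
  mult_class t 1 moves (a%:Z - 1) (fun _ x => (x + t%:R) ^+ a - x ^+ a).
Proof.
case: a => [|k].
  apply: (@mult_ext _ _ _ _ (fun _ _ => 0)); last exact: mult_zero.
  by move=> la x _; rewrite !expr0 subrr.
have [sz _] := subXX_monic (- t%:R) k.
apply: (@mult_ext _ _ _ _ (fun _ x => -1 * ('X^(k.+1) - ('X - (- t%:R)%:P) ^+ k.+1).[x])).
  by move=> la x _; rewrite !(hornerD, hornerN, horner_exp, hornerX, hornerXn, hornerC) opprK mulN1r opprB.
apply: mult_scale; have -> : k.+1%:Z - 1 = 1 * k%:Z by lia.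
exact: (@mult_poly _ 1).
Qed.

Lemma runner_psum_delta i r a : (0 < i <= t./2)%N -> (r < t)%N ->
  has_delta t 1 (runner_moves t i) (a%:Z - 1) (psum t r a).
Proof.
move=> hi rt; have hd := @mult_pow_delta (runner_moves t i) a.
exists (fun la x => if r == i then (x + t%:R) ^+ a - x ^+ a
          else if r == (t - i)%N then - (-1) ^+ a * ((x + t%:R) ^+ a - x ^+ a) else 0).
  case: eqP => // _; case: eqP => // _; first exact: mult_scale.
  exact: mult_zero.
move=> la p dd hp w0; have [j pj [-> ->]] := runner_movesP dd hp w0.
rewrite /psum psumf_runner_move //; congr (_ + _).
case: eqP => // _; first by move: (runner_pos t i la j) => z; rewrite rmorphD.
case: eqP => // _; rewrite (_ : - runner_pos t i la j - t%:Z = - (runner_pos t i la j + t%:Z)).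
  move: (runner_pos t i la j) => z; rewrite !rmorphN rmorphD /=; move: (z%:~R) => x.
  by rewrite [(- x) ^+ a]exprNn [(- (x + _)) ^+ a]exprNn; ring.
by move: (runner_pos t i la j) => z; rewrite opprD.
Qed.

(** On runner 0 the increment is t^a (1 - (-1)^a) ((y + 1)^a - y^a). It vanishes for even a; for odd
    a it is 2 t^a ((y + 1)^a + (- y)^a), of degree (a - 1) / 2 in [oblong y]. *)
Lemma strict_psum_delta r a : (r < t)%N ->
  has_delta t 2 (strict_moves t) (a%:Z - 1) (psum t r a).
Proof.
move=> rt; have [P sP eP] := pow_sum_oblong a.
have hd := @mult_poly t 2 (strict_moves t) P _ isT sP.
exists (fun la x => if (r == 0%N) && odd a then (2 * t%:R ^+ a) * P.[x] else 0).
  case: (r == 0%N); last exact: mult_zero.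
  case oa : (odd a); last exact: mult_zero.
  by apply: mult_scale; apply: mult_mono hd; have := odd_double_half a; rewrite oa; lia.
move=> la p dd hp w0; have [j pj [-> ->]] := strict_movesP dd hp w0.
rewrite /psum psumf_strict_move //; congr (_ + _).
case: eqP => //= _; rewrite -eP; set y := nth _ _ _.
rewrite !rmorphN !rmorphM !rmorphD /= -!pmulrn; move: (y%:R) => {}y.
rewrite [(- (t%:R * (y + 1))) ^+ a]exprNn [(- (t%:R * y)) ^+ a]exprNn [(- y) ^+ a]exprNn.
rewrite -signr_odd !exprMn.
by case: (odd a); rewrite ?expr1 ?expr0; ring.
Qed.

Lemma Wt_runner_moves i d f : (0 < i <= t./2)%N -> Wt t d f ->
  exists2 f', Wt t (d - 2) f' & forall la, is_dd la ->
    \sum_(p <- runner_moves t i la) p.1.1 * f p.2 = f la + f' la.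
Proof.
move=> hi; apply: (@Wt_moves t 1).
- by move=> m; apply: runner_moment_Wt; lia.
- by move=> la; apply: runner_total_weight.
- move=> la p dd hp w0; have [j pj [_ ->]] := runner_movesP dd hp w0.
  by have [] := runner_moveP t_odd dd pj.
- by move=> r a; apply: runner_psum_delta.
Qed.

Lemma Wt_strict_moves d f : Wt t d f ->
  exists2 f', Wt t (d - 2) f' & forall la, is_dd la ->
    \sum_(p <- strict_moves t la) p.1.1 * f p.2 = f la + f' la.
Proof.
apply: (@Wt_moves t 2).
- exact: strict_moment_Wt.
- exact: strict_total_weight.
- move=> la p dd hp w0; have [j pj [_ ->]] := strict_movesP dd hp w0.
  by have [] := strict_moveP t_odd dd pj.
- by move=> r a; apply: strict_psum_delta.
Qed.

End Lowering.

(** * Neighbours *)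

Lemma containsP a b :
  reflect (forall i, nth 0 b i <= nth 0 a i)%N (contains a b).
Proof.
apply: (iffP allP) => h i.
  case: (ltnP i (size b)) => hi; last by rewrite nth_default.
  by have := h i.+1; rewrite mem_iota add1n ltnS /part /=; apply.
by rewrite mem_iota; case: i => // i _; apply: h.
Qed.

Lemma contains_trans b a c : contains a b -> contains b c -> contains a c.
Proof.
by move=> /containsP h1 /containsP h2; apply/containsP => i; apply: leq_trans (h1 i).
Qed.

Lemma contains_refl a : contains a a.
Proof. exact/containsP. Qed.

Lemma sumn_incr_nth s j : sumn (incr_nth s j) = (sumn s).+1.
Proof.
by elim: s j => [|x s IH] [|j] //=; rewrite ?IH ?addnS // sumn_ncons mul0n.
Qed.

Lemma contains_incr s j : contains (incr_nth s j) s.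
Proof. by apply/containsP => i; rewrite nth_incr_nth leq_addl. Qed.

Lemma eq_nth_notin0 (a b : seq nat) : 0%N \notin a -> 0%N \notin b ->
  (forall i, nth 0%N a i = nth 0%N b i) -> a = b.
Proof.
have le x y : 0%N \notin y -> (forall i, nth 0%N x i = nth 0%N y i) -> (size y <= size x)%N.
  move=> y0 e; rewrite leqNgt; apply/negP => h; case/negP: y0.
  by rewrite -(nth_default 0%N (leqnn (size x))) e mem_nth.
move=> a0 b0 e; apply: (@eq_from_nth _ 0%N) => //.
by apply/eqP; rewrite eqn_leq !le.
Qed.

Lemma sumn_contains a b : contains a b -> (sumn b <= sumn a)%N.
Proof.
move=> /containsP h; rewrite -(@sum_nth (size a + size b) a) ?leq_addr //.
by rewrite -(@sum_nth (size a + size b) b) ?leq_addl //; apply: leq_sum.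
Qed.

Lemma incr_notin0 (s : seq nat) (j : nat) : 0%N \notin s -> (j <= size s)%N -> 0%N \notin incr_nth s j.
Proof.
move=> s0 js; apply/negP => /(nthP 0%N)[i]; rewrite nth_incr_nth size_incr_nth.
case: (eqVneq j i) => [->//|/eqP ij]; rewrite add0n => hi e.
have hs : (i < size s)%N by move: hi; case: ifP; lia.
by case/negP: s0; rewrite -[X in X \in _]e; apply: mem_nth.
Qed.

Lemma contains_sumn_eq (a b : seq nat) : 0%N \notin a -> 0%N \notin b ->
  contains a b -> sumn a = sumn b -> a = b.
Proof.
move=> a0 b0 /containsP h e; apply: eq_nth_notin0 => // i.
case: (ltnP i (size a + size b)) => hi; last by rewrite !nth_default //; lia.
apply/eqP; rewrite eqn_leq h andbT leqNgt; apply/negP => lt.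
have : (sumn b < sumn a)%N; last by rewrite e ltnn.
rewrite -(@sum_nth (size a + size b) a) ?leq_addr // -(@sum_nth (size a + size b) b) ?leq_addl //.
rewrite (bigD1 (Ordinal hi)) //= [X in (_ < X)%N](bigD1 (Ordinal hi)) //=.
by rewrite -addSn leq_add // leq_sum.
Qed.

Lemma contains_sumnS (a b : seq nat) : 0%N \notin a -> 0%N \notin b ->
  contains a b -> sumn a = (sumn b).+1 ->
  exists2 j, (j <= size b)%N & a = incr_nth b j.
Proof.
move=> a0 b0 cab e; have /containsP h := cab.
have [j hj] : exists j, (nth 0 b j < nth 0 a j)%N.
  case: (boolP [exists j : 'I_(size a), (nth 0%N b j < nth 0%N a j)%N]).
    by move=> /existsP[j hj]; exists j.
  rewrite negb_exists => /forallP ge.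
  suff : (sumn a <= sumn b)%N by rewrite e ltnn.
  apply: sumn_contains; apply/containsP => i.
  case: (ltnP i (size a)) => hi; last by rewrite nth_default.
  by rewrite leqNgt; apply: (ge (Ordinal hi)).
have hjb : (j <= size b)%N.
  rewrite leqNgt; apply/negP => jb.
  have ja : (j < size a)%N by rewrite ltnNge; apply/negP => /(nth_default 0%N) e0; lia.
  have sa : (size b < size a)%N by apply: ltn_trans ja.
  have p1 : (0 < nth 0%N a (size b))%N.
    by rewrite lt0n; apply: contraNneq a0 => <-; rewrite mem_nth.
  have : (sumn b + 2 <= sumn a)%N; last by rewrite e; lia.
  rewrite -(@sum_nth (size a + size b) a) ?leq_addr // -(@sum_nth (size a + size b) b) ?leq_addl //.
  have h1 : (size b < size a + size b)%N by lia.
  have h2 : (j < size a + size b)%N by lia.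
  have ne : Ordinal h2 != Ordinal h1 by rewrite -(inj_eq val_inj) /=; lia.
  rewrite (bigD1 (Ordinal h1)) //= [X in (_ <= X)%N](bigD1 (Ordinal h1)) //=.
  rewrite (bigD1 (Ordinal h2)) //= [X in (_ <= _ + X)%N](bigD1 (Ordinal h2)) //=.
  rewrite [nth _ b (size b)]nth_default //.
  set s1 := \sum_(_ < _ | _) nth 0%N b _; set s2 := \sum_(_ < _ | _) nth 0%N a _.
  have : (s1 <= s2)%N by apply: leq_sum.
  by move: hj p1; lia.
exists j => //; apply: contains_sumn_eq => //; last by rewrite sumn_incr_nth.
  exact: incr_notin0.
apply/containsP => i; rewrite nth_incr_nth.
by case: (eqVneq j i) => [<-|_]; [exact: hj|exact: h].
Qed.


Lemma part_notin0 la : is_part la -> 0%N \notin la. Proof. by case/andP. Qed.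
Lemma strict_notin0 s : is_strict s -> 0%N \notin s. Proof. by case/andP. Qed.

Section Neighbours.

Variable t : nat.
Hypothesis t_odd : odd t.

Let t_gt0 : (0 < t)%N. Proof. exact: odd_gt0. Qed.

(** The size is the sum of the first power sums over all runners. A box of an ordinary component
    adds t on its runner and t on the mirror one; a box of the strict component adds 2 t on runner
    0. *)
Lemma quotient_size_tcore la nu : is_dd la -> is_dd nu -> tcore t nu = tcore t la ->
  (sumn nu + 2 * t * quotient_size t la = sumn la + 2 * t * quotient_size t nu)%N.
Proof.
move=> dl dn /(tcore_eqP dn dl t_gt0) ec.
have psN i mu : (0 < i < t)%N -> psumf t (t - i) intr mu = psumf t i intr mu.
  move=> hi; rewrite psumfN //.
  have -> : psumf t i (intr \o -%R) mu = psumf t i (fun u => -1 * intr u) mu.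
    by rewrite /psumf; congr (_ - _); apply: eq_bigr => x _; rewrite /= ?rmorphN ?mulN1r.
  by rewrite psumfZ mulN1r opprK.
have E mu : is_dd mu -> (sumn mu)%:R = psumf t 0 intr mu +
    \sum_(1 <= i < t./2.+1) (psumf t i intr mu + psumf t i intr mu).
  move=> dm; rewrite (sumn_dd dm).
  transitivity (\sum_(r < t) psumf t r intr mu).
    rewrite sum_psumf //; apply: eq_bigr => x _.
    by rewrite rmorphN /= opprK -!pmulrn.
  rewrite (sum_fold (fun r => psumf t r intr mu) t_odd); congr (_ + _).
  by apply: eq_big_nat => i hi; rewrite psN //; lia.
have E0 mu : is_dd mu -> psumf t 0 intr mu = 2 * t%:R * (sumn (strict_quotient t mu))%:R.
  move=> dm; rewrite psumf0 // sumnE natr_sum mulr_sumr; apply: eq_bigr => y _.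
  by rewrite rmorphN rmorphM /= -!pmulrn; ring.
have D : (sumn nu)%:R - (sumn la)%:R = 2 * t%:R *
    ((quotient_size t nu)%:R - (quotient_size t la)%:R) :> rat.
  rewrite (E la dl) (E nu dn) !E0 // /quotient_size !natrD !natr_sum.
  transitivity (2 * t%:R * ((sumn (strict_quotient t nu))%:R - (sumn (strict_quotient t la))%:R)
     + \sum_(1 <= i < t./2.+1) 2 * (psumf t i intr nu - psumf t i intr la)).
    rewrite mulrBr -mulr_sumr sumrB !big_split /=; ring.
  rewrite [in RHS]opprD [in RHS]addrACA [in RHS]mulrDr; congr (_ + _).
  rewrite -sumrB mulr_sumr; apply: eq_big_nat => i hi.
  by rewrite psumf_size ?ec ?mulrA //; lia.
apply/eqP; rewrite -(eqr_nat rat) !natrD !natrM; apply/eqP.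
have -> : (sumn nu)%:R = (sumn la)%:R + 2 * t%:R * ((quotient_size t nu)%:R - (quotient_size t la)%:R) :> rat.
  by rewrite -D addrC subrK.
ring.
Qed.

Definition strict_targets (la : seq nat) : seq (seq nat) :=
  [seq strict_move t la j | j <- iota 0 (size (strict_quotient t la)).+1
     & is_strict (incr_nth (strict_quotient t la) j)].

Definition runner_targets (la : seq nat) : seq (seq nat) :=
  [seq runner_move t i la j | i <- iota 1 t./2,
     j <- [seq j <- iota 0 (runner_len t i la).+1 | is_part (incr_nth (tquotient t i la) j)]].

Lemma quotient_size_incr (f g : nat -> nat) i : (0 < i <= t./2)%N ->
  (forall r, (0 < r <= t./2)%N -> g r = (f r + (r == i))%N) ->
  (\sum_(1 <= r < t./2.+1) g r = (\sum_(1 <= r < t./2.+1) f r).+1)%N.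
Proof.
move=> hi e; rewrite (eq_big_nat _ _ (F2 := fun r => (f r + (r == i))%N)); last first.
  by move=> r hr; apply: e.
rewrite big_split /= -[RHS]addn1; congr (_ + _)%N.
have ui : i \in index_iota 1 t./2.+1 by rewrite mem_index_iota.
rewrite (bigD1_seq i ui (iota_uniq _ _)) /= eqxx big1 // => r ri.
by rewrite (negbTE ri).
Qed.

(** By [quotient_size_tcore], adding 2 t boxes with the same core means one more box in the quotient
    data, hence in exactly one component, the containments excluding any compensation. *)
Lemma neighbours_perm la : is_dd la ->
  perm_eq [seq nu <- partitions (sumn la + 2 * t) | is_dd nu && ge_t t nu la]
          (strict_targets la ++ runner_targets la).
Proof.
move=> dl; set Y := strict_quotient t la.
have stY : is_strict Y by have [] := dd_quotient0 dl t_gt0.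
have qsize nu : is_dd nu -> tcore t nu = tcore t la ->
    (sumn nu = sumn la + 2 * t)%N <-> quotient_size t nu = (quotient_size t la).+1.
  by move=> dn ec; have := quotient_size_tcore dl dn ec; split; nia.
have inj_r i j i' j' : (0 < i <= t./2)%N -> (0 < i' <= t./2)%N ->
    is_part (incr_nth (tquotient t i la) j) -> is_part (incr_nth (tquotient t i' la) j') ->
    runner_move t i la j = runner_move t i' la j' -> i = i' /\ j = j'.
  move=> hi hi' p p' e; have [_ _ _ /(_ i hi)] := runner_moveP t_odd dl p.
  have [_ _ _ /(_ i hi)] := runner_moveP t_odd dl p'; rewrite e eqxx => ->.
  case: eqP => [-> /incr_nth_inj -> //|_ /(congr1 sumn)].
  by rewrite sumn_incr_nth; lia.
apply: uniq_perm.
- by rewrite filter_uniq // partitions_uniq.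
- rewrite cat_uniq; apply/and3P; split.
  + rewrite map_inj_in_uniq ?filter_uniq ?iota_uniq // => j j'.
    rewrite !mem_filter => /andP[p _] /andP[p' _] e.
    have [_ _ + _] := strict_moveP t_odd dl p; have [_ _ + _] := strict_moveP t_odd dl p'.
    by rewrite e => -> /incr_nth_inj.
  + apply/hasPn => nu /allpairsPdep[i [j []]]; rewrite mem_iota mem_filter => hi /andP[p _] ->.
    apply/negP => /mapP[j']; rewrite mem_filter => /andP[p' _] e.
    have [_ _ + _] := strict_moveP t_odd dl p'; have [_ _ + _] := runner_moveP t_odd dl p.
    by rewrite e => -> /(congr1 sumn); rewrite sumn_incr_nth; lia.
  + apply: allpairs_uniq_dep; first exact: iota_uniq.
      by move=> i _; rewrite filter_uniq ?iota_uniq.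
    move=> p q /allpairsPdep[i [j [hi hj ->]]] /allpairsPdep[i' [j' [hi' hj' ->]]] /= e.
    move: hi hi' hj hj'; rewrite !mem_iota !mem_filter => hi hi' /andP[p1 _] /andP[p2 _].
    by have [-> ->] := inj_r i j i' j' ltac:(lia) ltac:(lia) p1 p2 e.
move=> nu; rewrite mem_filter mem_partitions mem_cat; apply/idP/idP.
  move=> /andP[/andP[dn /and3P[/eqP ec cY /allP cL]] /andP[_ /eqP es]].
  have stN : is_strict (strict_quotient t nu) by have [] := dd_quotient0 dn t_gt0.
  have {}es := (qsize nu dn ec).1 es.
  have cL' i : (0 < i <= t./2)%N -> contains (tquotient t i nu) (tquotient t i la).
    by move=> hi; apply: cL; rewrite mem_iota; lia.
  have leY : (sumn Y <= sumn (strict_quotient t nu))%N by apply: sumn_contains.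
  have leL i : (0 < i <= t./2)%N -> (sumn (tquotient t i la) <= sumn (tquotient t i nu))%N.
    by move=> hi; apply: sumn_contains; apply: cL'.
  have n0 i mu : 0%N \notin tquotient t i mu by apply: part_notin0; apply: is_part_tquotient.
  have n0Y : 0%N \notin Y by apply: strict_notin0.
  have n0N : 0%N \notin strict_quotient t nu by apply: strict_notin0.
  have sp i mu : (0 < i <= t./2)%N -> (\sum_(1 <= r < t./2.+1) sumn (tquotient t r mu) =
     sumn (tquotient t i mu) + \sum_(1 <= r < t./2.+1 | r != i) sumn (tquotient t r mu))%N.
    by move=> hi; rewrite (bigD1_seq i) ?iota_uniq // mem_index_iota.
  have leR (P : pred nat) : (\sum_(1 <= r < t./2.+1 | P r) sumn (tquotient t r la)
      <= \sum_(1 <= r < t./2.+1 | P r) sumn (tquotient t r nu))%N.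
    rewrite big_nat_cond [X in (_ <= X)%N]big_nat_cond; apply: leq_sum => r /andP[hr _]; apply: leL; lia.
  have leT := leR xpredT.
  move: es; rewrite /quotient_size -/Y => es.
  case: (ltnP (sumn Y) (sumn (strict_quotient t nu))) => hY.
    have [j hj ej] : exists2 j, (j <= size Y)%N & strict_quotient t nu = incr_nth Y j.
      by apply: contains_sumnS => //; lia.
    have stj : is_strict (incr_nth Y j) by rewrite -ej.
    apply/orP; left; apply/mapP; exists j; first by rewrite mem_filter stj mem_iota /= add0n ltnS.
    have [dm em sm qm] := strict_moveP t_odd dl stj.
    apply: (dd_quotient_inj t_odd) => //; [by rewrite em|by rewrite sm|].
    move=> i hi; rewrite qm //; apply: contains_sumn_eq => //; first exact: cL'.
    by have := leL i hi; have := leR (fun r => r != i); move: es; rewrite !(sp i) //; lia.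
  have eY : strict_quotient t nu = Y by apply: contains_sumn_eq => //; lia.
  have [i hi lti] : exists2 i, (0 < i <= t./2)%N &
      (sumn (tquotient t i la) < sumn (tquotient t i nu))%N.
    case: (boolP (has (fun i => sumn (tquotient t i la) < sumn (tquotient t i nu))%N (iota 1 t./2))).
      by move=> /hasP[i]; rewrite mem_iota => hi lti; exists i => //; lia.
    move=> /hasPn ge; suff : (\sum_(1 <= r < t./2.+1) sumn (tquotient t r nu)
      <= \sum_(1 <= r < t./2.+1) sumn (tquotient t r la))%N by lia.
    rewrite big_nat_cond [X in (_ <= X)%N]big_nat_cond; apply: leq_sum => r /andP[hr _]; rewrite leqNgt; apply: ge.
    by rewrite mem_iota; lia.
  have les := leR (fun r => r != i).
  have [j hj ej] : exists2 j, (j <= size (tquotient t i la))%N &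
      tquotient t i nu = incr_nth (tquotient t i la) j.
    by apply: contains_sumnS => //; [exact: cL'|move: es; rewrite eY !(sp i) //; lia].
  have ptj : is_part (incr_nth (tquotient t i la) j) by rewrite -ej is_part_tquotient.
  apply/orP; right; apply/allpairsPdep; exists i, j; split.
  - by rewrite mem_iota; lia.
  - by rewrite mem_filter ptj mem_iota /= add0n ltnS (leq_trans hj) ?leq_addr.
  have [dm em sm qm] := runner_moveP t_odd dl ptj.
  apply: (dd_quotient_inj t_odd) => //; [by rewrite em|by rewrite sm|].
  move=> r hr; rewrite qm //; case: eqP => [->//|/eqP ri].
  apply: contains_sumn_eq => //; first exact: cL'.
  have spr mu : (\sum_(1 <= k < t./2.+1 | k != i) sumn (tquotient t k mu) =
     sumn (tquotient t r mu) + \sum_(1 <= k < t./2.+1 | (k != i) && (k != r)) sumn (tquotient t k mu))%N.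
    rewrite -big_filter (bigD1_seq r) ?filter_uniq ?iota_uniq //.
      by rewrite big_filter_cond.
    by rewrite mem_filter ri mem_index_iota.
  have := leR (fun k => (k != i) && (k != r)); have := leL r hr.
  by move: es; rewrite eY !(sp i) // !spr; lia.
case/orP.
  move=> /mapP[j]; rewrite mem_filter => /andP[stj _] ->.
  have [dm em sm qm] := strict_moveP t_odd dl stj.
  rewrite dm (dd_part dm) /ge_t em eqxx sm contains_incr /=; apply/andP; split.
    by apply/allP => i; rewrite mem_iota => hi; rewrite qm ?contains_refl //; lia.
  apply/eqP/(qsize _ dm em); rewrite /quotient_size sm sumn_incr_nth addSn.
  by congr (_ + _).+1; apply: eq_big_nat => i hi; rewrite qm //; lia.
move=> /allpairsPdep[i [j []]]; rewrite mem_iota mem_filter => hi /andP[ptj _] ->.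
have {}hi : (0 < i <= t./2)%N by lia.
have [dm em sm qm] := runner_moveP t_odd dl ptj.
rewrite dm (dd_part dm) /ge_t em eqxx sm contains_refl /=; apply/andP; split.
  apply/allP => r; rewrite mem_iota => hr; rewrite qm; last by lia.
  by case: eqP => [->|_]; [exact: contains_incr|exact: contains_refl].
apply/eqP/(qsize _ dm em); rewrite /quotient_size sm -addnS; congr (_ + _)%N.
apply: (quotient_size_incr hi) => r hr; rewrite qm //.
by case: eqP => [->|_]; rewrite ?sumn_incr_nth ?addn1 ?addn0.
Qed.

End Neighbours.

(** * The difference operator *)

Lemma hook_prod_neq0 mu : is_part mu -> (hook_prod mu)%:R != 0 :> rat.
Proof.
move=> pm; have E := hook_prod_beta pm (leqnn _); apply/eqP => h0.
have /eqP := E; rewrite h0 mul0r eq_sym; apply/negP/prodf_neq0 => i _.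
by rewrite pnatr_eq0 -lt0n fact_gt0.
Qed.

Lemma shifted_hook_prod_neq0 s : is_strict s -> (shifted_hook_prod s)%:R != 0 :> rat.
Proof.
move=> st; have E := shifted_hook_prod_beta st; apply/eqP => h0.
have /eqP := E; rewrite h0 mul0r eq_sym; apply/negP/prodf_neq0 => i _.
by rewrite pnatr_eq0 -lt0n fact_gt0.
Qed.

Section DifferenceOperator.

Variable t : nat.
Hypothesis t_odd : odd t.

Let t_gt0 : (0 < t)%N. Proof. exact: odd_gt0. Qed.
Let tR0 : t%:R != 0 :> rat. Proof. by rewrite pnatr_eq0 -lt0n t_gt0. Qed.

(** Ensures that the exponent of 2 in [G_t] is not a truncated difference. *)
Lemma strict_size_le la : is_dd la ->
  (size (strict_quotient t la) <= quotient_size t la)%N.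
Proof.
move=> dd; have [_ st _ _] := dd_quotient0 dd t_gt0.
apply: leq_trans (leq_addr _ _).
have := strict_notin0 st; elim: (strict_quotient t la) => //= x s IH.
by rewrite inE negb_or eq_sym => /andP[x0 /IH]; lia.
Qed.

Lemma hooks_neq0 la :
  \prod_(1 <= i < t./2.+1) (hook_prod (tquotient t i la))%:R != 0 :> rat.
Proof.
rewrite prodf_seq_neq0; apply/allP => i _ /=.
exact/hook_prod_neq0/is_part_tquotient.
Qed.

(** The power of 2 in [G_t] doubles exactly when [j] is an existing part, which is the factor in
    [shifted_hook_ratio]. *)
Lemma G_strict_move la (j : 'I_(size (strict_quotient t la)).+1) : is_dd la ->
  is_strict (incr_nth (strict_quotient t la) j) ->
  G_t t (strict_move t la j) = G_t t la * (t%:R^-1 * strict_weight j).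
Proof.
move=> dd stj; have [dn _ es eq] := strict_moveP t_odd dd stj.
have [_ st _ _] := dd_quotient0 dd t_gt0.
rewrite /G_t -(shifted_hook_ratio st stj) es.
have -> : quotient_size t (strict_move t la j) = (quotient_size t la).+1.
  rewrite /quotient_size es sumn_incr_nth addSn.
  by congr (_ + _).+1; apply: eq_big_nat => i hi; rewrite eq //; lia.
have -> : \prod_(1 <= i < t./2.+1) (hook_prod (tquotient t i (strict_move t la j)))%:R
    = \prod_(1 <= i < t./2.+1) (hook_prod (tquotient t i la))%:R :> rat.
  by apply: eq_big_nat => i hi; rewrite eq //; lia.
have h1 := hooks_neq0 la; have h2 := shifted_hook_prod_neq0 st.
have h3 := shifted_hook_prod_neq0 stj; have hs := strict_size_le dd.
have -> : 2%:R ^+ ((quotient_size t la).+1 - size (incr_nth (strict_quotient t la) j)) =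
   (if (j < size (strict_quotient t la))%N then 2 else 1)
   * 2%:R ^+ (quotient_size t la - size (strict_quotient t la)) :> rat.
  rewrite size_incr_nth; case: ltnP => h; first by rewrite subSn // exprS.
  by rewrite mul1r subSS (_ : nat_of_ord j = size (strict_quotient t la)) //; have := leq_ord j; lia.
have tq : t%:R ^+ quotient_size t la != 0 :> rat by rewrite expf_neq0.
move: h1 h2 h3 tq; rewrite exprS.
set P := \prod_(_ <= _ < _) _; set H := (shifted_hook_prod _)%:R.
set H' := (shifted_hook_prod _)%:R; set T := t%:R ^+ _.
set c := (if _ then _ else _); set E := 2%:R ^+ _.
move: (t%:R : rat) tR0 P H H' T c E => x x0 P H H' T c E h1 h2 h3 h4.
by field; rewrite x0 h1 h2 h3 h4.
Qed.

Lemma G_runner_move i la (j : 'I_(runner_len t i la).+1) : is_dd la ->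
  (0 < i <= t./2)%N -> is_part (incr_nth (tquotient t i la) j) ->
  G_t t (runner_move t i la j) = G_t t la *
    (2 / t%:R * bead_weight t%:R (runner_shift t i la) (tquotient t i la) j).
Proof.
move=> dd hi ptj; have [dn _ es eq] := runner_moveP t_odd dd ptj.
have pt := is_part_tquotient t i la.
rewrite /G_t -(hook_ratio _ tR0 pt _ ptj) ?leq_addr // es.
have -> : quotient_size t (runner_move t i la j) = (quotient_size t la).+1.
  rewrite /quotient_size es -addnS; congr (_ + _)%N.
  apply: (quotient_size_incr hi) => r hr; rewrite eq //.
  by case: eqP => [->|_]; rewrite ?sumn_incr_nth ?addn1 ?addn0.
have ui : i \in index_iota 1 t./2.+1 by rewrite mem_index_iota.
rewrite ![\prod_(_ <= _ < _) _](bigD1_seq i ui (iota_uniq _ _)) /= eq // eqxx.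
have -> : \prod_(1 <= r < t./2.+1 | r != i) (hook_prod (tquotient t r (runner_move t i la j)))%:R
    = \prod_(1 <= r < t./2.+1 | r != i) (hook_prod (tquotient t r la))%:R :> rat.
  rewrite big_nat_cond [RHS]big_nat_cond; apply: eq_bigr => r /andP[hr ri].
  by rewrite eq ?(negbTE ri) //; lia.
have h1 : \prod_(1 <= r < t./2.+1 | r != i) (hook_prod (tquotient t r la))%:R != 0 :> rat.
  rewrite prodf_seq_neq0; apply/allP => r _; apply/implyP => _.
  exact/hook_prod_neq0/is_part_tquotient.
have h2 := hook_prod_neq0 pt; have h3 := hook_prod_neq0 ptj.
have [_ st _ _] := dd_quotient0 dd t_gt0.
have h5 := shifted_hook_prod_neq0 st; have hs := strict_size_le dd.
rewrite subSn // !exprS.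
have tq : t%:R ^+ quotient_size t la != 0 :> rat by rewrite expf_neq0.
move: h1 h2 h3 h5 tq.
set P := \prod_(_ <= _ < _ | _) _; set S := (shifted_hook_prod _)%:R.
set H := (hook_prod (tquotient _ _ _))%:R; set H' := (hook_prod (incr_nth _ _))%:R.
set T := t%:R ^+ _; set E := 2%:R ^+ _.
move: (t%:R : rat) tR0 P H H' S T E => x x0 P H H' S T E h1 h2 h3 h4 h5.
by field; rewrite x0 h1 h2 h3 h4 h5.
Qed.

(** The sums on the right run over all rows: where no box can be added, the weight is 0. *)
Lemma sum_neighbours (g f : seq nat -> rat) la : is_dd la ->
  (forall nu, is_dd nu -> g nu = G_t t nu * f nu) ->
  \sum_(nu <- partitions (sumn la + 2 * t) | is_dd nu && ge_t t nu la) g nu =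
  G_t t la * (t%:R^-1 * (\sum_(p <- strict_moves t la) p.1.1 * f p.2)
    + 2 / t%:R * \sum_(i <- iota 1 t./2) \sum_(p <- runner_moves t i la) p.1.1 * f p.2).
Proof.
move=> dd gf; have [_ st _ _] := dd_quotient0 dd t_gt0.
rewrite -big_filter (perm_big _ (neighbours_perm t_odd dd)) big_cat mulrDr.
congr (_ + _).
  rewrite /strict_targets [LHS]big_map [LHS]big_filter [LHS]big_mkcond [LHS]big_iota_ord.
  rewrite [in RHS]big_map [in RHS]big_enum /=.
  rewrite mulrA mulr_sumr; apply: eq_bigr => j _; rewrite add0n.
  case: ifPn => [stj|/strict_weight0 ->] //; last by rewrite mul0r mulr0.
  have [dn _ _ _] := strict_moveP t_odd dd stj.
  by rewrite gf // G_strict_move //; ring.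
rewrite /runner_targets big_allpairs_dep mulrA mulr_sumr.
apply: eq_big_seq => i; rewrite mem_iota => hi.
rewrite [LHS]big_filter [LHS]big_mkcond [LHS]big_iota_ord [in RHS]big_map [in RHS]big_enum /=.
rewrite mulr_sumr; apply: eq_bigr => j _; rewrite add0n.
case: ifPn => [ptj|npt]; last by rewrite bead_weight0 ?is_part_tquotient // mul0r mulr0.
have [dn _ _ _] := runner_moveP t_odd dd ptj.
by rewrite gf // G_runner_move //; ring.
Qed.

(** Stated for every [g] equal to G f on doubled distinct partitions, because an iterate of [D_t]
    has this form only there. *)
Lemma Wt_D_t d f : Wt t d f -> exists2 f', Wt t (d - 2) f' &
  forall g, (forall nu, is_dd nu -> g nu = G_t t nu * f nu) ->
  forall la, is_dd la -> D_t t g la = G_t t la * f' la.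
Proof.
move=> wf; have [f0 w0 e0] := Wt_strict_moves t_odd wf.
have [f1 w1 e1] : exists2 f1, Wt t (d - 2) f1 & forall la, is_dd la ->
    \sum_(i <- iota 1 t./2) \sum_(p <- runner_moves t i la) p.1.1 * f p.2
    = (t./2)%:R * f la + f1 la.
  have : forall i, i \in iota 1 t./2 -> (0 < i <= t./2)%N by move=> i; rewrite mem_iota; lia.
  have -> : (t./2)%:R = (size (iota 1 t./2))%:R :> rat by rewrite size_iota.
  elim: (iota 1 t./2) => [|i s IH] hs.
    exists (fun=> 0); first exact: Wt_zero.
    by move=> la _; rewrite big_nil mul0r addr0.
  have [|fs ws es] := IH; first by move=> r hr; apply: hs; rewrite inE hr orbT.
  have [|fi wi ei] := @Wt_runner_moves t t_odd i d f _ wf; first by apply: hs; rewrite mem_head.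
  exists (fun la => fi la + fs la); first exact: Wt_add.
  by move=> la dd; rewrite big_cons ei // es // /= -natr1; ring.
exists (fun la => t%:R^-1 * f0 la + 2 / t%:R * f1 la).
  by apply: Wt_add; apply: Wt_scale.
move=> g gf la dd; rewrite /D_t (sum_neighbours dd gf) e0 // e1 // gf //.
have e : t%:R = 2 * (t./2)%:R + 1 :> rat.
  have := congr1 (fun n => n%:R : rat) (odd_double_half t).
  by rewrite t_odd -addnn !natrD => <- /=; ring.
have -> : (t./2)%:R = (t%:R - 1) / 2 :> rat by rewrite e; field.
by field.
Qed.

Lemma D_t_ext g h : (forall nu, is_dd nu -> g nu = h nu) ->
  forall la, is_dd la -> D_t t g la = D_t t h la.
Proof.
move=> gh la dd; rewrite /D_t gh //; congr (_ - _).
by apply: eq_bigr => nu /andP[dn _]; rewrite gh.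
Qed.

Lemma iter_D_t_ext r g h : (forall nu, is_dd nu -> g nu = h nu) ->
  forall la, is_dd la -> iter r (D_t t) g la = iter r (D_t t) h la.
Proof. by move=> gh; elim: r => //= r IH la; apply: D_t_ext. Qed.

Lemma Wt_iter_D_t r d f : Wt t d f -> exists2 f', Wt t (d - (2 * r)%:Z) f' &
  forall la, is_dd la -> iter r (D_t t) (fun nu => G_t t nu * f nu) la = G_t t la * f' la.
Proof.
move=> wf; elim: r => [|r [fr wr er]]; first by exists f; rewrite ?subr0.
have [f' w' e'] := Wt_D_t wr; exists f'.
  by apply: Wt_mono w'; lia.
by move=> la dd; rewrite iterS; apply: e'.
Qed.

Lemma iter_D_t_eq0 r d f la : Wt t d f -> d < (2 * r)%:Z -> is_dd la ->
  iter r (D_t t) (fun nu => G_t t nu * f nu) la = 0.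
Proof.
move=> wf hd dd; have [f' w' ->] // := Wt_iter_D_t r wf.
by rewrite (Wt_neg w') ?mulr0 //; lia.
Qed.

(** * Sums weighted by the number of chains *)

Lemma ge_t_refl la : ge_t t la la.
Proof. by rewrite /ge_t eqxx contains_refl; apply/allP => i _; apply: contains_refl. Qed.

Lemma ge_t_trans nu la mu : ge_t t la nu -> ge_t t nu mu -> ge_t t la mu.
Proof.
move=> /and3P[/eqP e1 c1 /allP h1] /and3P[/eqP e2 c2 /allP h2]; apply/and3P; split.
- by rewrite e1 e2.
- exact: contains_trans c2.
- by apply/allP => i hi; apply: contains_trans (h2 i hi); apply: h1.
Qed.

Lemma ge_t_sumn_eq la mu : is_dd la -> is_dd mu -> ge_t t la mu ->
  sumn la = sumn mu -> la = mu.
Proof.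
move=> dl dm /and3P[/eqP ec cY /allP cL] es.
have := quotient_size_tcore t_odd dm dl ec; rewrite es => /addnI /eqP.
rewrite eqn_pmul2l ?muln_gt0 // => /eqP; rewrite /quotient_size => eq.
have cL' i : (0 < i <= t./2)%N -> contains (tquotient t i la) (tquotient t i mu).
  by move=> hi; apply: cL; rewrite mem_iota; lia.
have leY := sumn_contains cY.
have leR (P : pred nat) : (\sum_(1 <= r < t./2.+1 | P r) sumn (tquotient t r mu)
    <= \sum_(1 <= r < t./2.+1 | P r) sumn (tquotient t r la))%N.
  rewrite big_nat_cond [X in (_ <= X)%N]big_nat_cond; apply: leq_sum => r /andP[hr _].
  by apply/sumn_contains/cL'; lia.
have n0 i nu : 0%N \notin tquotient t i nu by apply/part_notin0/is_part_tquotient.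
have [_ /strict_notin0 sl _ _] := dd_quotient0 dl t_gt0.
have [_ /strict_notin0 sm _ _] := dd_quotient0 dm t_gt0.
apply: (dd_quotient_inj t_odd) => //.
  by apply: contains_sumn_eq => //; have := leR xpredT; lia.
move=> i hi; apply: contains_sumn_eq => //; first exact: cL'.
have ui : i \in index_iota 1 t./2.+1 by rewrite mem_index_iota.
move: eq; rewrite !(bigD1_seq i ui (iota_uniq _ _)) /=.
by have := leR (fun r => r != i); have := sumn_contains (cL' i hi); lia.
Qed.

Definition F_sum (g : seq nat -> rat) (mu : seq nat) (n : nat) : rat :=
  \sum_(la <- partitions (sumn mu + 2 * n * t) | is_dd la && ge_t t la mu)
     (F_t t la mu)%:R * g la.

Lemma F_sum0 g mu : is_dd mu -> F_sum g mu 0 = g mu.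
Proof.
move=> dm; rewrite /F_sum muln0 mul0n addn0 big_mkcond.
have mup : mu \in partitions (sumn mu) by rewrite mem_partitions dd_part /=.
rewrite (bigD1_seq mu mup (partitions_uniq _)) /= dm ge_t_refl F_tE // eqxx mul1r.
rewrite big1_seq ?addr0 // => la /andP[ne]; rewrite mem_partitions => /andP[_ /eqP es].
case: ifP => // /andP[dl h]; case/eqP: ne; exact: ge_t_sumn_eq.
Qed.

Lemma F_t_rec n la mu : is_dd la -> sumn la = (sumn mu + 2 * n.+1 * t)%N ->
  F_t t la mu = (\sum_(nu <- partitions (sumn mu + 2 * n * t)
    | [&& is_dd nu, ge_t t la nu & ge_t t nu mu]) F_t t nu mu)%N.
Proof.
have t0 := t_gt0; move=> dl es; rewrite F_tE // ifN; last first.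
  by apply/eqP => e; move: es; rewrite e; lia.
have -> : (sumn la - 2 * t = sumn mu + 2 * n * t)%N by rewrite es; lia.
rewrite big_seq_cond [RHS]big_seq_cond; apply: eq_bigl => nu.
case: (boolP (nu \in _)) => //; rewrite mem_partitions => /andP[_ /eqP en].
have -> : (sumn la == sumn nu + 2 * t)%N by rewrite es en; apply/eqP; lia.
by [].
Qed.

(** Chains are cut at the partition nu before their last step. After exchanging the sums, the inner
    sum over la is [D_t t g nu + g nu]. *)
Lemma F_sumS g mu n : is_dd mu -> F_sum g mu n.+1 = F_sum g mu n + F_sum (D_t t g) mu n.
Proof.
move=> dm; rewrite /F_sum -big_split /=.
set A := partitions (sumn mu + 2 * n.+1 * t); set B := partitions (sumn mu + 2 * n * t).
transitivity (\sum_(la <- A | is_dd la && ge_t t la mu) \sum_(nu <- B |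
    [&& is_dd nu, ge_t t la nu & ge_t t nu mu]) (F_t t nu mu)%:R * g la).
  rewrite big_seq_cond [RHS]big_seq_cond; apply: eq_bigr => la.
  rewrite mem_partitions => /andP[/andP[_ /eqP es] /andP[dl _]].
  by rewrite (F_t_rec dl es) natr_sum mulr_suml.
rewrite (exchange_big_dep (fun nu => is_dd nu && ge_t t nu mu)) /=; last first.
  by move=> la nu _ /and3P[-> _ ->].
rewrite big_seq_cond [RHS]big_seq_cond; apply: eq_bigr => nu.
rewrite mem_partitions => /andP[/andP[_ /eqP en] /andP[dn hn]].
have -> : A = partitions (sumn nu + 2 * t) by rewrite en; congr partitions; lia.
rewrite -mulrDr /D_t addrC subrK mulr_sumr; apply: eq_bigl => la.
rewrite dn hn andbT -andbA; congr andb.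
by apply/andP/idP => [[]//|h]; split=> //; apply: ge_t_trans h hn.
Qed.

Lemma F_sum_poly r g mu : (forall la, is_dd la -> iter r (D_t t) g la = 0) ->
  is_dd mu -> exists2 p : {poly rat}, (size p <= r)%N & forall n, F_sum g mu n = p.[n%:R].
Proof.
elim: r g => [|r IH] g gr dm.
  exists 0 => [|n]; first by rewrite size_poly0.
  by rewrite horner0 /F_sum big1 // => la /andP[dl _]; have /= -> := gr la dl; rewrite mulr0.
have [|p sp ep] := IH (D_t t g) _ dm.
  by move=> la dl; rewrite -(gr la dl) iterSr.
have [q sq eq] := antidifference p (oner_neq0 rat).
(* [antidifference] gives a backward difference, hence the shift by 1; the constant adjusts the
   value at 0 to [F_sum0]. *)
pose P := q \Po ('X - 1%:P) + (g mu - q.[-1])%:P.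
have hP x : P.[x] = q.[x - 1] + (g mu - q.[-1]).
  by rewrite hornerD horner_comp hornerXsubC hornerC.
exists P => [|n].
  rewrite (leq_trans (size_polyD _ _)) // geq_max size_comp_poly2 ?size_XsubC //.
  by rewrite (leq_trans sq) ?ltnS // (leq_trans (size_polyC_leq1 _)).
rewrite hP; elim: n => [|n IHn]; first by rewrite F_sum0 // sub0r addrC subrK.
rewrite F_sumS // IHn ep -eq -natr1 addrK; ring.
Qed.

End DifferenceOperator.

Theorem corollary4p8
  (t : nat) (t_odd : odd t) (u' v' : nat)
  (j k : 'I_u' -> nat) (j' k' : 'I_v' -> nat)
  (alpha : seq nat) (alpha_dd : is_dd alpha) (alpha_core : is_tcore t alpha) :
  (exists r : nat, forall la : seq nat, is_dd la -> tcore t la = alpha ->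
     iter r (D_t t) (fun nu => G_t t nu
                     * (\prod_(u < u') hook_sum t (j u) (k u) nu)
                     * (\prod_(v < v') content_sum t (j' v) (k' v) nu)) la = 0)
  /\
  (forall mu : seq nat, is_dd mu ->
     exists p : {poly rat},
       (size p).-1%:R <= \sum_(u < u') (k u + 1)%:R
                         + \sum_(v < v') (k' v + 2)%:R / 2%:R :> rat
       /\ forall n : nat,
            \sum_(la <- partitions (sumn mu + 2 * n * t)
                    | is_dd la && ge_t t la mu)
               (F_t t la mu)%:R * G_t t la
               * (\prod_(u < u') hook_sum t (j u) (k u) la)
               * (\prod_(v < v') content_sum t (j' v) (k' v) la)
            = p.[n%:R]).
Proof.
pose f nu := (\prod_(u < u') hook_sum t (j u) (k u) nu)
  * (\prod_(v < v') content_sum t (j' v) (k' v) nu).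
(* Twice the announced bound on the degree, since one application of [D_t] costs weight 2. *)
pose w := (\sum_(u < u') 2 * (k u).+1 + \sum_(v < v') (k' v).+2)%N.
have wf : Wt t w%:Z f.
  rewrite /w PoszD !(big_morph Posz PoszD (erefl 0%:Z)); apply: Wt_mul.
    by apply: Wt_prod => u; apply: Wt_hook_sum (odd_gt0 t_odd) _ _.
  by apply: Wt_prod => v; apply: Wt_content_sum (odd_gt0 t_odd) _ _.
(* As w < 2 ([w./2] + 1), this many steps make the weight negative; the resulting polynomial has
   degree at most [w./2]. *)
have vanish nu : is_dd nu -> iter w./2.+1 (D_t t) (fun la => G_t t la * f la) nu = 0.
  by apply: iter_D_t_eq0 wf _; lia.
split.
  exists w./2.+1 => la dl _; rewrite -(vanish la dl).
  by apply: iter_D_t_ext dl => nu _; rewrite -mulrA.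
move=> mu dm; have [p sp ep] := F_sum_poly t_odd vanish dm; exists p; split; last first.
  by move=> n; rewrite -ep; apply: eq_bigr => la _; rewrite /f !mulrA.
have sp2 : (2 * (size p).-1 <= w)%N by lia.
suff -> : \sum_(u < u') (k u + 1)%:R + \sum_(v < v') (k' v + 2)%:R / 2 = w%:R / 2 :> rat.
  by rewrite ler_pdivlMr // -natrM ler_nat mulnC.
rewrite /w natrD !natr_sum mulrDl !mulr_suml; congr (_ + _); apply: eq_bigr => i _.
  by rewrite natrM addn1 mulrC mulKf.
by rewrite addn2.
Qed.
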